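(* Let $M=\mathbb{T}^3_A$ be the hyperbolic torus attached to a matrix $A\in\mathrm{SL}(2,\mathbb{Z})$ with $\mathrm{tr}(A)>2$ and irrational eigenvalues $\lambda,\lambda^{-1}$, let $X$ be the vector field on $M$ induced by $\lambda^t\left(\frac{\partial}{\partial x}+a\frac{\partial}{\partial y}\right)$, where $(1,a)$ is an eigenvector of $A$ for $\lambda$, and let $\rho:\mathbb{Z}\to\mathrm{Diff}(M)$, $\rho(n)=\phi^X_n$, be the discrete flow of $X$. Then the cohomology of the complex $\Omega(M)_\rho$ of $\rho$-co-invariant forms satisfies $$\mathrm{H}^0(\Omega(M)_\rho)=0,\qquad \mathrm{H}^3(\Omega(M)_\rho)=0,$$ while $\mathrm{H}^1(\Omega(M)_\rho)$ and $\mathrm{H}^2(\Omega(M)_\rho)$ are infinite-dimensional real vector spaces. Moreover $\mathrm{H}^p(\mathcal{C}_\tau(M))\simeq \mathrm{H}^p(\Omega(M)_\rho)$ for all $p$, where $\mathcal{C}_\tau(M)$ is the complex of divergence forms of $X$; in particular $\mathrm{H}^1(\mathcal{C}_\tau(M))$ and $\mathrm{H}^2(\mathcal{C}_\tau(M))$ are infinite-dimensional.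
   Context: Hyperbolic torus: let $A\in\mathrm{SL}(2,\mathbb{Z})$ with $\mathrm{tr}(A)>2$. Then $A=PDP^{-1}$ with $P\in\mathrm{GL}(2,\mathbb{R})$, $D=\mathrm{diag}(\lambda,\lambda^{-1})$, $\lambda>0$, $\lambda\neq1$. For $t\in\mathbb{R}$ put $D^t=\mathrm{diag}(\lambda^t,\lambda^{-t})$ and $A^t=PD^tP^{-1}$. Let $G_3=\mathbb{R}^2\rtimes\mathbb{R}$ be the semidirect product for the homomorphism $\mathbb{R}\to\mathrm{Aut}(\mathbb{R}^2)$, $t\mapsto A^t$, i.e. $(u,t)(u',t')=(u+A^tu',t+t')$, and let $\Gamma_3=\mathbb{Z}^2\rtimes\mathbb{Z}\subset G_3$. Then $\mathbb{T}^3_A:=\Gamma_3\backslash G_3$, a compact smooth $3$-manifold. The eigenvalue $\lambda$ is assumed irrational. With $(x,y,t)$ the coordinates on $G_3=\mathbb{R}^2\times\mathbb{R}$, the vector field $\lambda^t\left(\frac{\partial}{\partial x}+a\frac{\partial}{\partial y}\right)$ is left invariant on $G_3$ and hence descends to $\mathbb{T}^3_A$. Its flow is denoted $\phi^X_s$, $s\in\mathbb{R}$. Co-invariant forms: $\Omega^p(M)$ denotes the smooth real $p$-forms on the compact manifold $M$. $\Omega^p(M)_\rho:=\mathrm{span}\{\omega-\rho(n)^*\omega : n\in\mathbb{Z},\ \omega\in\Omega^p(M)\}$ (which equals $\{\omega-(\phi_1^X)^*\omega:\omega\in\Omega^p(M)\}$). $\Omega(M)_\rho=\bigoplus_p\Omega^p(M)_\rho$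 is a subcomplex of the de Rham complex $(\Omega(M),d)$, and $\mathrm{H}^p(\Omega(M)_\rho)$ is its degree $p$ cohomology. Divergence forms: $\mathcal{C}^p_\tau(M):=\{L_X\omega:\omega\in\Omega^p(M)\}$, where $L_X$ is the Lie derivative and $\tau:\mathbb{R}\to\{\text{vector fields on }M\}$ is the Lie algebra homomorphism with $\tau(1)=X$. $\mathcal{C}_\tau(M)=\bigoplus_p\mathcal{C}^p_\tau(M)$ is a subcomplex of the de Rham complex, with degree $p$ cohomology $\mathrm{H}^p(\mathcal{C}_\tau(M))$. *)

(* Defs.v *)
From HB Require Import structures.
From mathcomp Require Import all_boot all_order all_algebra.
From mathcomp Require Import all_classical all_reals all_analysis.

Set Implicit Arguments.
Unset Strict Implicit.
Unset Printing Implicit Defensive.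

Import Order.TTheory GRing.Theory Num.Theory.
Import numFieldNormedType.Exports.

Local Open Scope classical_set_scope.
Local Open Scope ring_scope.

Section LinearAlgebra.
Variable (K : fieldType).
Implicit Types V W : lmodType K.

Definition lspan V (S : set V) : {pred V} := fun x => `[<
  exists (n : nat) (c : 'I_n -> K) (e : 'I_n -> V),
    (forall i, S (e i)) /\ x = \sum_(i < n) c i *: e i >].

Lemma lspan_submod_closed V (S : set V) : submod_closed (lspan S).
Proof.
split=> [|k x y /asboolP[n [c [e [Se ->]]]] /asboolP[m [d [f [Sf ->]]]]].
  apply/asboolP; exists 0, (fun=> 0), (fun=> 0).
  by split=> [[]//|]; rewrite big_ord0.
apply/asboolP; exists (n + m)%N.
exists (fun i => match fintype.split i with inl j => k * c j | inr j => d j end).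
exists (fun i => match fintype.split i with inl j => e j | inr j => f j end).
split=> [i|]; first by case: (fintype.split i).
rewrite big_split_ord/= scaler_sumr; congr (_ + _); apply: eq_bigr => i _.
  by rewrite -[lshift _ _]/(unsplit (inl i)) unsplitK scalerA.
by rewrite -[rshift _ _]/(unsplit (inr i)) unsplitK.
Qed.

HB.instance Definition _ V (S : set V) :=
  GRing.isSubmodClosed.Build K V (lspan S) (lspan_submod_closed S).

Lemma lspan_id V (S : set V) : S 0 ->
  (forall k x y, S x -> S y -> S (k *: x + y)) ->
  forall x, (x \in lspan S) = `[< S x >].
Proof.
move=> S0 SD x; apply/asboolP/asboolP => [[n [c [e [Se ->]]]]|Sx]; last first.
  by exists 1%N, (fun=> 1), (fun=> x); rewrite big_ord1 scale1r.
elim: n c e Se => [|n IH] c e Se; first by rewrite big_ord0.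
by rewrite big_ord_recl; apply: SD => //; apply: IH => i; apply: Se.
Qed.

(* The quotient Z / (Z `&` B), as an lmodType.  Linear spans make it total in
   Z and B; when Z and B are linear subspaces the spans are Z and B themselves
   (lspan_id), and when moreover B `<=` Z this is Z / B. *)
Section SubQuotient.
Variables (V : lmodType K) (Z B : set V).

Definition subspace : Type := {z : V | z \in lspan Z}.
HB.instance Definition _ := SubChoice.on subspace.
HB.instance Definition _ := [SubChoice_isSubLmodule of subspace by <:].

Definition relators : {pred subspace} := fun z => val z \in lspan B.

Lemma relators_submod_closed : submod_closed relators.
Proof.
split=> [|k x y xB yB]; first by rewrite unfold_in raddf0 rpred0.
by rewrite unfold_in linearP rpredD// rpredZ.
Qed.

HB.instance Definition _ :=
  GRing.isSubmodClosed.Build K subspace relators relators_submod_closed.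

Definition subquot : Type := Quotient.quot relators.
HB.instance Definition _ := GRing.Zmodule.on subquot.

Local Open Scope quotient_scope.

Local Notation Q := (Quotient.quot relators).

Let scale (k : K) (x : subquot) : subquot := \pi_Q (k *: repr (x : Q)).

Let scale_pi k (x : subspace) : scale k (\pi_Q x) = \pi_Q (k *: x).
Proof.
apply/eqP; rewrite /scale -Quotient.idealrBE -scalerBr rpredZ//.
by rewrite Quotient.idealrBE reprK.
Qed.

Let reprQK (x : subquot) : \pi_Q (repr (x : Q)) = x := reprK x.

Let scaleA k l x : scale k (scale l x) = scale (k * l) x.
Proof. by rewrite -(reprQK x) !scale_pi scalerA. Qed.

Let scale1 : left_id 1 scale.
Proof. by move=> x; rewrite -(reprQK x) scale_pi scale1r. Qed.

Let scaleDr : right_distributive scale +%R.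
Proof.
move=> k x y; rewrite -(reprQK x) -(reprQK y) -[LHS]/(scale k (\pi_Q _ + \pi_Q _)).
by rewrite -raddfD !scale_pi scalerDr raddfD.
Qed.

Let scaleDl x : {morph scale^~ x : k l / k + l}.
Proof. by move=> k l; rewrite -(reprQK x) !scale_pi scalerDl raddfD. Qed.

HB.instance Definition _ := GRing.Zmodule_isLmodule.Build K subquot
  scaleA scale1 scaleDr scaleDl.

End SubQuotient.

Definition infinite_dimensional V : Prop :=
  ~ exists (n : nat) (e : 'I_n -> V),
      forall x, exists c : 'I_n -> K, x = \sum_(i < n) c i *: e i.

Definition lmod_isomorphic V W : Prop := exists f : {linear V -> W}, bijective f.

End LinearAlgebra.

(* Differential forms on the vector space E = R^(n+1). *)
Section DifferentialForms.
Variables (R : realType) (n : nat).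
Local Notation E := 'rV[R]_n.+1.

Fixpoint differentiable_upto (k : nat) (f : E -> R^o) : Prop :=
  if k is k'.+1 then
    (forall x, differentiable f x) /\
    (forall v, differentiable_upto k' (fun x => 'D_v f x))
  else True.

(* C^oo: all iterated directional derivatives are Frechet differentiable. *)
Definition smooth (f : E -> R^o) : Prop := forall k, differentiable_upto k f.

(* The p tangent vectors fed to a p-form are the rows of a p x (n+1) matrix;
   a 0-form is a function, since there is a single 0 x (n+1) matrix. *)
Definition pform (p : nat) : Type := E -> 'M[R]_(p, n.+1) -> R^o.
HB.instance Definition _ p := GRing.Lmodule.on (pform p).

Definition multilinear p (f : 'M[R]_(p, n.+1) -> R^o) : Prop :=
  forall (i : 'I_p) (u v w : 'M[R]_(p, n.+1)) (b c : R),
    row i u = b *: row i v + c *: row i w ->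
    row' i v = row' i u -> row' i w = row' i u ->
    f u = b *: f v + c *: f w.

Definition alternating p (f : 'M[R]_(p, n.+1) -> R^o) : Prop :=
  forall (u : 'M[R]_(p, n.+1)) (i j : 'I_p),
    i != j -> row i u = row j u -> f u = 0.

Definition smooth_form p (w : pform p) : Prop :=
  [/\ forall x, multilinear (w x), forall x, alternating (w x)
    & forall v, smooth (fun x => w x v)].

(* [jacobian f x] acts on the right of row vectors: v *m jacobian f x is the
   tuple of the images of the rows of v under the differential of f at x. *)
Definition pullback p (f : E -> E) (w : pform p) : pform p :=
  fun x v => w (f x) (v *m jacobian f x).

(* The invariant formula for d on constant vector fields, whose brackets
   vanish; normalized without the factor 1 / (p + 1). *)
Definition ext_deriv p (w : pform p) : pform p.+1 :=
  fun x v => \sum_(i < p.+1)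
    (-1) ^+ i *: 'D_(row i v) (fun y => w y (row' i v)) x.

Definition is_flow (X : E -> E) (phi : R -> E -> E) : Prop :=
  (forall x, phi 0 x = x) /\
  (forall x (s : R), is_derive s 1 (fun s : R => phi s x) (X (phi s x))).

(* L_X w = d/ds (phi_s^* w) at s = 0, where phi is the flow of X. *)
Definition lie_deriv p (phi : R -> E -> E) (w : pform p) : pform p :=
  fun x v => derive1 (fun s : R => pullback (phi s) w x v) 0.

Definition graded := forall p, set (pform p).

Definition coinvariant (Om : graded) (rho : int -> E -> E) : graded :=
  fun p => [set` lspan [set eta | exists (k : int) (w : pform p),
    Om p w /\ eta = w - pullback (rho k) w]].
Arguments coinvariant Om rho p : clear implicits.

Definition divergence (Om : graded) (phi : R -> E -> E) : graded :=
  fun p => [set lie_deriv phi w | w in Om p].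
Arguments divergence Om phi p : clear implicits.

Definition cocycles (C : graded) : graded :=
  fun p => [set w | C p w /\ ext_deriv w = 0].
Arguments cocycles C p : clear implicits.

Definition coboundaries (C : graded) : graded := fun p =>
  match p with
  | 0 => [set 0]
  | q.+1 => [set ext_deriv w | w in C q]
  end.
Arguments coboundaries C p : clear implicits.

Definition cohomology (C : graded) (p : nat) : lmodType R :=
  subquot (cocycles C p) (coboundaries C p).

End DifferentialForms.

(* The torus Gamma3 \ G3.  The projection G3 -> Gamma3 \ G3 is a covering by
   the (free, properly discontinuous) left action of Gamma3, and pulling back
   along it identifies the smooth forms on the quotient with the smooth forms
   on G3 invariant under left translation by Gamma3.  This is how torus_forms
   represents them; d, pullback by maps that lift, and Lie derivatives along
   fields that lift are computed on G3. *)
Section HyperbolicTorus.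
Variable R : realType.

(* (x, y, t); the planar part u = (x, y) is handled as a column vector, on
   which A and its powers act on the left. *)
Definition G3 : Type := 'rV[R]_3.

Definition pt (u : 'cV[R]_2) (t : R) : G3 :=
  row_mx u^T (t%:M : 'M[R]_1).
Definition plane (g : 'rV[R]_(2 + 1)) : 'cV[R]_2 := (lsubmx g)^T.
Definition height (g : 'rV[R]_(2 + 1)) : R := rsubmx g 0 0.

Definition diag2 (x y : R) : 'M[R]_2 := diag_mx (\row_(i < 2) [:: x; y]`_i).

(* A^t = P D^t P^-1, for A = P D P^-1 and D = diag(lam, lam^-1). *)
Definition mxflow (P : 'M[R]_2) (lam t : R) : 'M[R]_2 :=
  P *m diag2 (lam `^ t) (lam `^ (- t)) *m invmx P.

Definition G3_mul (P : 'M[R]_2) (lam : R) (g h : G3) : G3 :=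
  pt (plane g + mxflow P lam (height g) *m plane h) (height g + height h).

Definition Gamma3 : set G3 :=
  [set g | exists (m : 'cV[int]_2) (k : int), g = pt (map_mx intr m) k%:~R].

Definition torus_forms (P : 'M[R]_2) (lam : R) : graded R 2 :=
  fun p => [set w : pform R 2 p | smooth_form w /\
    forall g, Gamma3 g -> pullback (G3_mul P lam g) w = w].

Definition slope_vec (a : R) : 'cV[R]_2 := \col_(i < 2) [:: 1; a]`_i.

(* lam^t (d/dx + a d/dy) *)
Definition torus_field (lam a : R) (g : G3) : G3 :=
  lam `^ height g *: (pt (slope_vec a) 0 : 'rV[R]_3).

Lemma torus_field_flow (lam a : R) :
  is_flow (torus_field lam a)
    (fun s g => (g + s *: (torus_field lam a g : 'rV[R]_3) : 'rV[R]_3)).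
Proof.
split=> [x|x s]; first by rewrite scale0r addr0.
suff -> : torus_field lam a (x + s *: (torus_field lam a x : 'rV[R]_3)) =
   torus_field lam a x.
  set w : 'rV[R]_3 := torus_field lam a x.
  split.
    by apply: derivableD; [exact: derivable_cst|exact/diff_derivable/differentiableZl].
  rewrite deriveD ?derive_cst ?add0r//; last exact/diff_derivable/differentiableZl.
  rewrite deriveE; last exact: differentiableZl.
  by rewrite diffZl// diff_val /= scale1r.
suff h0 : height (torus_field lam a x) = 0.
  have h1 : rsubmx (torus_field lam a x : 'rV[R]_(2 + 1)) = 0.
    by apply/matrixP => i j; rewrite !ord1 [RHS]mxE.
  congr (_ `^ _ *: _); rewrite /height linearD mxE linearZ /= h1 scaler0.
  by rewrite [X in _ + X]mxE addr0.
rewrite /height mxE /torus_field mxE.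
set r := (X in _ * X); suff -> : r = 0 by rewrite mulr0.
by rewrite /r /pt (row_mxEr (slope_vec a)^T) mxE mul0rn.
Qed.

End HyperbolicTorus.

(* Main.v *)
From HB Require Import structures.
From mathcomp Require Import all_boot all_order all_algebra perm.
From mathcomp Require Import all_classical all_reals all_analysis.
From mathcomp Require Import ring lra.
Require Import Defs.

(** Forms on the torus are the forms on R^3 invariant under left translation by
    the lattice. The field is mu V with V = (1, a, 0) constant and mu = lam^t
    depending on the height t only, so its flow phi_s is the family of shears
    x + s mu(x) V (flow_unique), and pullbacks by it are explicit: phi_s^* w has
    the coefficients of w + s (ln lam) mu dt /\ i_V w at the displaced point
    (pullback_phiE).

    The key fact is that a form w invariant under the time-one map is invariant
    under the whole flow, and satisfies dt /\ i_V w = 0 (invariant_flow,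
    contraction0). Indeed invariance under phi_n makes n times dt /\ i_V w, and
    then n times the derivative of w along V, a difference of values of functions
    that are bounded on each compact fibre of t.

    Comparison of the complexes: let J w be the mean of phi_s^* w for s between 0
    and 1. It commutes with d and sends L_X z to phi_1^* z - z. If J w = 0, then
    w is invariant under phi_1 (flow_mean_eq0), hence under the flow, and
    w = J w = 0. So J is an isomorphism from divergence forms onto co-invariant
    forms, compatible with d (cohomology_isomorphic).

    Degree 0: if h - phi_1^* h is closed, then dh is invariant, so h is constant
    along V and the difference vanishes (H0_eq0).

    Degrees 1 and 2: the classes of w_j - phi_1^* w_j, for
    w_j = cos(2 pi t)^j lam^-t ell with ell the linear form dual to the
    eigenvector, and for w_j = cos(2 pi t)^j dx /\ dy, are independent. If a
    combination w of the w_j has w - phi_1^* w = d (h - phi_1^* h), then w - dh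
    is invariant, so w and dh have the same contraction with V along dt
    (infinite_criterion). The contraction of dh consists of derivatives along the
    fibres and has mean zero over them, while that of w is constant on fibres;
    this forces a polynomial in cos(2 pi t) to vanish.

    Degree 3: every 3-form on the torus is c vol + d e (ext_deriv_primitive). The
    form e comes from a vector field with prescribed divergence, found by
    integrating along the fibres, transporting by the monodromy, gluing the
    transports with cut-offs depending on t only, and integrating along t
    (divergence_decomposition). Since the volume is invariant under the flow,
    (c vol + d e) - phi_1^* (c vol + d e) = d (e - phi_1^* e) (H3_eq0). *)

Set Implicit Arguments.
Unset Strict Implicit.
Unset Printing Implicit Defensive.

Import Order.TTheory GRing.Theory Num.Theory.
Import numFieldNormedType.Exports.

Local Open Scope classical_set_scope.
Local Open Scope ring_scope.

(** * Integrals over the unit interval *)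

Section UnitInterval.
Variable R : realType.
Local Notation mu := (@lebesgue_measure R).
Implicit Types f g : R -> R.

Definition int01 f : R := \int[mu]_(s in `[0, 1]) f s.

Lemma integrable01 f : continuous f -> mu.-integrable `[0, 1] (EFin \o f).
Proof.
move=> cf; apply: continuous_compact_integrable; first exact: segment_compact.
by apply: continuous_subspaceT.
Qed.

Lemma int01_cst (c : R) : int01 (fun=> c) = c.
Proof.
rewrite /int01 Rintegral_cst//= lebesgue_measure_itv/= lte01 oppr0 adde0.
by rewrite mulr1.
Qed.

Lemma int01D f g : continuous f -> continuous g ->
  int01 (fun s => f s + g s) = int01 f + int01 g.
Proof. by move=> cf cg; apply: RintegralD => //; exact: integrable01. Qed.

Lemma int01Z c f : continuous f -> int01 (fun s => c * f s) = c * int01 f.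
Proof. by move=> cf; apply: RintegralZl => //; exact: integrable01. Qed.

Lemma int01B f g : continuous f -> continuous g ->
  int01 (fun s => f s - g s) = int01 f - int01 g.
Proof. by move=> cf cg; apply: RintegralB => //; exact: integrable01. Qed.

Lemma continuous_sum (T : topologicalType) n (f : 'I_n -> T -> R^o) :
  (forall i, continuous (f i)) -> continuous (fun s => \sum_(i < n) f i s).
Proof.
move=> cf; have -> : (fun s => \sum_(i < n) f i s) = \sum_(i < n) f i.
  by apply/funext => s; rewrite fct_sumE.
elim/big_ind : _ => [y|g h cg ch y|i _]; [exact: cvg_cst| |exact: cf].
exact: cvgD (cg y) (ch y).
Qed.

Lemma int01_sum n (f : 'I_n -> R -> R) : (forall i, continuous (f i)) ->
  int01 (fun s => \sum_(i < n) f i s) = \sum_(i < n) int01 (f i).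
Proof.
elim: n f => [|n IH] f cf.
  by under [X in int01 X]eq_fun do rewrite big_ord0; rewrite big_ord0 int01_cst.
under [X in int01 X]eq_fun do rewrite big_ord_recl.
rewrite big_ord_recl int01D//; last exact: continuous_sum.
by rewrite IH.
Qed.

Lemma ler_int01 f C : continuous f ->
  (forall s, 0 <= s <= 1 -> `|f s| <= C) -> `|int01 f| <= C.
Proof.
move=> cf fC.
have cn : continuous (fun s => `|f s|).
  by move=> s; apply: (@continuous_comp _ _ _ f Num.norm); [exact: cf|exact: norm_continuous].
apply: (le_trans (le_normr_Rintegral _ _)) => //; first exact: integrable01.
rewrite -[leRHS]int01_cst; apply: le_Rintegral => //; first exact: integrable01.
- by apply: integrable01 => ?; exact: cvg_cst.
Qed.

Lemma int01_FTC (F f : R -> R) : continuous f ->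
  (forall s : R, is_derive s 1 F (f s)) -> int01 f = F 1 - F 0.
Proof.
move=> cf dF; rewrite /int01 /Rintegral (@continuous_FTC2 _ f F)//.
- by apply: continuous_subspaceT.
- have cF s : {for s, continuous F}.
    by apply/differentiable_continuous/derivable1_diffP; case: (dF s).
  split.
  + by move=> s _; case: (dF s).
  + by apply: cvg_at_right_filter; exact: cF.
  + by apply: cvg_at_left_filter; exact: cF.
- by move=> s _; rewrite derive1E; case: (dF s).
Qed.

End UnitInterval.

Section ParametricIntegral.
Variables (R : realType) (n : nat).
Local Notation E := 'rV[R]_n.+1.

Lemma is_derive_line (f : E -> R^o) (x v : E) (s : R) :
  differentiable f (x + s *: v) ->
  is_derive s 1 (fun r : R => f (x + r *: v)) ('D_v f (x + s *: v)).
Proof.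
move=> df.
have dl : is_diff (s : R^o) (fun r : R^o => x + r *: v) (fun r : R^o => r *: v).
  have := is_diffD (is_diff_cst x (s : R^o)) (is_diff_scalel s v).
  by rewrite add0r.
have dg : is_diff (x + s *: v) f ('d f (x + s *: v)) by exact/differentiableP.
have [dfl e] := is_diff_comp dl dg.
split; first exact/diff_derivable/dfl.
by rewrite !deriveE// -[fun r : R => _]/(f \o _) e /= scale1r.
Qed.

Lemma near_ball0 (P : set E) (x : E) : (\forall y \near x, P y) ->
  exists2 d : R, 0 < d & forall v : E, `|v| < d -> P (x + v).
Proof.
move=> /nbhs_ballP[d d0 dP]; exists d => // v vd; apply: dP.
by rewrite -ball_normE /= opprD addrA subrr add0r normrN.
Qed.

Lemma rV_derive_sum (f : E -> R^o) (x v : E) : differentiable f x ->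
  'D_v f x = \sum_i v 0 i * 'D_('e_i) f x.
Proof.
move=> df; rewrite deriveE// {1}(row_sum_delta v) linear_sum; apply: eq_bigr => i _.
by rewrite linearZZ deriveE.
Qed.

Lemma ler_coord (v : E) i : `|v 0 i| <= `|v|.
Proof.
rewrite [leRHS]/Num.norm /= mx_normrE.
by apply/bigmax_geP; right => /=; exists (0, i).
Qed.

Variable G : R -> E -> R^o.
Hypothesis cG : forall x, continuous (G ^~ x).
Hypothesis dG : forall s x, differentiable (G s) x.
Hypothesis cdG : forall v, continuous (fun z : R * E => 'D_v (G z.1) z.2).

Let cdG1 v x : continuous (fun s => 'D_v (G s) x).
Proof.
move=> s; apply: (@continuous_comp _ _ _ (fun s => (s, x))
  (fun z : R * E => 'D_v (G z.1) z.2)); last exact: (@cdG _ (_, _)).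
by apply: (@cvg_pair _ _ _ _ (nbhs s) (nbhs x)); [exact: cvg_id|exact: cvg_cst].
Qed.

Let unif (x : E) (e : R) : 0 < e -> exists2 d : R, 0 < d &
  forall v : E, `|v| < d -> forall (s : R) i, 0 <= s <= 1 ->
    `|'D_('e_i) (G s) (x + v) - 'D_('e_i) (G s) x| < e.
Proof.
move=> e0.
have near1 i : \forall y \near x, forall s : R, 0 <= s <= 1 ->
    `|'D_('e_i) (G s) y - 'D_('e_i) (G s) x| < e.
  have /compact_near_coveringP := @segment_compact R 0 1.
  move=> /(_ _ (nbhs x) (fun y s => `|'D_('e_i) (G s) y - 'D_('e_i) (G s) x| < e)).
  have step (s : R) : `[0, 1]%classic s -> \forall s' \near s & y \near x,
      `|'D_('e_i) (G s') y - 'D_('e_i) (G s') x| < e.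
    move=> _.
    have cD : {for (s, x), continuous (fun z : R * E =>
        'D_('e_i) (G z.1) z.2 - 'D_('e_i) (G z.1) x)}.
      apply: cvgB; first exact: (@cdG _ (_, _)).
      apply: (@continuous_comp _ _ _ fst (fun s => 'D_('e_i) (G s) x)).
        exact: cvg_fst.
      exact: (@cdG1 _ _ _).
    have /cvgrPdist_lt/(_ _ e0) := cD; rewrite /= subrr.
    by apply: filterS => -[s' y] /=; rewrite sub0r normrN.
  move=> /(_ _ step); apply: filterS => y Py s s01; apply: Py.
  by rewrite /= in_itv.
have : \forall y \near x, forall i (s : R), 0 <= s <= 1 ->
    `|'D_('e_i) (G s) y - 'D_('e_i) (G s) x| < e.
  exact: (@filter_forall _ _ _ _ (nbhs_filter x) near1).
move=> /near_ball0[d d0 dP]; exists d => // v vd s i s01; exact: dP.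
Qed.

Let A (x v : E) : R^o := int01 (fun s => 'D_v (G s) x).

Let A_linear x : linear (A x).
Proof.
move=> k u v; rewrite /A.
have -> : (fun s => 'D_(k *: u + v) (G s) x) =
    (fun s => k * 'D_u (G s) x + 'D_v (G s) x).
  by apply/funext => s; rewrite !deriveE// linearP.
rewrite int01D ?int01Z// => s.
by apply: cvgM; [exact: cvg_cst|exact: cdG1].
Qed.

Let A_coord x v : A x v = \sum_i v 0 i * A x 'e_i.
Proof.
pose HL := GRing.isLinear.Build _ _ _ _ _ (A_linear x).
pose L : {linear E -> R^o} := HB.pack (A x : E -> R^o) HL.
by rewrite -[LHS]/(L v) {1}(row_sum_delta v) linear_sum; apply: eq_bigr => i _;
  rewrite linearZZ.
Qed.

Let A_continuous x : continuous (A x).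
Proof.
have -> : A x = (fun v : E => \sum_i v 0 i * A x 'e_i).
  by apply/funext => v; rewrite A_coord.
apply: continuous_sum => i.
have dc (y : E) : differentiable (fun v : E => v 0 i * A x 'e_i) y.
  by apply: differentiableM => //; exact: differentiable_coord.
by move=> y; exact: differentiable_continuous (dc y).
Qed.

(** The increment is controlled by the mean value theorem for each value of
    the parameter; the continuity of the partial derivatives along the compact
    segment of parameters makes the control uniform. *)
Lemma int01_diff (x : E) :
  differentiable (fun y => int01 (G ^~ y) : R^o) x /\
  forall v, 'D_v (fun y => int01 (G ^~ y) : R^o) x = int01 (fun s => 'D_v (G s) x).
Proof.
pose HL := GRing.isLinear.Build _ _ _ _ _ (A_linear x).
pose L : {linear E -> R^o} := HB.pack (A x : E -> R^o) HL.
set F : E -> R^o := fun y => int01 (G ^~ y).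
have step d e : 0 < d -> 0 < e -> (forall v, `|v| < d ->
    forall s i, 0 <= s <= 1 ->
    `|'D_('e_i) (G s) (x + v) - 'D_('e_i) (G s) x| < e) ->
  forall v, `|v| < d -> `|F (x + v) - F x - A x v| <= n.+1%:R * e * `|v|.
  move=> d0 e0 He v vd.
  rewrite -[F _ - F _]int01B// -int01B//; last first.
    by move=> s; apply: cvgB; exact: cG.
  apply: ler_int01 => [s|s s01].
    by apply: cvgB; [apply: cvgB; exact: cG|exact: cdG1].
  have [||c c01] := @MVT R (fun r => G s (x + r *: v))
    (fun r => 'D_v (G s) (x + r *: v)) 0 1 ltr01.
  - by move=> r _; exact: is_derive_line.
  - apply: continuous_subspaceT => r.
    apply: differentiable_continuous; apply/derivable1_diffP.
    by case: (@is_derive_line (G s) x v r).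
  rewrite scale1r scale0r addr0 subr0 mulr1 => ->.
  rewrite rV_derive_sum// [X in _ - X]rV_derive_sum// -sumrB.
  apply: (le_trans (ler_norm_sum _ _ _)).
  have -> : n.+1%:R * e * `|v| = \sum_(i < n.+1) (`|v| * e).
    by rewrite sumr_const card_ord -mulr_natl; ring.
  apply: ler_sum => i _; rewrite -mulrBr normrM; apply: ler_pM => //.
    exact: ler_coord.
  apply/ltW/He => //; move: c01; rewrite in_itv/= => /andP[c0 c1].
  rewrite normrZ (gtr0_norm c0); apply: le_lt_trans vd.
  by apply: ler_piMl => //; exact: ltW.
have key : F \o shift x = cst (F x) + L +o_ (0 : E) id.
  apply/eqaddoP => e e0.
  have [|d d0 He] := @unif x (e / n.+1%:R); first exact: divr_gt0.
  apply/nbhs_ballP; exists d => // v; rewrite -ball_normE /= sub0r normrN => vd.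
  have := step _ _ d0 (divr_gt0 e0 (ltr0Sn _ _)) He v vd.
  rewrite mulrCA divff ?mulr1 ?pnatr_eq0//.
  by rewrite !fctE /= opprD addrA [v + x]addrC.
have dFL : 'd F x = L :> (E -> R^o) by apply: diff_unique => //; exact: A_continuous.
have dF : differentiable F x.
  by apply/diff_locallyP; rewrite dFL; split=> //; exact: A_continuous.
by split=> // v; rewrite deriveE// dFL.
Qed.

End ParametricIntegral.

(** * Smooth functions *)

Section SmoothFunctions.
Variables (R : realType) (n : nat).
Local Notation E := 'rV[R]_n.+1.
Local Notation du := (@differentiable_upto R n).
Local Notation smooth := (@smooth R n).
Implicit Types (f g : E -> R^o) (x v : E).

Lemma duSP k f : du k.+1 f <->
  (forall x, differentiable f x) /\ forall v, du k (fun x => 'D_v f x).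
Proof. by []. Qed.

Lemma du_W k f : du k.+1 f -> du k f.
Proof.
elim: k f => [//|k IH] f /duSP[df Hf]; apply/duSP; split=> // v; exact/IH/Hf.
Qed.

Lemma du_cst k (c : R) : du k (fun=> c).
Proof.
elim: k c => [//|k IH] c; apply/duSP; split=> [x|v]; first exact: differentiable_cst.
by have -> : (fun x => 'D_v (fun=> c) x) = (fun=> 0 : R^o);
  [apply/funext => x; exact: derive_cst|exact: IH].
Qed.

Lemma du_D k f g : du k f -> du k g -> du k (fun x => f x + g x).
Proof.
elim: k f g => [//|k IH] f g /duSP[df Hf] /duSP[dg Hg]; apply/duSP; split=> [x|v].
  exact: differentiableD.
have -> : (fun x => 'D_v (fun x => f x + g x) x) = (fun x => 'D_v f x + 'D_v g x).
  by apply/funext => x; apply: deriveD; exact: diff_derivable.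
exact: IH.
Qed.

Lemma du_M k f g : du k f -> du k g -> du k (fun x => f x * g x).
Proof.
elim: k f g => [//|k IH] f g Hf0 Hg0.
have /duSP[df Hf] := Hf0; have /duSP[dg Hg] := Hg0.
apply/duSP; split=> [x|v]; first exact: differentiableM.
have -> : (fun x => 'D_v (fun x => f x * g x) x) =
    (fun x => f x * 'D_v g x + g x * 'D_v f x).
  by apply/funext => x; apply: deriveM; exact: diff_derivable.
by apply: du_D; (apply: IH; [exact: du_W|]); [exact: Hg|exact: Hf].
Qed.

Lemma smoothP f : smooth f <->
  (forall x, differentiable f x) /\ forall v, smooth (fun x => 'D_v f x).
Proof.
split=> [sf|[df sf]]; last by case=> // k; apply/duSP; split=> // v; exact: sf.
split=> [x|v k].
  by have /duSP[+ _] := sf 1%N; exact.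
by have /duSP[_] := sf k.+1; exact.
Qed.

Lemma smooth_diff f x : smooth f -> differentiable f x.
Proof. by move=> /smoothP[+ _]; exact. Qed.

Lemma smooth_derivable f x v : smooth f -> derivable f x v.
Proof. by move=> /(@smooth_diff _ x)/diff_derivable. Qed.

Lemma smooth_derive f v : smooth f -> smooth (fun x => 'D_v f x).
Proof. by move=> /smoothP[_]; exact. Qed.

Lemma smooth_continuous f : smooth f -> continuous f.
Proof. by move=> sf x; exact/differentiable_continuous/smooth_diff. Qed.

Lemma smooth_cst (c : R) : smooth (fun=> c).
Proof. by move=> k; exact: du_cst. Qed.

Lemma smoothD f g : smooth f -> smooth g -> smooth (fun x => f x + g x).
Proof. by move=> sf sg k; exact: du_D. Qed.

Lemma smoothM f g : smooth f -> smooth g -> smooth (fun x => f x * g x).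
Proof. by move=> sf sg k; exact: du_M. Qed.

Lemma smoothZ (c : R) f : smooth f -> smooth (fun x => c * f x).
Proof. by move=> sf; apply: smoothM => //; exact: smooth_cst. Qed.

Lemma smoothN f : smooth f -> smooth (fun x => - f x).
Proof.
by move=> sf; under eq_fun do rewrite -mulN1r; exact: smoothZ.
Qed.

Lemma smoothB f g : smooth f -> smooth g -> smooth (fun x => f x - g x).
Proof. by move=> sf sg; apply: smoothD => //; exact: smoothN. Qed.

Lemma smooth_sum (I : Type) (s : seq I) (F : I -> E -> R^o) :
  (forall i, smooth (F i)) -> smooth (fun x => \sum_(i <- s) F i x).
Proof.
move=> sF; elim: s => [|i s IH].
  by under eq_fun do rewrite big_nil; exact: smooth_cst.
by under eq_fun do rewrite big_cons; exact: smoothD.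
Qed.

Lemma derive_coord i x v : 'D_v (fun y : E => y 0 i : R^o) x = v 0 i.
Proof.
have := is_derive_id x v => -[dx ex].
have /derivable_mxP/(_ 0 i) := dx => dc.
have := derive_mx dx; rewrite ex => /matrixP/(_ 0 i).
by rewrite [RHS]mxE.
Qed.

Lemma smooth_coord i : smooth (fun y : E => y 0 i).
Proof.
apply/smoothP; split=> [x|v]; first exact: differentiable_coord.
have -> : (fun x => 'D_v (fun y : E => y 0 i : R^o) x) = (fun=> v 0 i).
  by apply/funext => x; exact: derive_coord.
exact: smooth_cst.
Qed.

Lemma smoothV f : smooth f -> (forall x, f x != 0) -> smooth (fun x => (f x)^-1).
Proof.
move=> sf f0; elim=> [//|k IH]; apply/duSP; split=> [x|v].
  by apply: differentiableV => //; exact: smooth_diff.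
have -> : (fun x => 'D_v (fun x => (f x)^-1) x) =
    (fun x => - ((f x)^-1 * (f x)^-1 * 'D_v f x)).
  apply/funext => x; rewrite deriveV//; last exact: smooth_derivable.
  by rewrite /GRing.scale/= expr2 invfM mulNr.
under eq_fun do rewrite -mulN1r.
apply: du_M; first exact: du_cst.
by apply: du_M; [exact: du_M|exact: smooth_derive].
Qed.

Lemma near_eq_differentiable f g x : (\forall y \near x, f y = g y) ->
  differentiable g x -> differentiable f x.
Proof.
move=> fg dg; have fgx := nbhs_singleton fg.
have key : f \o shift x = cst (f x) + 'd g x +o_ (0 : E) id.
  apply/eqaddoP => e e0.
  have /eqaddoP/(_ e e0) := diff_locally dg.
  have : \forall y \near (0 : E), f (y + x) = g (y + x).
    have [d d0 H] := near_ball0 fg; apply/nbhs_ballP; exists d => // y.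
    by rewrite -ball_normE /= sub0r normrN addrC => /H; rewrite addrC.
  by apply: filterS2 => y /= e1; rewrite !fctE /= e1 fgx.
have e : 'd f x = 'd g x :> (E -> R^o).
  by apply: diff_unique => //; exact: diff_continuous.
by apply/diff_locallyP; rewrite e; split=> //; exact: diff_continuous.
Qed.

(** Near each point the iterated derivatives of f are those of its local model,
    because derivatives at a point depend only on a neighbourhood of it. *)
Lemma smooth_local f :
  (forall x, exists2 g, smooth g & \forall y \near x, f y = g y) -> smooth f.
Proof.
move=> H k; elim: k f H => [//|k IH] f H; apply/duSP; split=> [x|v].
  have [g sg fg] := H x.
  by apply: near_eq_differentiable fg _; exact: smooth_diff.
apply: (IH (fun x => 'D_v f x)) => x; have [g sg fg] := H x.
exists (fun y => 'D_v g y); first exact: smooth_derive.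
apply: filterS (nbhs_interior fg) => y fgy; exact: near_eq_derive.
Qed.

Lemma derive_comp (f : E -> R^o) (h : E -> E) x v :
  differentiable h x -> differentiable f (h x) ->
  'D_v (fun y => f (h y)) x = 'D_('D_v h x) f (h x).
Proof.
move=> dh df; have dfh : differentiable (f \o h) x by exact: differentiable_comp.
by rewrite [LHS](deriveE v dfh) diff_comp// !deriveE.
Qed.

Lemma derive_comp1 (F : R -> R^o) (F' : R) f x v :
  is_derive (f x : R^o) (1 : R^o) F F' -> differentiable f x ->
  differentiable (fun y => F (f y) : R^o) x /\
  'D_v (fun y => F (f y) : R^o) x = F' * 'D_v f x.
Proof.
move=> [dF eF] df; have dF' : differentiable F (f x) by exact/derivable1_diffP.
have dFf : differentiable (F \o f) x by exact: differentiable_comp.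
split=> //; rewrite [LHS](deriveE v dFf) diff_comp//= deriv1E//.
by rewrite derive1E eF -deriveE// /GRing.scale/= mulrC.
Qed.

Lemma derive_linear (f : E -> R^o) x (a b : R) u v : differentiable f x ->
  'D_(a *: u + b *: v) f x = a * 'D_u f x + b * 'D_v f x.
Proof. by move=> df; rewrite !deriveE// linearD !linearZZ. Qed.

Lemma derive_lincomb f g (b c : R) x v : smooth f -> smooth g ->
  'D_v (fun y => b * f y + c * g y) x = b * 'D_v f x + c * 'D_v g x.
Proof.
move=> sf sg; have df := @smooth_derivable f x v sf; have dg := @smooth_derivable g x v sg.
rewrite (deriveD (f := fun y => b * f y) (g := fun y => c * g y)).
- by rewrite (deriveZ b df) (deriveZ c dg).
- exact: (derivableZ df).
- exact: (derivableZ dg).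
Qed.

Lemma derive_addsum m f (F : 'I_m -> E -> R^o) x v :
  smooth f -> (forall i, smooth (F i)) ->
  'D_v (fun y => f y + \sum_i F i y) x = 'D_v f x + \sum_i 'D_v (F i) x.
Proof.
move=> sf sF.
rewrite (deriveD (f := f) (g := fun y => \sum_i F i y)); last 2 first.
- exact: smooth_derivable.
- exact/smooth_derivable/smooth_sum.
have -> : (fun y => \sum_i F i y) = \sum_i F i.
  by apply/funext => y; rewrite fct_sumE.
by rewrite derive_sum// => i; exact: smooth_derivable.
Qed.

Lemma derive_shear_map (c : E -> R^o) (V : E) x v : differentiable c x ->
  differentiable (fun y : E => y + c y *: V) x /\
  'D_v (fun y : E => y + c y *: V) x = v + 'D_v c x *: V.
Proof.
move=> dc.
have dz : differentiable (fun y => c y *: V) x by exact: differentiableZl.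
split; first exact: differentiableD.
rewrite deriveD ?derive_id; [|exact: derivable_id|exact: diff_derivable].
by rewrite [X in _ + X]deriveE// diffZl//= deriveE.
Qed.

Lemma derive_shear f (c : E -> R^o) (V : E) x v :
  differentiable c x -> differentiable f (x + c x *: V) ->
  'D_v (fun y : E => f (y + c y *: V)) x =
  'D_v f (x + c x *: V) + 'D_v c x * 'D_V f (x + c x *: V).
Proof.
move=> dc df; have [dh eh] := derive_shear_map V v dc.
by rewrite (derive_comp v dh df) eh -{1}[v]scale1r derive_linear// mul1r.
Qed.

Lemma smooth_shear f (c : E -> R^o) (V : E) : smooth f -> smooth c ->
  smooth (fun y : E => f (y + c y *: V)).
Proof.
move=> sf sc k; elim: k f sf => [//|k IH] f sf; apply/duSP; split=> [x|v].
  apply: (@differentiable_comp _ _ _ _ (fun y : E => y + c y *: V) f).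
    by case: (@derive_shear_map c V x 0 (smooth_diff x sc)).
  exact: smooth_diff.
have -> : (fun x => 'D_v (fun y : E => f (y + c y *: V)) x) = (fun x =>
    'D_v f (x + c x *: V) + 'D_v c x * 'D_V f (x + c x *: V)).
  by apply/funext => x; rewrite derive_shear//; exact: smooth_diff.
apply: du_D; first exact/(IH (fun x => 'D_v f x))/smooth_derive.
apply: du_M; first exact: smooth_derive.
exact/(IH (fun x => 'D_V f x))/smooth_derive.
Qed.

Lemma derive_affine_map (M : 'M[R]_n.+1) (b x v : E) :
  differentiable (fun y : E => b + y *m M) x /\
  'D_v (fun y : E => b + y *m M) x = v *m M.
Proof.
have -> : (fun y : E => b + y *m M) =
    cst b + \sum_i (fun y : E => y 0 i *: row i M).
  by apply/funext => y; rewrite /= fctE fct_sumE mulmx_sum_row.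
have dZ i : differentiable (fun y : E => y 0 i *: row i M) x.
  by apply: differentiableZl; exact: differentiable_coord.
split; first by apply: differentiableD => //; exact: differentiable_sum.
rewrite deriveD ?derive_cst ?add0r; [|exact: derivable_cst|]; last first.
  by apply/diff_derivable/differentiable_sum.
rewrite derive_sum => [|i]; last exact: diff_derivable.
rewrite mulmx_sum_row; apply: eq_bigr => i _.
have dc : differentiable (fun y : E => y 0 i : R^o) x by exact: differentiable_coord.
by rewrite deriveE// diffZl//= -deriveE// derive_coord.
Qed.

Lemma derive_affine f (M : 'M[R]_n.+1) (b x v : E) :
  differentiable f (b + x *m M) ->
  'D_v (fun y : E => f (b + y *m M)) x = 'D_(v *m M) f (b + x *m M).
Proof.
by move=> df; have [dh eh] := derive_affine_map M b x v;
  rewrite (derive_comp v dh df) eh.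
Qed.

Lemma smooth_affine f (M : 'M[R]_n.+1) (b : E) : smooth f ->
  smooth (fun y : E => f (b + y *m M)).
Proof.
move=> sf k; elim: k f sf => [//|k IH] f sf; apply/duSP; split=> [x|v].
  apply: (@differentiable_comp _ _ _ _ (fun y : E => b + y *m M) f).
    by case: (derive_affine_map M b x 0).
  exact: smooth_diff.
have -> : (fun x => 'D_v (fun y : E => f (b + y *m M)) x) =
    (fun x => 'D_(v *m M) f (b + x *m M)).
  by apply/funext => x; rewrite derive_affine//; exact: smooth_diff.
exact/(IH (fun x => 'D_(v *m M) f x))/smooth_derive.
Qed.

End SmoothFunctions.

(** * Integrals along segments *)

Section FlowIntegral.
Variables (R : realType) (n : nat).
Local Notation E := 'rV[R]_n.+1.
Local Notation smooth := (@smooth R n).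
Implicit Types (f c : E -> R^o) (x v V : E).

(** Mean of s^k f over the segment from x to x + c(x) V. The weight s^k is there
    because differentiating the integrand in x brings out a factor s: the family
    is closed under derivation, so that its smoothness follows by induction. *)
Definition flow_int (k : nat) c V f x : R^o :=
  int01 (fun s => s ^+ k * f (x + (s * c x) *: V)).

Lemma continuous_shear f c V : continuous f -> continuous c ->
  continuous (fun z : R * E => f (z.2 + (z.1 * c z.2) *: V)).
Proof.
move=> cf cc z.
apply: (@continuous_comp _ _ _ (fun z : R * E => z.2 + (z.1 * c z.2) *: V) f);
  last exact: cf.
apply: (@cvgD _ _ _ (nbhs z) _ (fun z : R * E => z.2)); first exact: cvg_snd.
apply: cvgZr_tmp; apply: cvgM; first exact: cvg_fst.
by apply: (@continuous_comp _ _ _ snd c); [exact: cvg_snd|exact: cc].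
Qed.

Lemma continuous_section (g : R * E -> R^o) x : continuous g ->
  continuous (fun s => g (s, x)).
Proof.
move=> cg s; apply: (@continuous_comp _ _ _ (fun s => (s, x)) g); last exact: cg.
by apply: (@cvg_pair _ _ _ _ (nbhs s) (nbhs x)); [exact: cvg_id|exact: cvg_cst].
Qed.

Lemma continuous_expM (k : nat) (g : R * E -> R^o) : continuous g ->
  continuous (fun z : R * E => z.1 ^+ k * g z : R^o).
Proof.
move=> cg z; apply: cvgM; last exact: cg.
apply: (@continuous_comp _ _ _ fst (fun s : R => s ^+ k : R^o)).
  exact: cvg_fst.
exact: exprn_continuous.
Qed.

Lemma continuous_flow_integrand (k : nat) c V f x : continuous f ->
  continuous c -> continuous (fun s : R => s ^+ k * f (x + (s * c x) *: V)).
Proof.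
move=> cf cc.
exact: (@continuous_section _ x
  (@continuous_expM k _ (@continuous_shear f c V cf cc))).
Qed.

Definition flow_integrand (k : nat) c V f (s : R) x : R^o :=
  s ^+ k * f (x + (s * c x) *: V).

Lemma smooth_flow_integrand k c V f s : smooth f -> smooth c ->
  smooth (flow_integrand k c V f s).
Proof.
move=> sf sc; apply: smoothZ; apply: smooth_shear => //; exact: smoothZ.
Qed.

Lemma derive_flow_integrand k c V f s x v : smooth f -> smooth c ->
  'D_v (flow_integrand k c V f s) x =
    flow_integrand k c V (fun y => 'D_v f y) s x +
    'D_v c x * flow_integrand k.+1 c V (fun y => 'D_V f y) s x.
Proof.
move=> sf sc; have sc' : smooth (fun y => s * c y) by exact: smoothZ.
rewrite [LHS](deriveZ (s ^+ k) (f := fun y => f (y + (s * c y) *: V))).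
  rewrite (@derive_shear _ _ f (fun y => s * c y)); do ?exact: smooth_diff.
  rewrite (deriveZ s (f := c)); last exact: smooth_derivable.
  by rewrite /flow_integrand /GRing.scale/= exprS; ring.
by apply/smooth_derivable/smooth_shear.
Qed.

Lemma continuous_derive_flow_integrand k c V f x v : smooth f -> smooth c ->
  continuous (fun s => 'D_v (flow_integrand k c V f s) x).
Proof.
move=> sf sc; have cc := smooth_continuous sc.
have cD v := smooth_continuous (smooth_derive v sf).
have -> : (fun s => 'D_v (flow_integrand k c V f s) x) = (fun s =>
    flow_integrand k c V (fun y => 'D_v f y) s x +
    'D_v c x * flow_integrand k.+1 c V (fun y => 'D_V f y) s x).
  by apply/funext => s; exact: derive_flow_integrand.
move=> s; apply: cvgD; first exact: (@continuous_flow_integrand k c V _ x (cD v) cc).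
apply: cvgM; first exact: cvg_cst.
exact: (@continuous_flow_integrand k.+1 c V _ x (cD V) cc).
Qed.

Lemma flow_int_diff k c V f x : smooth f -> smooth c ->
  differentiable (flow_int k c V f) x /\ forall v,
  'D_v (flow_int k c V f) x = int01 (fun s => 'D_v (flow_integrand k c V f s) x).
Proof.
move=> sf sc.
have cf := smooth_continuous sf; have cc := smooth_continuous sc.
have cD v := smooth_continuous (smooth_derive v sf).
apply: (@int01_diff R n (flow_integrand k c V f)).
- by move=> y; exact: (@continuous_flow_integrand k c V f y cf cc).
- by move=> s y; exact/smooth_diff/smooth_flow_integrand.
- move=> v; have -> : (fun z : R * E => 'D_v (flow_integrand k c V f z.1) z.2) =
    (fun z => z.1 ^+ k * 'D_v f (z.2 + (z.1 * c z.2) *: V) +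
    'D_v c z.2 * (z.1 ^+ k.+1 * 'D_V f (z.2 + (z.1 * c z.2) *: V))).
    by apply/funext => z; exact: derive_flow_integrand.
  move=> z; apply: cvgD.
    exact: (@continuous_expM k _ (@continuous_shear _ c V (cD v) cc) z).
  apply: cvgM.
    apply: (@continuous_comp _ _ _ snd (fun y => 'D_v c y)); first exact: cvg_snd.
    exact/smooth_continuous/smooth_derive.
  exact: (@continuous_expM k.+1 _ (@continuous_shear _ c V (cD V) cc) z).
Qed.

Lemma derive_flow_int k c V f x v : smooth f -> smooth c ->
  'D_v (flow_int k c V f) x = flow_int k c V (fun y => 'D_v f y) x +
    'D_v c x * flow_int k.+1 c V (fun y => 'D_V f y) x.
Proof.
move=> sf sc; have [_ ->] := flow_int_diff k V x sf sc.
have -> : (fun s => 'D_v (flow_integrand k c V f s) x) = (fun s =>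
    flow_integrand k c V (fun y => 'D_v f y) s x +
    'D_v c x * flow_integrand k.+1 c V (fun y => 'D_V f y) s x).
  by apply/funext => s; exact: derive_flow_integrand.
have cc := smooth_continuous sc.
have cD v := smooth_continuous (smooth_derive v sf).
rewrite int01D ?int01Z//.
- exact: (@continuous_flow_integrand k.+1 c V _ x (cD V) cc).
- exact: (@continuous_flow_integrand k c V _ x (cD v) cc).
- move=> s; apply: cvgM; first exact: cvg_cst.
  exact: (@continuous_flow_integrand k.+1 c V _ x (cD V) cc).
Qed.

Lemma smooth_flow_int k c V f : smooth f -> smooth c -> smooth (flow_int k c V f).
Proof.
move=> sf sc m; elim: m k f sf => [//|m IH] k f sf; apply/duSP; split=> [x|v].
  by have [] := flow_int_diff k V x sf sc.
have -> : (fun x => 'D_v (flow_int k c V f) x) = (fun x =>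
    flow_int k c V (fun y => 'D_v f y) x +
    'D_v c x * flow_int k.+1 c V (fun y => 'D_V f y) x).
  by apply/funext => x; exact: derive_flow_int.
apply: du_D; first exact/IH/smooth_derive.
apply: du_M; first exact: smooth_derive.
exact/IH/smooth_derive.
Qed.

Lemma derive_line0 f V : smooth f -> (forall x, 'D_V f x = 0) ->
  forall x s, f (x + s *: V) = f x.
Proof.
move=> sf f0 x s.
have dg (r : R) : is_derive r 1 (fun r : R => f (x + r *: (s *: V))) 0.
  have := is_derive_line (v := s *: V) (smooth_diff (x + r *: (s *: V)) sf).
  suff -> : 'D_(s *: V) f (x + r *: (s *: V)) = 0 by [].
  have df := smooth_diff (x + r *: (s *: V)) sf.
  by rewrite deriveE// linearZZ -deriveE// f0 scaler0.
have c0 : continuous (fun=> 0 : R) := @cst_continuous R R 0.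
have := @int01_FTC _ _ (fun=> 0) c0 dg.
rewrite int01_cst scale1r scale0r addr0 => /esym/eqP.
by rewrite subr_eq0 => /eqP.
Qed.

(** With c = 1 these are the mean of f over the segment from x to x + e, and its
    first moment; the latter inverts derivation along e on periodic functions of
    mean zero. *)
Definition avg e f := flow_int 0 (fun=> 1) e f.
Definition moment e f := flow_int 1 (fun=> 1) e f.

Lemma avgE e f x : avg e f x = int01 (fun s => f (x + s *: e)).
Proof. by congr int01; apply/funext => s; rewrite expr0 mul1r mulr1. Qed.

Lemma momentE e f x : moment e f x = int01 (fun s => s * f (x + s *: e)).
Proof. by congr int01; apply/funext => s; rewrite expr1 mulr1. Qed.

Lemma smooth_avg e f : smooth f -> smooth (avg e f).
Proof. by move=> sf; apply: smooth_flow_int => //; exact: smooth_cst. Qed.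

Lemma smooth_moment e f : smooth f -> smooth (moment e f).
Proof. by move=> sf; apply: smooth_flow_int => //; exact: smooth_cst. Qed.

Lemma derive_avg e f v x : smooth f ->
  'D_v (avg e f) x = avg e (fun y => 'D_v f y) x.
Proof.
move=> sf; rewrite derive_flow_int//; last exact: smooth_cst.
by rewrite derive_cst mul0r addr0.
Qed.

Lemma derive_moment e f v x : smooth f ->
  'D_v (moment e f) x = moment e (fun y => 'D_v f y) x.
Proof.
move=> sf; rewrite derive_flow_int//; last exact: smooth_cst.
by rewrite derive_cst mul0r addr0.
Qed.

Lemma derive_avg_along e f x : smooth f ->
  'D_e (avg e f) x = f (x + e) - f x.
Proof.
move=> sf; rewrite derive_avg// avgE.
have dl (s : R) : is_derive s 1 (fun s : R => f (x + s *: e)) ('D_e f (x + s *: e)).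
  by apply: is_derive_line; exact: smooth_diff.
have := @continuous_flow_integrand 0 (fun=> 1) e _ x
    (smooth_continuous (smooth_derive e sf)) (@cst_continuous _ _ (1 : R^o)).
under eq_fun do rewrite expr0 mul1r mulr1.
by move=> /int01_FTC/(_ dl) ->; rewrite scale1r scale0r addr0.
Qed.

(** Integration by parts against the weight s. *)
Lemma derive_moment_along e f x : smooth f ->
  'D_e (moment e f) x = f (x + e) - avg e f x.
Proof.
move=> sf; rewrite derive_moment// momentE avgE.
have c0 := @continuous_flow_integrand 0 (fun=> 1) e f x
    (smooth_continuous sf) (@cst_continuous _ _ (1 : R^o)).
have c1 := @continuous_flow_integrand 1 (fun=> 1) e _ x
    (smooth_continuous (smooth_derive e sf)) (@cst_continuous _ _ (1 : R^o)).
have e0 : (fun s => s ^+ 0 * f (x + (s * 1) *: e)) = (fun s => f (x + s *: e)).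
  by apply/funext => s; rewrite expr0 mul1r mulr1.
have e1 : (fun s => s ^+ 1 * 'D_e f (x + (s * 1) *: e)) =
    (fun s => s * 'D_e f (x + s *: e)).
  by apply/funext => s; rewrite expr1 mulr1.
rewrite e0 in c0; rewrite e1 in c1.
apply/eqP; rewrite eq_sym subr_eq -int01D//; apply/eqP.
have dl (s : R) : is_derive s 1 (fun s : R => s * f (x + s *: e) : R^o)
    (s * 'D_e f (x + s *: e) + f (x + s *: e)).
  have [d1 d2] := is_derive_line (v := e) (smooth_diff (x + s *: e) sf).
  split; first by apply: derivableM => //; exact: derivable_id.
  rewrite deriveM; [|exact: derivable_id|exact: d1]. rewrite d2 derive_id.
  by rewrite /GRing.scale/= mulr1.
have cl : continuous (fun s : R => s * 'D_e f (x + s *: e) + f (x + s *: e)).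
  by move=> s; apply: cvgD; [exact: c1|exact: c0].
by rewrite (int01_FTC cl dl) mul1r mul0r subr0 scale1r.
Qed.

End FlowIntegral.

(** The derivative at r = 0 of the mean of F over the interval from r to r + 1 is
    F 1 - F 0. The parameter r is taken in 1 x 1 matrices in order to apply the
    theorem on parametric integrals in dimension one. *)
Lemma int01_shift_inj (R : realType) (F F' : R -> R^o) :
  (forall s : R, is_derive s 1 F (F' s)) -> continuous F' ->
  (forall r, int01 (fun s => F (s + r)) = 0) -> F 1 = F 0.
Proof.
move=> dF cF' F0.
have dF0 s : differentiable F s by apply/derivable1_diffP; case: (dF s).
have cF : continuous F by move=> s; exact/differentiable_continuous.
pose G (s : R) (x : 'rV[R]_1) : R^o := F (s + x 0 0).
have dG s x v : differentiable (G s) x /\ 'D_v (G s) x = F' (s + x 0 0) * v 0 0.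
  have sf : smooth (fun y : 'rV[R]_1 => s + y 0 0).
    by apply: smoothD; [exact: smooth_cst|exact: smooth_coord].
  have [d e] := derive_comp1 v (dF (s + x 0 0)) (smooth_diff x sf).
  split; [exact: d|apply: etrans e _; congr (_ * _)].
  rewrite (deriveD (f := cst s) (g := fun y : 'rV[R]_1 => y 0 0 : R^o)).
  - by rewrite derive_cst add0r derive_coord.
  - exact: derivable_cst.
  - exact/smooth_derivable/smooth_coord.
have cs (f : R -> R^o) (x : 'rV[R]_1) : continuous f -> continuous (fun s => f (s + x 0 0)).
  move=> cf s; apply: (@continuous_comp _ _ _ (fun s => s + x 0 0) f); last exact: cf.
  by apply: cvgD; [exact: cvg_id|exact: cvg_cst].
have [||v|_ /(_ (const_mx 1))] := @int01_diff R 0 G _ _ _ 0.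
- by move=> x; exact: cs.
- by move=> s x; case: (dG s x 0).
- have -> : (fun z : R * 'rV[R]_1 => 'D_v (G z.1) z.2) =
     (fun z : R * 'rV[R]_1 => F' (z.1 + z.2 0 0) * v 0 0).
    by apply/funext => z; case: (dG z.1 z.2 v).
  move=> z; apply: cvgM; last exact: cvg_cst.
  apply: (@continuous_comp _ _ _ (fun z : R * 'rV[R]_1 => z.1 + z.2 0 0) F').
    apply: cvgD; first exact: cvg_fst.
    apply: (@continuous_comp _ _ _ snd (fun x : 'rV[R]_1 => x 0 0)).
      exact: cvg_snd.
    exact: coord_continuous.
  exact: cF'.
have -> : (fun y => int01 (G ^~ y) : R^o) = cst 0 by apply/funext => y; exact: F0.
rewrite derive_cst.
have -> : (fun s => 'D_(const_mx 1) (G s) 0) = F'.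
  apply/funext => s; have [_ ->] := dG s 0 (const_mx 1).
  by rewrite !mxE addr0 mulr1.
rewrite (int01_FTC cF' dF) => /esym/eqP.
by rewrite subr_eq0 => /eqP.
Qed.

(** * Alternating multilinear forms *)

Section SetRow.
Variables (R : realType) (n p : nat).
Implicit Types (v : 'M[R]_(p, n.+1)) (V : 'rV[R]_n.+1).

Definition setrow (i : 'I_p) V v : 'M[R]_(p, n.+1) :=
  \matrix_(a, b) (if a == i then V 0 b else v a b).

Lemma row_setrow i V v : row i (setrow i V v) = V.
Proof. by apply/rowP => b; rewrite !mxE eqxx. Qed.

Lemma row_setrow_neq i j V v : j != i -> row j (setrow i V v) = row j v.
Proof. by move=> ji; apply/rowP => b; rewrite !mxE (negPf ji). Qed.

Lemma setrow_id i v : setrow i (row i v) v = v.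
Proof. by apply/matrixP => a b; rewrite !mxE; case: eqP => // ->. Qed.

Lemma setrowC i j V W v : i != j ->
  setrow i V (setrow j W v) = setrow j W (setrow i V v).
Proof.
move=> ij; apply/matrixP => a b; rewrite !mxE.
by case: eqP => // ->; rewrite (negPf ij).
Qed.

End SetRow.

Lemma row'_setrow (R : realType) n p i (V : 'rV[R]_n.+1) (v : 'M[R]_(p, n.+1)) :
  row' i (setrow i V v) = row' i v.
Proof. by apply/matrixP => a b; rewrite !mxE eq_sym (negPf (neq_lift _ _)). Qed.

Lemma row'_setrow_lift (R : realType) n p i k (V : 'rV[R]_n.+1)
  (v : 'M[R]_(p.+1, n.+1)) :
  row' i (setrow (lift i k) V v) = setrow k V (row' i v).
Proof. by apply/matrixP => a b; rewrite !mxE (inj_eq lift_inj). Qed.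

Lemma row'_mul (R : realType) n p i (M : 'M[R]_n.+1) (v : 'M[R]_(p, n.+1)) :
  row' i (v *m M) = row' i v *m M.
Proof.
by apply/matrixP => a b; rewrite !mxE; apply: eq_bigr => k _; rewrite !mxE.
Qed.

Section MultilinearAlternating.
Variables (R : realType) (n p : nat) (f : 'M[R]_(p, n.+1) -> R^o).
Hypotheses (fm : multilinear f) (fa : alternating f).
Implicit Types (v : 'M[R]_(p, n.+1)) (V W : 'rV[R]_n.+1).

Lemma mlin_setrow i (b c : R) V W v :
  f (setrow i (b *: V + c *: W) v) = b * f (setrow i V v) + c * f (setrow i W v).
Proof.
by apply: (fm (i := i)); rewrite ?row'_setrow ?row_setrow.
Qed.

Lemma alt_setrow2 i j V v : i != j -> f (setrow i V (setrow j V v)) = 0.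
Proof.
move=> ij; apply: (fa ij).
by rewrite row_setrow row_setrow_neq 1?eq_sym// row_setrow.
Qed.

(** A change of the argument by a matrix of rank one is seen only to first
    order, since two rows proportional to the same vector are annihilated. *)
Lemma alt_rank1 (c : 'cV[R]_p) V v :
  f (v + c *m V) = f v + \sum_i c i 0 * f (setrow i V v).
Proof.
suff H k : forall (c : 'cV[R]_p) v, (forall i : 'I_p, (k <= i)%N -> c i 0 = 0) ->
    f (v + c *m V) = f v + \sum_i c i 0 * f (setrow i V v).
  by apply: (H p) => i; rewrite leqNgt ltn_ord.
elim: k {c v} => [|k IH] c v ck.
  have -> : c = 0 by apply/colP => i; rewrite ck// mxE.
  by rewrite mul0mx addr0 big1 ?addr0// => i _; rewrite mxE mul0r.
have [kp|pk] := ltnP k p; last first.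
  by apply: IH => i ki; have := leq_trans pk ki; rewrite leqNgt ltn_ord.
pose i0 := Ordinal kp.
pose c' : 'cV[R]_p := \col_i (if i == i0 then 0 else c i 0).
have c'k (i : 'I_p) : (k <= i)%N -> c' i 0 = 0.
  rewrite mxE; case: eqP => // /eqP ii0 ki; apply: ck.
  by rewrite ltn_neqAle ki andbT eq_sym -[k]/(val i0) (inj_eq val_inj).
have -> : v + c *m V =
    setrow i0 (1 *: row i0 v + c i0 0 *: V) (v + c' *m V).
  apply/matrixP => a b; rewrite !mxE !big_ord1 !mxE.
  by case: eqP => [->|]; rewrite ?mul1r// !mxE.
rewrite mlin_setrow mul1r.
have -> : setrow i0 (row i0 v) (v + c' *m V) = v + c' *m V.
  by apply/matrixP => a b; rewrite !mxE big_ord1 !mxE; case: eqP => [ai|//];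
    rewrite ?ai mul0r addr0.
have -> : setrow i0 V (v + c' *m V) = setrow i0 V v + c' *m V.
  by apply/matrixP => a b; rewrite !mxE big_ord1 !mxE; case: eqP => [ai|//];
    rewrite ?ai mul0r addr0.
rewrite !IH// [X in _ = _ + X](bigD1 i0)//= -addrA; congr (_ + _).
rewrite addrC; congr (_ + _).
  rewrite [X in _ + X]big1 ?addr0// => i _; rewrite mxE.
  by case: eqP => [_|/eqP ii0]; rewrite ?mul0r// alt_setrow2// mulr0.
rewrite (bigD1 i0)//= mxE eqxx mul0r add0r.
by apply: eq_bigr => i ii0; rewrite mxE (negPf ii0).
Qed.

Lemma alt_tperm i j v : i != j -> f (row_perm (tperm i j) v) = - f v.
Proof.
move=> ij; pose A := row i v; pose B := row j v.
have e X Y : f (setrow i X (setrow j Y v)) = f (setrow j Y (setrow i X v)).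
  by rewrite setrowC.
have := alt_setrow2 (1 *: A + 1 *: B) v ij.
rewrite mlin_setrow !mul1r.
rewrite e mlin_setrow [X in _ + X]e mlin_setrow !mul1r.
rewrite -!e !alt_setrow2// add0r addr0.
have -> : setrow i A (setrow j B v) = v by rewrite setrow_id setrow_id.
have -> : setrow i B (setrow j A v) = row_perm (tperm i j) v.
  apply/matrixP => a b; rewrite !mxE; case: eqP => [->|/eqP ai].
    by rewrite tpermL.
  case: eqP => [->|/eqP aj]; first by rewrite tpermR.
  by rewrite tpermD 1?eq_sym.
by move/eqP; rewrite addrC addr_eq0 => /eqP.
Qed.

Lemma alt_perm (s : 'S_p) v : f (row_perm s v) = (-1) ^+ s * f v.
Proof.
case: (prod_tpermP s) => ts -> /allP; elim: ts v => [|[i j] ts IH] v Hts.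
  by rewrite big_nil row_perm1 odd_perm1 mul1r.
rewrite big_cons row_permM.
have ij : i != j by have := Hts (i, j); rewrite mem_head; exact.
rewrite alt_tperm//= IH; last by move=> x xts; apply: Hts; rewrite inE xts orbT.
rewrite odd_permM odd_tperm ij addTb signrN mulNr //.
Qed.

End MultilinearAlternating.

(** Deleting one or the other of two equal rows gives arguments that differ by
    a cyclic permutation. *)
Lemma alt_row' (R : realType) n p (f : 'M[R]_(p, n.+1) -> R^o)
    (v : 'M[R]_(p.+1, n.+1)) (i j : 'I_p.+1) :
  multilinear f -> alternating f -> i != j -> row i v = row j v ->
  (-1) ^+ i * f (row' i v) = - ((-1) ^+ j * f (row' j v)).
Proof.
move=> fm fa ij vij.
have tk k : tperm i j (lift i k) != j.
  by rewrite -{2}(tpermL i j) (inj_eq perm_inj) eq_sym neq_lift.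
have [s0 s0E] : {s0 | forall k, lift j (s0 k) = tperm i j (lift i k)}.
  exists (fun k => odflt k (unlift j (tperm i j (lift i k)))) => k.
  by case: unliftP (tk k) => [m ->//|->]; rewrite eqxx.
have s0_inj : injective s0.
  move=> k l /(congr1 (lift j)); rewrite !s0E => /perm_inj; exact: lift_inj.
pose s := perm s0_inj.
have tE : tperm i j = lift_perm i j s.
  apply/permP => k; case: (unliftP i k) => [m ->|->].
    by rewrite lift_perm_lift [s m]permE s0E.
  by rewrite lift_perm_id tpermL.
have oS : odd i (+) odd j (+) s = true.
  by rewrite -odd_lift_perm -tE odd_tperm ij.
have rE : row' i v = row_perm s (row' j v).
  apply/matrixP => k l; rewrite !mxE [s k]permE s0E.
  have rij : v i l = v j l by have /rowP/(_ l) := vij; rewrite !mxE.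
  case: tpermP => [e|e|//]; last by rewrite e rij.
  by have := neq_lift i k; rewrite e eqxx.
rewrite rE alt_perm// mulrA -[(-1) ^+ i]signr_odd -[(-1) ^+ j]signr_odd -signr_addb.
have -> : odd i (+) s = ~~ odd j.
  by move: oS; case: (odd i); case: (odd j); case: (s : bool).
by rewrite signrN mulNr.
Qed.

(** * Pullback and exterior derivative *)

Section TopForms.
Variables (R : realType) (n : nat).

Lemma mlin_setrow_sum p (f : 'M[R]_(p, n.+1) -> R^o) i (I : Type) (r : seq I)
    (c : I -> R) (W : I -> 'rV[R]_n.+1) v : multilinear f ->
  f (setrow i (\sum_(j <- r) c j *: W j) v) =
  \sum_(j <- r) c j * f (setrow i (W j) v).
Proof.
move=> fm; elim: r => [|j r IH]; rewrite ?big_nil ?big_cons.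
  have := mlin_setrow fm i 0 0 0 0 v; rewrite !scale0r addr0 !mul0r addr0 //.
by rewrite -[X in c j *: W j + X]scale1r mlin_setrow// IH mul1r.
Qed.

Lemma alternating_det : alternating (fun v : 'M[R]_n.+1 => \det v : R^o).
Proof.
move=> v i j ij vij; apply: (determinant_alternate ij) => k.
by have /rowP/(_ k) := vij; rewrite !mxE.
Qed.

(** The determinant is, up to a factor, the only alternating form of top degree. *)
Lemma top_form_det (f : 'M[R]_n.+1 -> R^o) v : multilinear f -> alternating f ->
  f v = \det v * f 1%:M.
Proof.
move=> fm fa; pose g (v : 'M[R]_n.+1) : R^o := f v - \det v * f 1%:M.
have gm : multilinear g.
  move=> i u w z b c e1 e2 e3; rewrite /g (fm i u w z b c)//.
  by rewrite (determinant_multilinear e1)// /GRing.scale/=; ring.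
have ga : alternating g.
  by move=> u i j ij e; rewrite /g (fa _ i j)// (alternating_det ij)// mul0r subr0.
have g1 : g 1%:M = 0 by rewrite /g det1 mul1r subrr.
suff H k : forall v, (forall i : 'I_n.+1, (k <= i)%N ->
    exists j, row i v = 'e_j) -> g v = 0.
  by apply/eqP; rewrite -subr_eq0; apply/eqP/(H n.+1) => i; rewrite leqNgt ltn_ord.
elim: k {v} => [|k IH] v Hv.
  have {Hv}[h hE] : {h : 'I_n.+1 -> 'I_n.+1 | forall i, row i v = 'e_(h i)}.
    have /choice[h hE] : forall i, exists j, row i v = 'e_j by move=> i; exact: Hv.
    by exists h.
  have [/injectiveP hi|/injectivePn[i [j ij hij]]] := boolP (injectiveb h); last first.
    by rewrite (ga v i j)// !hE hij.
  have -> : v = row_perm (perm hi) 1%:M.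
    apply/matrixP => i l; have /rowP/(_ l) := hE i.
    by rewrite !mxE permE /= => ->; rewrite eq_sym.
  by rewrite alt_perm// g1 mulr0.
have [kn|nk] := ltnP k n.+1; last first.
  by apply: IH => i ki; have := leq_trans nk ki; rewrite leqNgt ltn_ord.
pose i0 := Ordinal kn.
rewrite -(setrow_id i0 v) {1}(row_sum_delta (row i0 v)) mlin_setrow_sum//.
apply: big1 => j _; rewrite IH ?mulr0// => i ki.
have [->|ii0] := eqVneq i i0; first by exists j; rewrite row_setrow.
rewrite row_setrow_neq//; apply: Hv.
by rewrite ltn_neqAle ki andbT eq_sym -[k]/(val i0) (inj_eq val_inj).
Qed.

End TopForms.

Section Pullback.
Variables (R : realType) (n : nat).
Local Notation E := 'rV[R]_n.+1.
Local Notation smooth := (@smooth R n).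

Lemma row_mul_jacobian p (h : E -> E) (x : E) (v : 'M[R]_(p, n.+1)) i :
  differentiable h x -> row i (v *m jacobian h x) = 'D_(row i v) h x.
Proof. by move=> dh; rewrite row_mul deriveEjacobian. Qed.

Lemma pullbackD p (h : E -> E) (w z : pform R n p) :
  pullback h (w + z) = pullback h w + pullback h z.
Proof. by []. Qed.

Lemma pullbackZ p (h : E -> E) (k : R) (w : pform R n p) :
  pullback h (k *: w) = k *: pullback h w.
Proof. by []. Qed.

Lemma multilinear_mulr p (f : 'M[R]_(p, n.+1) -> R^o) (M : 'M[R]_n.+1) :
  multilinear f -> multilinear (fun v => f (v *m M)).
Proof.
move=> fm i u v w b c e1 e2 e3; apply: (fm i).
- by rewrite !row_mul e1 mulmxDl -!scalemxAl.
- by rewrite !row'_mul e2.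
- by rewrite !row'_mul e3.
Qed.

Lemma alternating_mulr p (f : 'M[R]_(p, n.+1) -> R^o) (M : 'M[R]_n.+1) :
  alternating f -> alternating (fun v => f (v *m M)).
Proof. by move=> fa v i j ij e; apply: (fa _ i j ij); rewrite !row_mul e. Qed.

Lemma pullback_affine p (M : 'M[R]_n.+1) (b : E) (w : pform R n p) x v :
  pullback (fun y => b + y *m M) w x v = w (b + x *m M) (v *m M).
Proof.
rewrite /pullback; congr (w _ _); apply/row_matrixP => i.
have [dh _] := derive_affine_map M b x 0.
rewrite row_mul_jacobian//; have [_ ->] := derive_affine_map M b x (row i v).
by rewrite row_mul.
Qed.

Section Shear.
Variables (c : E -> R^o) (V : E).
Hypothesis sc : smooth c.
Let h (y : E) : E := y + c y *: V.

(** The differential of a shear is a perturbation of the identity of rank one. *)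
Lemma jacobian_shear p x (v : 'M[R]_(p, n.+1)) :
  v *m jacobian h x = v + (\col_i 'D_(row i v) c x) *m V.
Proof.
apply/row_matrixP => i.
have dc := smooth_diff x sc.
have [dh eh] := derive_shear_map V (row i v) dc.
rewrite row_mul_jacobian// eh; apply/rowP => j.
by rewrite !mxE big_ord1 !mxE.
Qed.

Lemma pullback_shear p (w : pform R n p) x v :
  multilinear (w (h x)) -> alternating (w (h x)) ->
  pullback h w x v =
  w (h x) v + \sum_i 'D_(row i v) c x * w (h x) (setrow i V v).
Proof.
move=> wm wa; rewrite /pullback jacobian_shear alt_rank1//; congr (_ + _).
by apply: eq_bigr => i _; rewrite mxE.
Qed.

Lemma smooth_form_pullback_shear p (w : pform R n p) :
  smooth_form w -> smooth_form (pullback h w).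
Proof.
move=> [wm wa ws].
split=> [x|x|v].
- exact: multilinear_mulr.
- exact: alternating_mulr.
- have -> : (fun x => pullback h w x v) = (fun x =>
      w (h x) v + \sum_i 'D_(row i v) c x * w (h x) (setrow i V v)).
    by apply/funext => x; rewrite pullback_shear.
  apply: smoothD; first exact: (@smooth_shear _ _ (fun x => w x v)).
  apply: smooth_sum => i; apply: smoothM; first exact: smooth_derive.
  exact: (@smooth_shear _ _ (fun x => w x (setrow i V v))).
Qed.

End Shear.

(** When rows i and j of v are equal, only the terms i and j of the sum can be
    nonzero, and they cancel by alt_row'. *)
Lemma smooth_form_ext_deriv p (w : pform R n p) :
  smooth_form w -> smooth_form (ext_deriv w).
Proof.
move=> [wm wa ws].
have dw v x : differentiable (fun y => w y v) x by exact: smooth_diff.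
split=> [x|x|v].
- move=> k u v z b c e1 e2 e3; rewrite /ext_deriv /GRing.scale/= !mulr_sumr.
  rewrite -big_split/=; apply: eq_bigr => i _.
  rewrite [b * _]mulrCA [c * _]mulrCA -mulrDr; congr (_ * _).
  have [->|ik] := eqVneq i k.
    by rewrite e1 e2 e3 derive_linear.
  have rowE (a : 'M[R]_(p.+1, n.+1)) : row' k a = row' k u -> row i a = row i u.
    case: (unliftP k i) ik => [m ->|->]; last by rewrite eqxx.
    move=> _ /matrixP e; apply/rowP => l; have := e m l.
    by rewrite !mxE.
  rewrite (rowE v)// (rowE z)//.
  have [m km] : exists m, k = lift i m.
    by case: (unliftP i k) ik => [m ->|->]; [exists m|rewrite eqxx].
  have uvz y : w y (row' i u) = b * w y (row' i v) + c * w y (row' i z).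
    have row'E (a : 'M[R]_(p.+1, n.+1)) : row' k a = row' k u ->
        row' m (row' i a) = row' m (row' i u).
      move=> /matrixP e; apply/matrixP => q l; rewrite !mxE.
      case: (unliftP k (lift i (lift m q))) => [r ->|].
        by have := e r l; rewrite !mxE.
      by rewrite km => /lift_inj e'; have := neq_lift m q; rewrite e' eqxx.
    apply: (wm y m); [|exact: row'E|exact: row'E].
    by have /rowP e := e1; apply/rowP => l; have := e l; rewrite !mxE -!km.
  have -> : (fun y => w y (row' i u)) =
      (fun y => b * w y (row' i v) + c * w y (row' i z)) by exact/funext.
  by rewrite derive_lincomb//; exact: ws.
- move=> v i j ij e; rewrite /ext_deriv (bigD1 i)//= (bigD1 j)//=; last by rewrite eq_sym.
  rewrite big1 ?addr0 => [|k /andP[ki kj]]; last first.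
    have -> : (fun y => w y (row' k v)) = (fun=> 0 : R^o).
      apply/funext => y.
      case: (unliftP k i) ki => [i' i'E|->]; last by rewrite eqxx.
      case: (unliftP k j) kj => [j' j'E|->]; last by rewrite eqxx.
      move=> _ _; apply: (wa y (row' k v) i' j').
        by apply: contraNneq ij => ij'; rewrite i'E j'E ij'.
      apply/rowP => l; have /rowP/(_ l) := e.
      by rewrite !mxE -i'E -j'E.
    by rewrite derive_cst scaler0.
  have s2 : ((-1) ^+ i * (-1) ^+ i : R) = 1 by rewrite -expr2 sqrr_sign.
  have -> : (fun y => w y (row' i v)) =
      (fun y => - ((-1) ^+ i * (-1) ^+ j) * w y (row' j v) + 0 * 0).
    apply/funext => y; have := alt_row' (wm y) (wa y) ij e.
    move=> /(congr1 ( *%R ((-1) ^+ i))); rewrite mulrA s2 mul1r => ->; ring.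
  rewrite e derive_lincomb//; last exact: smooth_cst.
  rewrite derive_cst /GRing.scale/= mulr0 addr0 mulrA mulrN mulrA s2 mul1r.
  by rewrite mulNr addNr.
- apply: smooth_sum => i; apply: smoothZ.
  exact: (@smooth_derive _ _ (fun y => w y (row' i v)) (row i v)).
Qed.

Lemma ext_deriv_pullback_affine p (M : 'M[R]_n.+1) (b : E) (w : pform R n p) :
  smooth_form w ->
  ext_deriv (pullback (fun y => b + y *m M) w) =
  pullback (fun y => b + y *m M) (ext_deriv w).
Proof.
move=> [wm wa ws]; apply/funext => x; apply/funext => v.
rewrite [RHS]pullback_affine; apply: eq_bigr => i _; congr (_ *: _).
have -> : (fun y => pullback (fun z : E => b + z *m M) w y (row' i v)) =
    (fun y => w (b + y *m M) (row' i v *m M)).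
  by apply/funext => y; rewrite pullback_affine.
rewrite (@derive_affine _ _ (fun y => w y (row' i v *m M))); last exact: smooth_diff.
by rewrite row_mul row'_mul.
Qed.

(** Besides the terms that the differential of the shear accounts for, d of
    the pullback contains the Hessian of c, contracted with V and
    antisymmetrized; it vanishes because the Hessian is symmetric. *)
Lemma ext_deriv_pullback_shear p (c : E -> R^o) (V : E) (w : pform R n p) :
  smooth c ->
  (forall u v x, 'D_u (fun y => 'D_v c y) x = 'D_v (fun y => 'D_u c y) x) ->
  smooth_form w ->
  ext_deriv (pullback (fun y => y + c y *: V) w) =
  pullback (fun y => y + c y *: V) (ext_deriv w).
Proof.
move=> sc symc [wm wa ws]; apply/funext => x; apply/funext => v.
set h := fun y : E => y + c y *: V.
pose H (u u' : E) : R := 'D_u (fun y => 'D_u' c y) x.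
pose Q (j k : 'I_p.+1) : R := w (h x) (row' j (setrow k V v)).
have dE (j : 'I_p.+1) : 'D_(row j v) (fun y => pullback h w y (row' j v)) x =
    'D_(row j (v *m jacobian h x))
      (fun y => w y (row' j (v *m jacobian h x))) (h x) +
    \sum_(k : 'I_p.+1 | k != j) H (row j v) (row k v) * Q j k.
  have rJ : row' j (v *m jacobian h x) = row' j v *m jacobian h x by rewrite row'_mul.
  rewrite rJ !(jacobian_shear V sc) -/h.
  have -> : (fun y => w y (row' j v + (\col_i 'D_(row i (row' j v)) c x) *m V)) =
     (fun y => w y (row' j v) + \sum_i 'D_(row i (row' j v)) c x *
        w y (setrow i V (row' j v))).
    apply/funext => y; rewrite (alt_rank1 (wm y) (wa y)); congr (_ + _).
    by apply: eq_bigr => i _; rewrite mxE.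
  set u := row j v; set r : 'M[R]_(p, n.+1) := row' j v.
  have hF (F : E -> R^o) : smooth F -> 'D_u (fun y => F (h y)) x =
      'D_(row j (v + (\col_i 'D_(row i v) c x) *m V)) F (h x).
    move=> sF; have -> : row j (v + (\col_i 'D_(row i v) c x) *m V) =
      1 *: u + 'D_u c x *: V.
      by apply/rowP => l; rewrite !mxE big_ord1 !mxE mul1r.
    rewrite derive_linear ?mul1r; last exact: smooth_diff.
    by rewrite -derive_shear//; exact: smooth_diff.
  have sFh (F : E -> R^o) : smooth F -> smooth (fun y => F (h y)).
    by move=> sF; exact: smooth_shear.
  have -> : (fun y => pullback h w y r) = (fun y => w (h y) r +
      \sum_i 'D_(row i r) c y * w (h y) (setrow i V r)).
    by apply/funext => y; rewrite (pullback_shear sc _ (wm _) (wa _)).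
  rewrite derive_addsum; last first.
  - by move=> i; apply: smoothM; [exact: smooth_derive|exact: (sFh (fun y => w y (setrow i V r)))].
  - exact: (sFh (fun y => w y r)).
  rewrite [in RHS]derive_addsum; [|exact: ws|by move=> i; exact: smoothZ].
  rewrite (hF (fun y => w y r))// -!addrA; congr (_ + _).
  have -> : \sum_(k | k != j) H u (row k v) * Q j k =
      \sum_i H u (row i r) * w (h x) (setrow i V r).
    have := @bigD1_ord R +%R 0 p.+1 j xpredT (fun k => H u (row k v) * Q j k) isT.
    rewrite (bigD1 j)//= => /addrI ->; apply: eq_bigr => i _.
    have -> : row (lift j i) v = row i r by apply/rowP => l; rewrite !mxE.
    by rewrite /Q row'_setrow_lift.
  rewrite -big_split/=; apply: eq_bigr => i _.
  have sc' : smooth (fun y => 'D_(row i r) c y) by exact: smooth_derive.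
  have sF' := sFh _ (ws (setrow i V r)).
  rewrite (deriveM (smooth_derivable sc') (smooth_derivable sF')).
  rewrite (hF (fun y => w y (setrow i V r)))//.
  rewrite (deriveZ _ (smooth_derivable (ws (setrow i V r)))).
  by rewrite /GRing.scale/= [X in _ + X]mulrC.
rewrite /ext_deriv.
under eq_bigr do rewrite dE scalerDr.
rewrite big_split/= -[RHS]addr0 /pullback /ext_deriv; congr (_ + _).
pose T (j k : 'I_p.+1) : R := if k != j then (-1) ^+ j * (H (row j v) (row k v) * Q j k) else 0.
have TN j k : T j k = - T k j.
  rewrite /T eq_sym; case: eqVneq => [_|jk] /=; first by rewrite oppr0.
  have -> : H (row k v) (row j v) = H (row j v) (row k v) by exact: symc.
  rewrite mulrCA [X in _ = - X]mulrCA -mulrN; congr (_ * _).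
  have e1 : Q j k = w (h x) (row' j (setrow k V (setrow j V v))).
    by rewrite /Q setrowC 1?eq_sym// row'_setrow.
  have e2 : Q k j = w (h x) (row' k (setrow k V (setrow j V v))).
    by rewrite /Q row'_setrow.
  rewrite e1 e2; apply: alt_row' => //.
  by rewrite row_setrow row_setrow_neq// row_setrow.
have : \sum_j \sum_k T j k = - \sum_j \sum_k T j k.
  rewrite {1}exchange_big/= -sumrN; apply: eq_bigr => j _.
  by rewrite -sumrN; apply: eq_bigr => k _; exact: TN.
move/eqP; rewrite -addr_eq0 -mulr2n mulrn_eq0/= => /eqP T0; rewrite -[RHS]T0.
apply: eq_bigr => j _; rewrite scaler_sumr big_mkcond/=.
by apply: eq_bigr => k _; rewrite /T; case: ifP.
Qed.

End Pullback.

(** * Flows of shears *)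

Section FunctorialPullback.
Variables (R : realType) (n : nat).
Local Notation E := 'rV[R]_n.+1.

Lemma jacobian_comp p (h1 h2 : E -> E) (x : E) (v : 'M[R]_(p, n.+1)) :
  differentiable h1 x -> differentiable h2 (h1 x) ->
  v *m jacobian h1 x *m jacobian h2 (h1 x) = v *m jacobian (h2 \o h1) x.
Proof.
move=> d1 d2; have d12 : differentiable (h2 \o h1) x by exact: differentiable_comp.
apply/row_matrixP => i.
transitivity ('D_(row i v) (h2 \o h1) x); last first.
  by rewrite row_mul_jacobian.
rewrite deriveE// (diff_comp d1 d2) row_mul (row_mul_jacobian v i d1).
by rewrite -deriveEjacobian// !deriveE.
Qed.

Lemma pullback_comp p (h1 h2 : E -> E) (w : pform R n p) :
  (forall x, differentiable h1 x) -> (forall x, differentiable h2 x) ->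
  pullback h1 (pullback h2 w) = pullback (h2 \o h1) w.
Proof.
move=> d1 d2; apply/funext => x; apply/funext => v.
by have := jacobian_comp v (d1 x) (d2 (h1 x)) => /(congr1 (w (h2 (h1 x)))).
Qed.

Lemma jacobian_id (x : E) : jacobian (fun y : E => y) x = 1%:M.
Proof.
apply/row_matrixP => i; rewrite -[jacobian _ x]mul1mx row_mul_jacobian//.
exact: derive_id.
Qed.

Lemma pullback_id p (w : pform R n p) : pullback (fun y => y) w = w.
Proof.
by apply/funext => x; apply/funext => v; rewrite /pullback jacobian_id mulmx1.
Qed.

Lemma ext_deriv_lincomb p (k : R) (w z : pform R n p) :
  smooth_form w -> smooth_form z ->
  ext_deriv (k *: w + z) = k *: ext_deriv w + ext_deriv z.
Proof.
move=> [_ _ sw] [_ _ sz]; apply/funext => x; apply/funext => v.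
transitivity (k * ext_deriv w x v + ext_deriv z x v); last by [].
rewrite /ext_deriv mulr_sumr -big_split/=; apply: eq_bigr => i _.
have -> : (fun y => (k *: w + z) y (row' i v)) =
    (fun y => k * w y (row' i v) + 1 * z y (row' i v)).
  by apply/funext => y; rewrite mul1r.
by rewrite derive_lincomb// mul1r /GRing.scale/= mulrDr mulrCA.
Qed.

Lemma smooth_form_lincomb p (k : R) (w z : pform R n p) :
  smooth_form w -> smooth_form z -> smooth_form (k *: w + z).
Proof.
move=> [mw aw sw] [mz az sz]; split=> [x|x|v].
- move=> i u v t b c e1 e2 e3; rewrite !fctE.
  rewrite (mw x i u v t b c)// (mz x i u v t b c)// /GRing.scale/=; ring.
- by move=> v i j ij e; rewrite !fctE (aw x v i j)// (az x v i j)// scaler0 addr0.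
- apply: smoothD => //; exact: smoothZ.
Qed.

Lemma smooth_form0 p : smooth_form (0 : pform R n p).
Proof.
split=> [x|x|v]; last exact: smooth_cst.
  have z0 u : (0 : pform R n p) x u = 0 by [].
  by move=> i u v t b c _ _ _; rewrite !z0 !scaler0 addr0.
by [].
Qed.

End FunctorialPullback.

Lemma derive1_shift (R : realType) (F : R -> R^o) (s : R) :
  derive1 (fun r => F (r + s)) 0 = derive1 F s.
Proof.
by rewrite /derive1; under eq_fun do rewrite addr0 add0r.
Qed.

Section ShearFlow.
Variables (R : realType) (n : nat).
Local Notation E := 'rV[R]_n.+1.
Local Notation smooth := (@smooth R n).
Variables (c : E -> R^o) (V : E).
Hypothesis sc : smooth c.
Hypothesis cV : forall x (r : R), c (x + r *: V) = c x.
Hypothesis symc : forall u v x,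
  'D_u (fun y => 'D_v c y) x = 'D_v (fun y => 'D_u c y) x.

Definition shear_flow (s : R) (y : E) : E := y + (s * c y) *: V.
Local Notation phi := shear_flow.
Local Notation P s w := (pullback (phi s) w).

Lemma shear_flowD s r x : phi s (phi r x) = phi (s + r) x.
Proof. by rewrite /shear_flow cV -addrA -scalerDl -mulrDl [r + s]addrC. Qed.

Lemma shear_flow0 : phi 0 = id.
Proof. by apply/funext => x; rewrite /shear_flow mul0r scale0r addr0. Qed.

Lemma smooth_sc s : smooth (fun y => s * c y).
Proof. exact: smoothZ. Qed.

Lemma shear_flow_diff s x : differentiable (phi s) x.
Proof.
by case: (@derive_shear_map _ _ (fun y => s * c y) V x 0 (smooth_diff x (smooth_sc s))).
Qed.

Lemma pullback_shear_flowD p (w : pform R n p) s r : P s (P r w) = P (r + s) w.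
Proof.
rewrite pullback_comp; [|exact: shear_flow_diff..].
by congr (pullback _ w); apply/funext => x /=; rewrite shear_flowD.
Qed.

Lemma pullback_shear_flow0 p (w : pform R n p) : P 0 w = w.
Proof. by rewrite shear_flow0 pullback_id. Qed.

Lemma derive_sc s v x : 'D_v (fun y => s * c y) x = s * 'D_v c x.
Proof. by rewrite (deriveZ s (smooth_derivable sc)). Qed.

Lemma pullback_shear_flow p (w : pform R n p) s x v : smooth_form w ->
  P s w x v = flow_integrand 0 c V (fun y => w y v) s x +
    \sum_i 'D_(row i v) c x * flow_integrand 1 c V (fun y => w y (setrow i V v)) s x.
Proof.
move=> [wm wa _].
rewrite /shear_flow (pullback_shear (smooth_sc s) _ (wm _) (wa _)).
rewrite /flow_integrand expr0 mul1r; congr (_ + _).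
by apply: eq_bigr => i _; rewrite derive_sc expr1; ring.
Qed.

Lemma smooth_form_pullback_flow p (w : pform R n p) s :
  smooth_form w -> smooth_form (P s w).
Proof. exact: (@smooth_form_pullback_shear _ _ _ V (smooth_sc s)). Qed.

Lemma ext_deriv_pullback_flow p (w : pform R n p) s :
  smooth_form w -> ext_deriv (P s w) = P s (ext_deriv w).
Proof.
move=> sw.
have sym' u v x : 'D_u (fun y => 'D_v (fun y => s * c y) y) x =
    'D_v (fun y => 'D_u (fun y => s * c y) y) x.
  have e u' : (fun y => 'D_u' (fun y => s * c y) y) = (fun y => s * 'D_u' c y).
    by apply/funext => y; exact: derive_sc.
  rewrite (e u) (e v) (deriveZ s (smooth_derivable (smooth_derive v sc))).
  by rewrite (deriveZ s (smooth_derivable (smooth_derive u sc))) symc.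
exact: (@ext_deriv_pullback_shear _ _ _ (fun y => s * c y) V w (smooth_sc s) sym' sw).
Qed.

Lemma continuous_addsum m (f : R -> R^o) (F : 'I_m -> R -> R^o) :
  continuous f -> (forall i, continuous (F i)) ->
  continuous (fun s => f s + \sum_i F i s).
Proof.
by move=> cf cF s; apply: cvgD; [exact: cf|exact: (@continuous_sum _ _ _ F cF s)].
Qed.

Lemma continuous_flow_integrand' k f x : smooth f ->
  continuous (fun s => flow_integrand k c V f s x).
Proof.
move=> sf; exact: (@continuous_flow_integrand _ _ k c V f x
  (smooth_continuous sf) (smooth_continuous sc)).
Qed.

Lemma continuousZ (k : R) (f : R -> R^o) : continuous f ->
  continuous (fun s => k * f s).
Proof. by move=> cf s; apply: cvgM; [exact: cvg_cst|exact: cf]. Qed.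

Lemma continuous_pullback_flow p (w : pform R n p) x v : smooth_form w ->
  continuous (fun s => P s w x v).
Proof.
move=> sw; have [_ _ ws] := sw.
under eq_fun do rewrite pullback_shear_flow//.
apply: continuous_addsum; first exact: continuous_flow_integrand'.
by move=> i; apply: continuousZ; exact: continuous_flow_integrand'.
Qed.

Definition flow_mean p (w : pform R n p) : pform R n p :=
  fun x v => int01 (fun s => P s w x v).

Lemma flow_meanE p (w : pform R n p) x v : smooth_form w ->
  flow_mean w x v = flow_int 0 c V (fun y => w y v) x +
    \sum_i 'D_(row i v) c x * flow_int 1 c V (fun y => w y (setrow i V v)) x.
Proof.
move=> sw; have [_ _ ws] := sw; rewrite /flow_mean.
under [X in int01 X]eq_fun do rewrite pullback_shear_flow//.
have ci i : continuous (fun s => 'D_(row i v) c x *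
    flow_integrand 1 c V (fun y => w y (setrow i V v)) s x).
  by apply: continuousZ; exact: continuous_flow_integrand'.
rewrite int01D; [|exact: continuous_flow_integrand'|exact: continuous_sum].
rewrite int01_sum//; congr (_ + _); apply: eq_bigr => i _.
by rewrite int01Z//; exact: continuous_flow_integrand'.
Qed.

Lemma flow_mean_lincomb p (k : R) (w z : pform R n p) :
  smooth_form w -> smooth_form z ->
  flow_mean (k *: w + z) = k *: flow_mean w + flow_mean z.
Proof.
move=> sw sz; apply/funext => x; apply/funext => v.
transitivity (k * flow_mean w x v + flow_mean z x v); last by [].
rewrite /flow_mean.
have cw := @continuous_pullback_flow p w x v sw.
have cz := @continuous_pullback_flow p z x v sz.
by rewrite -int01Z// -int01D//; exact: continuousZ.
Qed.

Lemma derive_flow_mean p (w : pform R n p) x u v : smooth_form w ->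
  continuous (fun s => 'D_u (fun y => P s w y v) x) /\
  'D_u (fun y => flow_mean w y v) x = int01 (fun s => 'D_u (fun y => P s w y v) x).
Proof.
move=> sw; have [_ _ ws] := sw.
pose f i := fun y => w y (setrow i V v).
pose d i := fun y => 'D_(row i v) c y.
have sd i : smooth (d i) by exact: smooth_derive.
have sg k f' s : smooth f' -> smooth (flow_integrand k c V f' s).
  by move=> sf; exact: smooth_flow_integrand.
have dP s : 'D_u (fun y => P s w y v) x =
    'D_u (flow_integrand 0 c V (fun y => w y v) s) x +
    \sum_i (d i x * 'D_u (flow_integrand 1 c V (f i) s) x +
            'D_u (d i) x * flow_integrand 1 c V (f i) s x).
  have -> : (fun y => P s w y v) = (fun y =>
      flow_integrand 0 c V (fun y => w y v) s y +
      \sum_i d i y * flow_integrand 1 c V (f i) s y).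
    by apply/funext => y; exact: pullback_shear_flow.
  rewrite derive_addsum; [|exact: sg|]; last first.
    by move=> i; apply: smoothM; [exact: sd|apply: sg; exact: ws].
  congr (_ + _); apply: eq_bigr => i _.
  rewrite (deriveM (smooth_derivable (sd i)) (smooth_derivable (sg 1%N (f i) s (ws _)))).
  by rewrite /GRing.scale/= [X in _ + X]mulrC.
have dJ : 'D_u (fun y => flow_mean w y v) x =
    'D_u (flow_int 0 c V (fun y => w y v)) x +
    \sum_i (d i x * 'D_u (flow_int 1 c V (f i)) x +
            'D_u (d i) x * flow_int 1 c V (f i) x).
  have -> : (fun y => flow_mean w y v) = (fun y =>
      flow_int 0 c V (fun y => w y v) y +
      \sum_i d i y * flow_int 1 c V (f i) y).
    by apply/funext => y; exact: flow_meanE.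
  have sf i : smooth (flow_int 1 c V (f i)) by apply: smooth_flow_int => //; exact: ws.
  rewrite derive_addsum; [|exact: smooth_flow_int|]; last first.
    by move=> i; apply: smoothM.
  congr (_ + _); apply: eq_bigr => i _.
  rewrite (deriveM (smooth_derivable (sd i)) (smooth_derivable (sf i))).
  by rewrite /GRing.scale/= [X in _ + X]mulrC.
have c1 k f' : smooth f' -> continuous (fun s => 'D_u (flow_integrand k c V f' s) x).
  by move=> sf; exact: continuous_derive_flow_integrand.
have c2 i : continuous (fun s => d i x * 'D_u (flow_integrand 1 c V (f i) s) x).
  by apply: continuousZ; apply: c1; exact: ws.
have c3 i : continuous (fun s => 'D_u (d i) x * flow_integrand 1 c V (f i) s x).
  by apply: continuousZ; apply: continuous_flow_integrand'; exact: ws.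
have c4 i : continuous (fun s => d i x * 'D_u (flow_integrand 1 c V (f i) s) x +
            'D_u (d i) x * flow_integrand 1 c V (f i) s x).
  by move=> s; apply: cvgD; [exact: c2|exact: c3].
have -> : (fun s => 'D_u (fun y => P s w y v) x) = (fun s =>
    'D_u (flow_integrand 0 c V (fun y => w y v) s) x +
    \sum_i (d i x * 'D_u (flow_integrand 1 c V (f i) s) x +
            'D_u (d i) x * flow_integrand 1 c V (f i) s x)) by exact/funext.
split; first by apply: continuous_addsum => //; apply: c1; exact: ws.
rewrite dJ int01D; [|by apply: c1; exact: ws|exact: continuous_sum].
rewrite int01_sum//; congr (_ + _).
  by have [_ ->] := flow_int_diff 0 V x (ws v) sc.
apply: eq_bigr => i _; rewrite int01D//; congr (_ + _).
  rewrite int01Z; last by apply: c1; exact: ws.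
  by have [_ ->] := flow_int_diff 1 V x (ws (setrow i V v)) sc.
by rewrite int01Z//; apply: continuous_flow_integrand'; exact: ws.
Qed.

Lemma ext_deriv_flow_mean p (w : pform R n p) : smooth_form w ->
  ext_deriv (flow_mean w) = flow_mean (ext_deriv w).
Proof.
move=> sw; apply/funext => x; apply/funext => v.
rewrite [RHS]/flow_mean.
under [X in int01 X]eq_fun do rewrite -ext_deriv_pullback_flow//.
rewrite /ext_deriv.
have ci (i : 'I_p.+1) : continuous (fun s =>
    (-1) ^+ i * 'D_(row i v) (fun y => P s w y (row' i v)) x).
  by apply: continuousZ; case: (derive_flow_mean x (row i v) (row' i v) sw).
rewrite int01_sum//; apply: eq_bigr => i _.
have [cD ->] := derive_flow_mean x (row i v) (row' i v) sw.
by rewrite int01Z.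
Qed.

Lemma pullback_flow_derivable p (w : pform R n p) x v (s : R) : smooth_form w ->
  derivable (fun s : R => P s w x v) s 1.
Proof.
move=> sw; have [_ _ ws] := sw.
under eq_fun do rewrite pullback_shear_flow//.
have df k f : smooth f -> derivable (fun s : R => flow_integrand k c V f s x) s 1.
  move=> sf; apply: derivableM; first exact: exprn_derivable.
  have -> : (fun s => f (x + (s * c x) *: V)) = (fun s => f (x + s *: (c x *: V))).
    by apply/funext => r; rewrite scalerA.
  by case: (is_derive_line (v := c x *: V) (smooth_diff (x + s *: (c x *: V)) sf)).
apply: derivableD; first exact: df.
have -> : (fun s => \sum_i 'D_(row i v) c x *
    flow_integrand 1 c V (fun y => w y (setrow i V v)) s x) =
  \sum_i (fun s => 'D_(row i v) c x *
    flow_integrand 1 c V (fun y => w y (setrow i V v)) s x).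
  by apply/funext => r; rewrite fct_sumE.
apply: derivable_sum => i; apply: derivableM; first exact: derivable_cst.
exact: df.
Qed.

Lemma lie_derivE p (w : pform R n p) x v : smooth_form w ->
  lie_deriv phi w x v = c x * 'D_V (fun y => w y v) x +
    \sum_i 'D_(row i v) c x * w x (setrow i V v).
Proof.
move=> sw; have [_ _ ws] := sw.
rewrite /lie_deriv derive1E.
have df f : smooth f -> is_derive (0 : R) 1 (fun s : R => f (x + (s * c x) *: V))
    (c x * 'D_V f x).
  move=> sf; have := is_derive_line (v := c x *: V) (smooth_diff (x + (0 : R) *: (c x *: V)) sf).
  rewrite scale0r addr0 deriveE; last exact: smooth_diff.
  rewrite linearZZ -deriveE; last exact: smooth_diff.
  by under eq_fun do rewrite scalerA.
have d0 := df _ (ws v).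
have d1 i : is_derive (0 : R) 1 (fun s => 'D_(row i v) c x *
    flow_integrand 1 c V (fun y => w y (setrow i V v)) s x : R^o)
    ('D_(row i v) c x * w x (setrow i V v)).
  have [da db] := df _ (ws (setrow i V v)).
  have di : derivable (fun s : R => s ^+ 1 : R^o) 0 1 by exact: exprn_derivable.
  have dm : derivable (fun s => flow_integrand 1 c V (fun y => w y (setrow i V v)) s x) 0 1.
    exact: derivableM di da.
  split; first by apply: derivableM => //; exact: derivable_cst.
  rewrite (deriveZ _ dm) /flow_integrand (deriveM di da) db.
  rewrite expr1 scale0r add0r mul0r scale0r addr0.
  by rewrite (@derive_id _ R^o) /GRing.scale/= mulr1.
under eq_fun do rewrite pullback_shear_flow//.
have -> : (fun s => flow_integrand 0 c V (fun y => w y v) s x +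
    \sum_i 'D_(row i v) c x *
    flow_integrand 1 c V (fun y => w y (setrow i V v)) s x) =
  (fun s => w (x + (s * c x) *: V) v : R^o) +
  \sum_i (fun s => 'D_(row i v) c x *
    flow_integrand 1 c V (fun y => w y (setrow i V v)) s x : R^o).
  apply/funext => r; rewrite [RHS]/(_ + _)/= fct_sumE.
  by rewrite {1}/flow_integrand expr0 mul1r.
by have [_ ->] := is_deriveD d0 (is_derive_sum d1).
Qed.

Lemma derive1_lincomb (f g : R -> R^o) (a b : R) : derivable f (0 : R) 1 ->
  derivable g (0 : R) 1 ->
  derive1 (fun s => a * f s + b * g s : R^o) 0 = a * derive1 f 0 + b * derive1 g 0.
Proof.
move=> df dg; rewrite !derive1E.
rewrite (deriveD (f := fun y => a * f y) (g := fun y => b * g y)).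
- by rewrite (deriveZ a df) (deriveZ b dg).
- exact: (derivableZ df).
- exact: (derivableZ dg).
Qed.

Lemma lie_deriv_lincomb p (k : R) (w z : pform R n p) :
  smooth_form w -> smooth_form z ->
  lie_deriv phi (k *: w + z) = k *: lie_deriv phi w + lie_deriv phi z.
Proof.
move=> sw sz; apply/funext => x; apply/funext => v.
transitivity (k * lie_deriv phi w x v + lie_deriv phi z x v); last by [].
rewrite /lie_deriv.
have -> : (fun s => P s (k *: w + z) x v) =
    (fun s => k * P s w x v + 1 * P s z x v).
  by apply/funext => s; rewrite mul1r.
rewrite derive1_lincomb ?mul1r//; exact: pullback_flow_derivable.
Qed.

Lemma smooth_form_lie p (w : pform R n p) :
  smooth_form w -> smooth_form (lie_deriv phi w).
Proof.
move=> sw; have [_ _ ws] := sw; split=> [x|x|v].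
- move=> i u v z a b e1 e2 e3; rewrite /lie_deriv /GRing.scale/=.
  rewrite -derive1_lincomb; do ?exact: pullback_flow_derivable.
  congr (derive1 _ _); apply/funext => s.
  have [mP _ _] := smooth_form_pullback_flow s sw.
  exact: (mP x i u v z a b).
- move=> v i j ij e; rewrite /lie_deriv.
  have -> : (fun s => P s w x v) = cst (0 : R^o).
    apply/funext => s; have [_ aP _] := smooth_form_pullback_flow s sw.
    exact: (aP x v i j).
  by rewrite derive1_cst.
- have -> : (fun x => lie_deriv phi w x v) = (fun x =>
    c x * 'D_V (fun y => w y v) x +
    \sum_i 'D_(row i v) c x * w x (setrow i V v)).
    by apply/funext => x; exact: lie_derivE.
  apply: smoothD; first by apply: smoothM => //; exact: smooth_derive.
  apply: smooth_sum => i; apply: smoothM; last exact: ws.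
  exact: smooth_derive.
Qed.

(** The flow property reduces the derivative at s to the derivative at 0. *)
Lemma pullback_flow_is_derive p (w : pform R n p) x v (s : R) : smooth_form w ->
  is_derive s 1 (fun s : R => P s w x v) (P s (lie_deriv phi w) x v).
Proof.
move=> sw; split; first exact: pullback_flow_derivable.
rewrite -derive1E; pose F r := P r w x v.
have shift0 := derive1_shift F s.
have e : (fun r => pullback (phi r) w (phi s x) (v *m jacobian (phi s) x)) =
    (fun r => F (r + s)).
  by apply/funext => r; rewrite /F -pullback_shear_flowD.
have pE : P s (lie_deriv phi w) x v =
  lie_deriv phi w (phi s x) (v *m jacobian (phi s) x) := erefl.
have lE y u : lie_deriv phi w y u = derive1 (fun r => P r w y u) 0 := erefl.
have E1 := congr1 (fun f : R -> R^o => derive1 f 0) e.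
exact: (etrans (esym shift0) (etrans (esym E1) (esym (etrans pE (lE _ _))))).
Qed.

(** Integration of d/ds phi_s^* w = phi_s^* (L w) over the unit interval. *)
Lemma flow_mean_lie p (w : pform R n p) : smooth_form w ->
  flow_mean (lie_deriv phi w) = P 1 w - w.
Proof.
move=> sw; apply/funext => x; apply/funext => v.
have cl := @continuous_pullback_flow p _ x v (smooth_form_lie sw).
have dl (s : R) := @pullback_flow_is_derive p w x v s sw.
have P0 : P 0 w x v = w x v by rewrite pullback_shear_flow0.
exact: (etrans (int01_FTC cl dl) (congr1 (fun r => P 1 w x v - r) P0)).
Qed.

(** If the mean of phi_s^* w over s in the unit interval vanishes, so does its
    pullback by phi_r, which is the mean over s between r and r + 1; hence
    phi_1^* w = phi_0^* w by int01_shift_inj. *)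
Lemma flow_mean_eq0 p (w : pform R n p) : smooth_form w -> flow_mean w = 0 ->
  P 1 w = w.
Proof.
move=> sw w0; apply/funext => x; apply/funext => v.
have cl := @continuous_pullback_flow p _ x v (smooth_form_lie sw).
have dl (s : R) := @pullback_flow_is_derive p w x v s sw.
have P0 : P 0 w x v = w x v by rewrite pullback_shear_flow0.
apply: etrans _ P0; apply: (int01_shift_inj dl cl) => r.
have e : (fun s => P (s + r) w x v) =
    (fun s => P s w (phi r x) (v *m jacobian (phi r) x)).
  by apply/funext => s; rewrite -pullback_shear_flowD.
have e0 : flow_mean w (phi r x) (v *m jacobian (phi r) x) = 0 by rewrite w0.
exact: (etrans (congr1 (@int01 R) e) e0).
Qed.

Section Equivariance.
Variable h : E -> E.
Hypothesis dh : forall x, differentiable h x.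
Hypothesis hphi : forall s x, h (phi s x) = phi s (h x).

Lemma pullback_flowC p (w : pform R n p) s :
  pullback h (P s w) = P s (pullback h w).
Proof.
have dphi := shear_flow_diff s.
apply: (etrans (pullback_comp w dh dphi)); apply: etrans (esym (pullback_comp w dphi dh)).
have -> // : phi s \o h = h \o phi s by apply/funext => x /=; rewrite hphi.
Qed.

Lemma pullback_lie p (w : pform R n p) :
  pullback h (lie_deriv phi w) = lie_deriv phi (pullback h w).
Proof.
apply/funext => x; apply/funext => v.
have e : (fun s => pullback h (P s w) x v) = (fun s => P s (pullback h w) x v).
  by apply/funext => s; rewrite pullback_flowC.
exact: (congr1 (fun f : R -> R^o => derive1 f 0) e).
Qed.

End Equivariance.

End ShearFlow.

(** * Coordinates on the group *)

Section Coordinates.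
Variable R : realType.
Local Notation E := 'rV[R]_3.

Definition j0 : 'I_3 := @Ordinal 3 0 isT.
Definition j1 : 'I_3 := @Ordinal 3 1 isT.
Definition j2 : 'I_3 := @Ordinal 3 2 isT.

Lemma ord3P (P : 'I_3 -> Prop) : P j0 -> P j1 -> P j2 -> forall i, P i.
Proof.
move=> p0 p1 p2 [[|[|[|//]]] hi].
- by rewrite (_ : Ordinal hi = j0)//; exact: val_inj.
- by rewrite (_ : Ordinal hi = j1)//; exact: val_inj.
- by rewrite (_ : Ordinal hi = j2)//; exact: val_inj.
Qed.

Lemma pt0 (u : 'cV[R]_2) t : (pt u t : E) 0 j0 = u 0 0.
Proof.
rewrite /pt (_ : j0 = lshift 1 (0 : 'I_2)); last exact: val_inj.
by rewrite (row_mxEl u^T) mxE.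
Qed.

Lemma pt1 (u : 'cV[R]_2) t : (pt u t : E) 0 j1 = u 1 0.
Proof.
rewrite /pt (_ : j1 = lshift 1 (1 : 'I_2)); last exact: val_inj.
by rewrite (row_mxEl u^T) mxE.
Qed.

Lemma heightE (x : E) : height x = x 0 j2.
Proof. by rewrite /height mxE; congr (x _ _); exact: val_inj. Qed.

Lemma height_pt (u : 'cV[R]_2) t : height (pt u t) = t.
Proof. by rewrite /height /pt (row_mxKr u^T) mxE. Qed.

Lemma pt2 (u : 'cV[R]_2) t : (pt u t : E) 0 j2 = t.
Proof. by rewrite -heightE height_pt. Qed.

Lemma pt_eta (x : E) : pt (plane x) (height x) = x.
Proof.
apply/rowP; apply: ord3P; rewrite ?pt0 ?pt1 ?pt2 ?heightE// !mxE.
- by congr (x _ _); exact: val_inj.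
- by congr (x _ _); exact: val_inj.
Qed.

Lemma pt_lincomb (k : R) u v s t :
  k *: (pt u s : E) + pt v t = pt (k *: u + v) (k * s + t).
Proof.
apply/rowP; apply: ord3P; rewrite mxE [X in X + _]mxE.
- by rewrite !pt0 !mxE.
- by rewrite !pt1 !mxE.
- by rewrite !pt2.
Qed.

Lemma ptD u v s t : (pt u s : E) + pt v t = pt (u + v) (s + t).
Proof. by have := pt_lincomb 1 u v s t; rewrite !scale1r mul1r. Qed.

Lemma pt00 : pt 0 0 = 0 :> E.
Proof. by apply/rowP; apply: ord3P; rewrite [RHS]mxE ?pt0 ?pt1 ?pt2 ?mxE. Qed.

Lemma ptZ k u s : k *: (pt u s : E) = pt (k *: u) (k * s).
Proof.
have := pt_lincomb k u 0 s 0; rewrite !addr0 => <-.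
by rewrite pt00 addr0.
Qed.

Lemma heightD (x y : E) : height (x + y) = height x + height y.
Proof. by rewrite !heightE mxE. Qed.

Lemma heightZ k (x : E) : height (k *: x) = k * height x.
Proof. by rewrite !heightE mxE. Qed.

Definition e0 : E := pt (delta_mx 0 0) 0.
Definition e1 : E := pt (delta_mx 1 0) 0.
Definition e2 : E := pt 0 1.

Lemma e0E : e0 = 'e_j0.
Proof. by apply/rowP; apply: ord3P; rewrite [RHS]mxE ?pt0 ?pt1 ?pt2 ?mxE. Qed.

Lemma e1E : e1 = 'e_j1.
Proof. by apply/rowP; apply: ord3P; rewrite [RHS]mxE ?pt0 ?pt1 ?pt2 ?mxE. Qed.

Lemma e2E : e2 = 'e_j2.
Proof. by apply/rowP; apply: ord3P; rewrite [RHS]mxE ?pt0 ?pt1 ?pt2 ?mxE. Qed.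

Lemma lincomb3 a b c (x y z : E) i :
  (a *: x + b *: y + c *: z) 0 i = a * x 0 i + b * y 0 i + c * z 0 i.
Proof. by rewrite !mxE. Qed.

Lemma rV3E (x : E) : x = x 0 j0 *: e0 + x 0 j1 *: e1 + x 0 j2 *: e2.
Proof.
apply/rowP; apply: ord3P; rewrite lincomb3 /e0 /e1 /e2 ?pt0 ?pt1 ?pt2 ?mxE /=;
  by rewrite ?mulr1 ?mulr0 ?addr0 ?add0r.
Qed.

Lemma periodicZ (F : E -> R^o) (e : E) : (forall x, F (x + e) = F x) ->
  forall (k : int) x, F (x + k%:~R *: e) = F x.
Proof.
move=> Fe; have Fn n x : F (x + n%:R *: e) = F x.
  elim: n x => [|n IH] x; first by rewrite scale0r addr0.
  by rewrite -natr1 scalerDl scale1r addrA Fe IH.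
case=> n x; first exact: Fn.
by rewrite NegzE mulrNz scaleNr -[in RHS](subrK (n.+1%:R *: e) x) Fn.
Qed.

Lemma floor_frac (r : R) : 0 <= r - (Num.floor r)%:~R <= 1.
Proof.
by rewrite subr_ge0 floor_le_tmp lerBlDr addrC -[1]/(1%:~R) -intrD ltW// floorD1_gt.
Qed.

(** A fundamental square of the fibre is compact. *)
Lemma periodic_bounded (F : E -> R^o) : continuous F ->
  (forall x, F (x + e0) = F x) -> (forall x, F (x + e1) = F x) ->
  forall t, exists C, forall x, height x = t -> `|F x| <= C.
Proof.
move=> cF F0 F1 t.
pose A (i : 'I_3) : set R := if i == j2 then `[t, t]%classic else `[0, 1]%classic.
have cA : compact [set v : E | forall i, A i (v 0 i)].
  by apply: rV_compact => i; rewrite /A; case: ifP => _; exact: segment_compact.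
have cn : continuous (fun x : E => `|F x| : R^o).
  by move=> x; apply: (@continuous_comp _ _ _ F Num.norm); [exact: cF|exact: norm_continuous].
have A0 : [set v : E | forall i, A i (v 0 i)] !=set0.
  exists (pt 0 t) => /=; apply: ord3P; rewrite /A /= in_itv/=.
  - by rewrite pt0 mxE lexx ler01.
  - by rewrite pt1 mxE lexx ler01.
  - by rewrite pt2 lexx.
have [c _ Hc] := @EVT_max_rV R 3 (fun x : E => `|F x|) _ A0 cA (continuous_subspaceT cn).
exists `|F c| => x xt.
pose y := x + (- Num.floor (x 0 j0))%:~R *: e0 + (- Num.floor (x 0 j1))%:~R *: e1.
have -> : F x = F y by rewrite /y (periodicZ F1) (periodicZ F0).
apply: Hc; rewrite inE/=.
have yE i : y 0 i = x 0 i - (Num.floor (x 0 j0))%:~R * e0 0 i - (Num.floor (x 0 j1))%:~R * e1 0 i.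
  by rewrite /y -{1}[x]scale1r lincomb3 !mulrNz mul1r !mulNr.
apply: ord3P; rewrite /A /= in_itv/= yE /e0 /e1 ?pt0 ?pt1 ?pt2 ?mxE/=.
- by rewrite mulr1 mulr0 subr0 floor_frac.
- by rewrite mulr1 mulr0 subr0 floor_frac.
- by rewrite !mulr0 !subr0 -heightE xt lexx.
Qed.

End Coordinates.

(** * Forms on the hyperbolic torus *)

Section Torus.
Variables (R : realType) (P : 'M[R]_2) (lam a : R).
Local Notation E := 'rV[R]_3.
Local Notation smooth := (@smooth R 2).
Hypotheses (P_unit : P \in unitmx) (lam_gt0 : 0 < lam) (lam_neq1 : lam != 1).
Hypothesis eigV : forall t,
  mxflow P lam t *m slope_vec a = lam `^ t *: slope_vec a.

(** The field is mu V, where V is a constant vector along which mu is constant: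
    its flow consists of the shears x + s mu(x) V. *)
Definition mu (x : E) : R^o := lam `^ height x.
Definition V : E := pt (slope_vec a) 0.
(** Linear part of the left translation by an element of height t, acting on the
    right of row vectors. *)
Definition L (t : R) : 'M[R]_3 := block_mx (mxflow P lam t)^T 0 0 1%:M.
Local Notation phi := (shear_flow mu V).
Local Notation Om := (torus_forms P lam).
Local Notation l := (ln lam).

Lemma ln_neq0 : l != 0.
Proof. by rewrite ln_eq0// lam_neq1. Qed.

Lemma muE x : mu x = expR (x 0 j2 * l).
Proof. by rewrite /mu heightE /powR gt_eqF. Qed.

Lemma mu_gt0 x : 0 < mu x.
Proof. by rewrite muE expR_gt0. Qed.

Lemma mu_neq0 x : mu x != 0.
Proof. by rewrite gt_eqF// mu_gt0. Qed.

Lemma derive_mu x v : differentiable mu x /\ 'D_v mu x = v 0 j2 * l * mu x.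
Proof.
have -> : mu = (fun y : E => expR (l * y 0 j2)).
  by apply/funext => y; rewrite muE mulrC.
have sf : smooth (fun y : E => l * y 0 j2) by apply: smoothZ; exact: smooth_coord.
have [d ->] := derive_comp1 v (is_derive_expR (l * x 0 j2)) (smooth_diff x sf).
split=> //; rewrite (deriveZ l (smooth_derivable (@smooth_coord R 2 j2))).
by rewrite derive_coord /GRing.scale/=; ring.
Qed.

Lemma smooth_mu : smooth mu.
Proof.
elim=> [//|k IH]; apply/duSP; split=> [x|v]; first by case: (derive_mu x 0).
have -> : (fun x => 'D_v mu x) = (fun x => v 0 j2 * l * mu x).
  by apply/funext => x; case: (derive_mu x v).
by apply: du_M => //; exact: du_cst.
Qed.

Lemma heightV : height V = 0. Proof. exact: height_pt. Qed.

Lemma muV x (r : R) : mu (x + r *: V) = mu x.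
Proof. by rewrite /mu heightD heightZ heightV mulr0 addr0. Qed.

Lemma mu_hessian u v x : 'D_u (fun y => 'D_v mu y) x = 'D_v (fun y => 'D_u mu y) x.
Proof.
have e w : (fun y => 'D_w mu y) = (fun y => w 0 j2 * l * mu y).
  by apply/funext => y; case: (derive_mu y w).
have h p q : 'D_p (fun y => 'D_q mu y) x = q 0 j2 * l * (p 0 j2 * l * mu x).
  rewrite (e q) (deriveZ (q 0 j2 * l) (smooth_derivable smooth_mu)).
  by have [_ ->] := derive_mu x p.
apply: etrans (h u v) (etrans _ (esym (h v u))); ring.
Qed.

Lemma height_phi s x : height (phi s x) = height x.
Proof. by rewrite /shear_flow heightD heightZ heightV mulr0 addr0. Qed.

(** The height is constant along integral curves, so the field is constant along
    them as well. *)
Lemma flow_unique psi : is_flow (torus_field lam a) psi ->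
  psi = fun s x => phi s x.
Proof.
move=> [psi0 dpsi]; apply/funext => s; apply/funext => x.
have dc i (r : R) : is_derive r 1 (fun r => psi r x 0 i : R^o) (mu (psi r x) * V 0 i).
  have [d1 d2] := dpsi x r; have dm := d1.
  have /derivable_mxP/(_ 0 i) dc := dm.
  split=> //; have := derive_mx d1; rewrite d2 => /matrixP/(_ 0 i).
  by rewrite [RHS]mxE [LHS]mxE => <-.
have psiE i c : (forall r, mu (psi r x) * V 0 i = c) ->
    forall r, psi r x 0 i = x 0 i + r * c.
  move=> hc r; pose g (r : R) : R^o := psi r x 0 i - r * c.
  have dg (q : R) : is_derive q 1 g 0.
    have [da db] := dc i q.
    have [dc1 dc2] : is_derive q 1 (fun q : R => q * c : R^o) c.
      have := is_diff_scalel q c => /=.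
      split; first by apply: derivableM; [exact: derivable_id|exact: derivable_cst].
      rewrite deriveM; [|exact: derivable_id|exact: derivable_cst].
      by rewrite derive_cst derive_id scaler0 add0r /GRing.scale/= mulr1.
    split; first exact: derivableB.
    by rewrite (deriveB da dc1) db dc2 hc subrr.
  have := is_derive_0_is_cst r 0 dg; rewrite /g psi0 mul0r subr0 => <-.
  by rewrite subrK.
have hE r : height (psi r x) = height x.
  rewrite !heightE (psiE j2 0) ?mulr0 ?addr0// => q.
  by rewrite -heightE heightV mulr0.
apply/rowP => i; rewrite (psiE i (mu x * V 0 i)); last by move=> r; rewrite /mu hE.
by rewrite /shear_flow !mxE mulrA.
Qed.

Lemma pt_mulL u t s : (pt u t : E) *m L s = pt (mxflow P lam s *m u) t.
Proof.
have := @mul_row_block R 1 2 1 2 1 u^T t%:M (mxflow P lam s)^T 0 0 1%:M.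
by rewrite !mulmx0 addr0 add0r mulmx1 -trmx_mul.
Qed.

Lemma G3_mulE g x : G3_mul P lam g x = g + x *m L (height g).
Proof.
have := pt_mulL (plane x) (height x) (height g); rewrite pt_eta => ->.
by rewrite -{2}(pt_eta g) ptD.
Qed.

Lemma diag2M (x y z t : R) : diag2 x y *m diag2 z t = diag2 (x * z) (y * t).
Proof.
apply/matrixP => i j; rewrite /diag2 mul_diag_mx !mxE.
case: i => [[|[|//]] hi]; case: j => [[|[|//]] hj];
  by rewrite -?val_eqE /= ?mulr1n ?mulr0n ?mulr0.
Qed.

Lemma mxflowD s t : mxflow P lam (s + t) = mxflow P lam s *m mxflow P lam t.
Proof.
rewrite /mxflow !mulmxA -[P *m _ *m _ *m P]mulmxA mulVmx// mulmx1.
rewrite -[P *m _ *m diag2 _ _]mulmxA diag2M.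
have e r q : lam `^ r * lam `^ q = lam `^ (r + q).
  by rewrite powRD// (gt_eqF lam_gt0) implybT.
by rewrite !e opprD.
Qed.

Lemma mxflow0 : mxflow P lam 0 = 1%:M.
Proof.
rewrite /mxflow oppr0 powRr0.
have -> : diag2 1 1 = 1%:M :> 'M[R]_2.
  apply/matrixP => i j; rewrite !mxE.
  by case: i => [[|[|//]] hi]; case: j => [[|[|//]] hj].
by rewrite mulmx1 mulmxV.
Qed.

Lemma det_mxflow t : \det (mxflow P lam t) = 1.
Proof.
rewrite /mxflow !det_mulmx mulrAC -det_mulmx mulmxV// det1 mul1r.
rewrite /diag2 det_diag big_ord_recl big_ord1 !mxE /= powRN divff//.
by rewrite gt_eqF// powR_gt0.
Qed.

Lemma det_L t : \det (L t) = 1.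
Proof.
have := @det_ublock R 2 1 (mxflow P lam t)^T 0 1%:M.
by rewrite det_tr det_mxflow det1 mulr1.
Qed.

Lemma LD s t : L (s + t) = L s *m L t.
Proof.
have := @mulmx_block R 2 1 2 1 2 1 (mxflow P lam s)^T 0 0 1%:M
  (mxflow P lam t)^T 0 0 1%:M.
rewrite !mulmx0 !mul0mx !addr0 !add0r mulmx1 -trmx_mul -mxflowD addrC.
exact: esym.
Qed.

Lemma L0 : L 0 = 1%:M.
Proof. by rewrite /L mxflow0 trmx1; have := @scalar_mx_block R 2 1 1 => /esym. Qed.

Lemma V_mulL t : V *m L t = lam `^ t *: V.
Proof. by rewrite /V pt_mulL eigV ptZ mulr0. Qed.

Lemma height_mulL x t : height (x *m L t) = height x.
Proof. by rewrite -(pt_eta x) pt_mulL !height_pt. Qed.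

(** Left translation by the element (m, k) of the lattice. *)
Definition gam (m : 'cV[int]_2) (k : int) (x : E) : E :=
  pt (map_mx intr m) k%:~R + x *m L k%:~R.

Lemma height_gam m k x : height (gam m k x) = k%:~R + height x.
Proof. by rewrite /gam heightD height_pt height_mulL. Qed.

Lemma mu_gam m k x : mu (gam m k x) = lam `^ k%:~R * mu x.
Proof. by rewrite /mu height_gam powRD// (gt_eqF lam_gt0) implybT. Qed.

Lemma gam_phi m k s x : gam m k (phi s x) = phi s (gam m k x).
Proof.
rewrite {2}/shear_flow mu_gam {1}/gam {1}/shear_flow mulmxDl addrA; congr (_ + _).
by rewrite -scalemxAl V_mulL scalerA; congr (_ *: _); ring.
Qed.

Lemma gam_diff m k x : differentiable (gam m k) x.
Proof. by case: (derive_affine_map (L k%:~R) (pt (map_mx intr m) k%:~R) x 0). Qed.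

Lemma OmP p (w : pform R 2 p) : Om w <->
  smooth_form w /\ forall m k, pullback (gam m k) w = w.
Proof.
split=> -[sw Hw]; split=> //.
  move=> m k; have <- : G3_mul P lam (pt (map_mx intr m) k%:~R) = gam m k.
    by apply/funext => x; rewrite G3_mulE height_pt.
  by apply: Hw; exists m, k.
move=> g [m [k ->]].
have -> : G3_mul P lam (pt (map_mx intr m) k%:~R) = gam m k.
  by apply/funext => x; rewrite G3_mulE height_pt.
exact: Hw.
Qed.

Lemma pullback_gam p (w : pform R 2 p) m k x v :
  pullback (gam m k) w x v = w (gam m k x) (v *m L k%:~R).
Proof. exact: pullback_affine. Qed.

Lemma Om_inv p (w : pform R 2 p) m k x v : Om w ->
  w (gam m k x) (v *m L k%:~R) = w x v.
Proof. by move=> /OmP[_ /(_ m k) e]; rewrite -pullback_gam e. Qed.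

Lemma Om_smooth p (w : pform R 2 p) : Om w -> smooth_form w.
Proof. by case. Qed.

Lemma Om0 p : Om (0 : pform R 2 p).
Proof. by split=> //; exact: smooth_form0. Qed.

Lemma Om_lincomb p (k : R) (w z : pform R 2 p) : Om w -> Om z -> Om (k *: w + z).
Proof.
move=> [sw Hw] [sz Hz]; split; first exact: smooth_form_lincomb.
by move=> g Hg; rewrite pullbackD pullbackZ Hw// Hz.
Qed.

Lemma Om_sub p (w z : pform R 2 p) : Om w -> Om z -> Om (w - z).
Proof. by move=> Ow Oz; rewrite addrC -scaleN1r; exact: Om_lincomb. Qed.

Lemma Om_pullback_flow p s (w : pform R 2 p) : Om w -> Om (pullback (phi s) w).
Proof.
move=> /OmP[sw Hw]; apply/OmP; split.
  by apply: smooth_form_pullback_flow => //; exact: smooth_mu.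
move=> m k.
have e := pullback_flowC smooth_mu (gam_diff m k) (gam_phi m k) w s.
by rewrite Hw in e.
Qed.

Lemma Om_ext_deriv p (w : pform R 2 p) : Om w -> Om (ext_deriv w).
Proof.
move=> /OmP[sw Hw]; apply/OmP; split; first exact: smooth_form_ext_deriv.
by move=> m k; rewrite -[in RHS](Hw m k) ext_deriv_pullback_affine.
Qed.

Lemma Om_lie p (w : pform R 2 p) : Om w -> Om (lie_deriv phi w).
Proof.
move=> /OmP[sw Hw]; apply/OmP; split.
  by apply: smooth_form_lie => //; exact: smooth_mu.
move=> m k.
have e := pullback_lie smooth_mu (gam_diff m k) (gam_phi m k) w.
by rewrite Hw in e.
Qed.

End Torus.

(** * Subquotients of vector spaces *)

Section Subquotients.
Variable K : fieldType.

Definition linear_set (V : lmodType K) (S : set V) :=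
  S 0 /\ forall k x y, S x -> S y -> S (k *: x + y).

Lemma lspan_min (V : lmodType K) (S T : set V) : linear_set T -> S `<=` T ->
  forall x, x \in lspan S -> T x.
Proof.
move=> [T0 TD] ST x /asboolP[n [c [e [Se ->]]]].
elim: n c e Se => [|n IH] c e Se; first by rewrite big_ord0.
by rewrite big_ord_recl; apply: TD; [exact/ST|apply: IH => i; exact: Se].
Qed.

Lemma lspanP (V : lmodType K) (S : set V) x : linear_set S ->
  reflect (S x) (x \in lspan S).
Proof. by move=> [S0 SD]; rewrite (lspan_id S0 SD); exact: asboolP. Qed.

Local Open Scope quotient_scope.

Section OneSubquotient.
Variables (V : lmodType K) (Z B : set V).
Hypotheses (lZ : linear_set Z) (lB : linear_set B).
Local Notation Q := (Quotient.quot (@relators K V Z B)).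

Definition subcls (z : V) (Zz : Z z) : subquot Z B :=
  \pi_Q (Sub z (introT (lspanP z lZ) Zz) : subspace Z).

Lemma pi_subquotP (x y : subspace Z) :
  \pi_Q x = \pi_Q y <-> B (val x - val y).
Proof.
split=> [/eqP|xy]; last first.
  apply/eqP; rewrite -Quotient.idealrBE; apply/lspanP => //.
by rewrite -Quotient.idealrBE => /(lspanP _ lB); rewrite raddfB.
Qed.

Lemma subquotZ (k : K) (x : subspace Z) :
  k *: (\pi_Q x : subquot Z B) = \pi_Q (k *: x).
Proof.
rewrite -[LHS]/(\pi_Q (k *: repr (\pi_Q x))); apply/eqP.
rewrite -Quotient.idealrBE -scalerBr rpredZ//.
by rewrite Quotient.idealrBE reprK.
Qed.

Lemma subclsP (q : subquot Z B) : exists z (Zz : Z z), q = subcls Zz.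
Proof.
exists (val (repr (q : Q))), (elimT (lspanP _ lZ) (valP (repr (q : Q)))).
by rewrite /subcls -[LHS]reprK; congr (\pi_Q _); exact: val_inj.
Qed.

Lemma subcls_eq z y (Zz : Z z) (Zy : Z y) : subcls Zz = subcls Zy <-> B (z - y).
Proof. exact: pi_subquotP. Qed.

Lemma subcls_lincomb k z y (Zz : Z z) (Zy : Z y) (Zzy : Z (k *: z + y)) :
  subcls Zzy = k *: subcls Zz + subcls Zy.
Proof.
rewrite /subcls subquotZ -[RHS]/((\pi_Q _ : Q) + (\pi_Q _ : Q)) -raddfD.
by congr (\pi_Q _); exact: val_inj.
Qed.

Lemma subcls0 (Z0 : Z 0) : subcls Z0 = 0.
Proof.
rewrite /subcls -[RHS](raddf0 (\pi_Q : subspace Z -> Q)).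
by congr (\pi_Q _); exact: val_inj.
Qed.

Lemma subquot_eq0 : Z `<=` B -> forall x : subquot Z B, x = 0.
Proof.
move=> ZB q; have [z [Zz ->]] := subclsP q.
by rewrite -(subcls0 lZ.1); apply/subcls_eq; rewrite subr0; exact: ZB.
Qed.

Lemma linear_set_sum n (b : 'I_n -> K) (c : 'I_n -> V) :
  (forall i, Z (c i)) -> Z (\sum_i b i *: c i).
Proof.
have [Z0 ZD] := lZ; move=> Zc; elim/big_ind : _ => [//|x y Zx Zy|j _].
  by rewrite -[x]scale1r; exact: ZD.
by rewrite -[_ *: _]addr0; exact: ZD.
Qed.

Lemma subcls_sum n (b : 'I_n -> K) (c : 'I_n -> V) (Zc : forall i, Z (c i)) z
    (Zz : Z z) : z = \sum_i b i *: c i ->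
  subcls Zz = \sum_i b i *: subcls (Zc i).
Proof.
elim: n b c Zc z Zz => [|n IH] b c Zc z Zz zE.
  rewrite big_ord0 -(subcls0 lZ.1); apply/subcls_eq.
  by rewrite zE big_ord0 subrr; case: lB.
pose c' i := c (lift ord0 i); pose b' i := b (lift ord0 i).
pose Zc' i : Z (c' i) := Zc (lift ord0 i).
rewrite big_ord_recl -[X in _ + X]/(\sum_i b' i *: subcls (Zc' i)) -(IH b' c' Zc' _ (linear_set_sum b' Zc') erefl).
have Zs : Z (b ord0 *: c ord0 + \sum_i b' i *: c' i).
  by apply: lZ.2 => //; exact: linear_set_sum.
rewrite -(subcls_lincomb _ _ Zs); apply/subcls_eq.
by rewrite zE big_ord_recl subrr; case: lB.
Qed.

(** Independence modulo B of an infinite sequence in Z. *)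
Lemma subquot_infinite (c : nat -> V) : (forall j, Z (c j)) ->
  (forall n (b : 'I_n -> K), B (\sum_(j < n) b j *: c j) -> forall j, b j = 0) ->
  infinite_dimensional (subquot Z B).
Proof.
move=> Zc indep [n [e espan]].
have /choice[M ME] : forall j : 'I_n.+1, exists m : 'I_n -> K,
    subcls (Zc j) = \sum_(i < n) m i *: e i by move=> j; exact: espan.
pose A : 'M[K]_(n.+1, n) := \matrix_(j, i) M j i.
have : kermx A != 0.
  rewrite -mxrank_eq0 mxrank_ker subn_eq0 -ltnNge ltnS; exact: rank_leq_col.
move=> /rowV0Pn[b /sub_kermxP bA b0].
have Zs : Z (\sum_(j < n.+1) b 0 j *: c j) by apply: linear_set_sum.
have s0 : subcls Zs = 0.
  rewrite (subcls_sum (fun j : 'I_n.+1 => Zc j) Zs erefl).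
  under eq_bigr do rewrite ME scaler_sumr.
  rewrite exchange_big/=; apply: big1 => i _.
  under eq_bigr do rewrite scalerA.
  rewrite -scaler_suml; have /rowP/(_ i) := bA; rewrite !mxE.
  under eq_bigr do rewrite mxE.
  by move=> ->; rewrite scale0r.
have bz := indep _ (fun j => b 0 j) _; case/eqP: b0.
apply/rowP => j; rewrite mxE; apply: bz.
by move: s0; rewrite -(subcls0 lZ.1) => /subcls_eq; rewrite subr0.
Qed.

End OneSubquotient.

Lemma subquot_isomorphic (V W : lmodType K) (Z B : set V) (Z' B' : set W)
    (j : V -> W) :
  linear_set Z -> linear_set B -> linear_set Z' -> linear_set B' ->
  (forall k x y, Z x -> Z y -> j (k *: x + y) = k *: j x + j y) ->
  (forall x, Z x -> Z' (j x)) ->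
  (forall y, Z' y -> exists2 x, Z x & j x = y) ->
  (forall x, Z x -> (B x <-> B' (j x))) ->
  lmod_isomorphic (subquot Z B) (subquot Z' B').
Proof.
move=> lZ lB lZ' lB' jlin jZ jsurj jB.
have /choice[F FE] : forall q : subquot Z B, exists r : subquot Z' B',
    forall z (Zz : Z z), q = subcls B lZ Zz -> r = subcls B' lZ' (jZ z Zz).
  move=> q; have [z [Zz qE]] := subclsP lZ q.
  exists (subcls B' lZ' (jZ z Zz)) => y Zy.
  rewrite qE => /(subcls_eq lZ lB) zy; apply/(subcls_eq lZ' lB').
  have Zzy : Z (z - y) by rewrite addrC -scaleN1r; exact: lZ.2.
  have -> : j z - j y = j (z - y).
    by rewrite [z - y]addrC [j z - _]addrC -!scaleN1r jlin.
  by apply/(jB _ Zzy).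
have Flin : linear F.
  move=> k x y; have [z [Zz xE]] := subclsP lZ x; have [u [Zu yE]] := subclsP lZ y.
  have Zzu : Z (k *: z + u) by exact: lZ.2.
  rewrite (FE x z Zz xE) (FE y u Zu yE) (FE _ _ Zzu); last first.
    by rewrite xE yE subcls_lincomb.
  have Zj : Z' (k *: j z + j u) by apply: lZ'.2; [exact: (jZ z Zz)|exact: (jZ u Zu)].
  rewrite -(subcls_lincomb B' lZ' (jZ z Zz) (jZ u Zu) Zj).
  by apply/(subcls_eq lZ' lB'); rewrite jlin// subrr; case: lB'.
have Finj : injective F.
  move=> x y; have [z [Zz xE]] := subclsP lZ x; have [u [Zu yE]] := subclsP lZ y.
  rewrite (FE x z Zz xE) (FE y u Zu yE) => /(subcls_eq lZ' lB') jzu.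
  rewrite xE yE; apply/(subcls_eq lZ lB).
  have Zzu : Z (z - u) by rewrite addrC -scaleN1r; exact: lZ.2.
  apply/(jB _ Zzu); suff -> : j (z - u) = j z - j u by [].
  by rewrite [z - u]addrC [j z - _]addrC -!scaleN1r jlin.
have Fsurj r : exists q, F q = r.
  have [y [Zy ->]] := subclsP lZ' r; have [z Zz jz] := jsurj y Zy.
  exists (subcls B lZ Zz); rewrite (FE _ z Zz)//.
  by apply/(subcls_eq lZ' lB'); rewrite jz subrr; case: lB'.
pose HF := GRing.isLinear.Build _ _ _ _ F Flin.
pose FL : {linear subquot Z B -> subquot Z' B'} := HB.pack F HF.
exists FL; have /choice[G GK] := Fsurj.
by exists G => x; [apply: Finj; rewrite [LHS]GK|exact: GK].
Qed.

End Subquotients.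

(** * Invariant and co-invariant forms *)

Section Complexes.
Variables (R : realType) (n : nat).

Lemma ext_deriv0 p : ext_deriv (0 : pform R n p) = 0.
Proof.
have := ext_deriv_lincomb 1 (smooth_form0 R n p) (smooth_form0 R n p).
rewrite scaler0 addr0 scale1r => /eqP.
by rewrite -subr_eq0 opprD addrA subrr sub0r oppr_eq0 => /eqP.
Qed.

Variable C : graded R n.
Hypotheses (lC : forall p, linear_set (@C p))
  (sC : forall p (w : pform R n p), C w -> smooth_form w).

Lemma linear_cocycles p : linear_set (@cocycles R n C p).
Proof.
split; first by split; [exact: (lC p).1|exact: ext_deriv0].
move=> k x y [Cx dx] [Cy dy]; split; first exact: (lC p).2.
by rewrite ext_deriv_lincomb ?dx ?dy ?scaler0 ?addr0//; exact: sC.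
Qed.

Lemma linear_coboundaries p : linear_set (@coboundaries R n C p).
Proof.
case: p => [|p]; first by split=> // k x y -> ->; rewrite scaler0 addr0.
split; first by exists 0; [exact: (lC p).1|exact: ext_deriv0].
move=> k _ _ [x Cx <-] [y Cy <-]; exists (k *: x + y); first exact: (lC p).2.
by rewrite ext_deriv_lincomb//; exact: sC.
Qed.

End Complexes.

Section TorusFlow.
Variables (R : realType) (P : 'M[R]_2) (lam a : R).
Local Notation E := 'rV[R]_3.
Local Notation smooth := (@smooth R 2).
Hypotheses (P_unit : P \in unitmx) (lam_gt0 : 0 < lam) (lam_neq1 : lam != 1).
Hypothesis eigV : forall t,
  mxflow P lam t *m slope_vec a = lam `^ t *: slope_vec a.
Local Notation mu := (mu lam).
Local Notation V := (V a).
Local Notation L := (L P lam).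
Local Notation phi := (shear_flow mu V).
Local Notation Om := (torus_forms P lam).
Local Notation l := (ln lam).

Lemma gam0 m x : gam P lam m 0 x = pt (map_mx intr m) 0 + x.
Proof. by rewrite /gam mulr0z (L0 lam P_unit) mulmx1. Qed.

Lemma Om_translate p (w : pform R 2 p) m x v : Om w ->
  w (x + pt (map_mx intr m) 0) v = w x v.
Proof.
move=> Ow; rewrite addrC -gam0 -[in RHS](Om_inv m 0 x v Ow).
by rewrite mulr0z (L0 lam P_unit) mulmx1.
Qed.

Lemma delta_intr i : map_mx intr (delta_mx i 0 : 'cV[int]_2) = delta_mx i 0 :> 'cV[R]_2.
Proof. by rewrite map_delta_mx. Qed.

Lemma Om_periodic0 p (w : pform R 2 p) v x : Om w -> w (x + e0 R) v = w x v.
Proof. by move=> Ow; rewrite /e0 -delta_intr Om_translate. Qed.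

Lemma Om_periodic1 p (w : pform R 2 p) v x : Om w -> w (x + e1 R) v = w x v.
Proof. by move=> Ow; rewrite /e1 -delta_intr Om_translate. Qed.

Lemma derive_translate (f : E -> R^o) (e x v : E) : (forall y, f (y + e) = f y) ->
  smooth f -> 'D_v f (x + e) = 'D_v f x.
Proof.
move=> fe sf.
have := derive_affine (f := f) (b := e) (M := 1%:M) v (x := x).
rewrite !mulmx1 [e + x]addrC => <-; last exact: smooth_diff.
congr ('D_v _ x); apply/funext => y.
by rewrite mulmx1 addrC fe.
Qed.

Lemma natmul_bounded (A C : R) : (forall n : nat, `|n%:R * A| <= C) -> A = 0.
Proof.
move=> H; apply/eqP; apply: contraT => A0.
have nA : 0 < `|A| by rewrite normr_gt0.
have := H (Num.bound (C / `|A|)); rewrite normrM normr_nat.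
have C0 : 0 <= C by have := H 0%N; rewrite mul0r normr0.
rewrite -ler_pdivlMr// => /(lt_le_trans (archi_boundP _))-/(_ _).
rewrite ltxx => F; have := F _; apply; exact: divr_ge0.
Qed.

(** The form dt /\ i_V w, where t is the height. *)
Definition contraction p (w : pform R 2 p) (x : E) (v : 'M[R]_(p, 3)) : R :=
  \sum_i v i j2 * w x (setrow i V v).

(** Pulling back by a shear adds to w a multiple of dt /\ i_V w, linear in s. *)
Lemma pullback_phiE p (w : pform R 2 p) s x v : smooth_form w ->
  pullback (phi s) w x v =
  w (phi s x) v + s * (l * mu x) * contraction w (phi s x) v.
Proof.
move=> sw; rewrite (pullback_shear_flow V (smooth_mu lam_gt0) s x v sw).
rewrite {1}/flow_integrand expr0 mul1r; congr (_ + _).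
rewrite /contraction mulr_sumr; apply: eq_bigr => i _.
have [_ ->] := derive_mu lam_gt0 x (row i v).
by rewrite /flow_integrand expr1 !mxE /shear_flow; ring.
Qed.

Section InvariantForms.
Variables (p : nat) (w : pform R 2 p).
Hypotheses (Ow : Om w) (winv : pullback (phi 1) w = w).

Let sw : smooth_form w := Om_smooth Ow.

Let ws v : smooth (fun y => w y v).
Proof. by case: sw. Qed.

Let g := contraction w.

Let bounded (f : E -> R^o) : smooth f ->
  (forall x, f (x + e0 R) = f x) -> (forall x, f (x + e1 R) = f x) ->
  forall t, exists C, forall x, height x = t -> `|f x| <= C.
Proof. by move=> sf; apply: periodic_bounded; exact: smooth_continuous. Qed.

Let pullback_phi s x v := pullback_phiE s x v sw.

Let winvn (n : nat) : pullback (phi n%:R) w = w.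
Proof.
elim: n => [|n IH]; first exact: pullback_shear_flow0.
by rewrite -natr1 addrC -(pullback_shear_flowD (smooth_mu lam_gt0) (@muV R lam a)) winv.
Qed.

Let phiK s x : phi s (phi (- s) x) = x.
Proof.
by rewrite (shear_flowD (@muV R lam a)) addrN shear_flow0.
Qed.

Let mu_phi s x : mu (phi s x) = mu x.
Proof. by rewrite /mu height_phi. Qed.

(** By pullback_phiE, invariance under the time-n map expresses n times
    dt /\ i_V w at x as a difference of values of w at two points of the same
    height. The coefficients of w are bounded on each fibre of the height, so the
    multiplied quantity vanishes. *)
Lemma contraction0 x v : contraction w x v = 0.
Proof.
have [C HC] := bounded (ws v) (fun x => Om_periodic0 v x Ow)
  (fun x => Om_periodic1 v x Ow) (height x).
suff : l * mu x * g x v = 0.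
  move/eqP; rewrite mulf_eq0 => /orP[|/eqP//].
  by rewrite mulf_eq0 (negPf (ln_neq0 lam_gt0 lam_neq1)) (negPf (mu_neq0 lam_gt0 x)).
apply: (@natmul_bounded _ (C + C)) => n.
have := congr1 (fun w' : pform R 2 p => w' (phi (- n%:R) x) v) (winvn n).
rewrite pullback_phi phiK mu_phi => e.
have -> : n%:R * (l * mu x * g x v) = w (phi (- n%:R) x) v - w x v.
  by rewrite -e /g; ring.
apply: (le_trans (ler_normB _ _)); apply: lerD; apply: HC => //.
exact: height_phi.
Qed.

Lemma inv_time1 (n : nat) x v : w (phi n%:R x) v = w x v.
Proof.
have := congr1 (fun w' : pform R 2 p => w' x v) (winvn n).
by rewrite pullback_phi /g contraction0 mulr0 addr0.
Qed.

(** Differentiating the invariance under the time-n map in the direction of the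
    height gives n times the derivative along V, against a bounded quantity. *)
Lemma derive_flow0 x v : 'D_V (fun y => w y v) x = 0.
Proof.
set f := fun y => w y v; have sf : smooth f := ws v.
have f0 y : f (y + e0 R) = f y by exact: Om_periodic0.
have f1 y : f (y + e1 R) = f y by exact: Om_periodic1.
pose dt y := 'D_(e2 R) f y.
have [C HC] := bounded (smooth_derive (e2 R) sf)
  (fun x => derive_translate x (e2 R) f0 sf)
  (fun x => derive_translate x (e2 R) f1 sf) (height x).
suff : l * mu x * 'D_V f x = 0.
  move/eqP; rewrite mulf_eq0 => /orP[|/eqP//].
  by rewrite mulf_eq0 (negPf (ln_neq0 lam_gt0 lam_neq1)) (negPf (mu_neq0 lam_gt0 x)).
apply: (@natmul_bounded _ (C + C)) => n.
pose y := phi (- n%:R) x.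
have xE : x = y + (n%:R * mu y) *: V by rewrite -[LHS](phiK n%:R).
have sc : smooth (fun z => n%:R * mu z) by apply: smoothZ; exact: (smooth_mu lam_gt0).
have e := @derive_shear R 2 f (fun z => n%:R * mu z) V y (e2 R) (smooth_diff y sc)
  (smooth_diff (y + (n%:R * mu y) *: V) sf).
have finv : (fun z => f (z + (n%:R * mu z) *: V)) = f.
  by apply/funext => z; exact: inv_time1.
have dc : 'D_(e2 R) (fun z => n%:R * mu z) y = n%:R * (l * mu y).
  rewrite (deriveZ n%:R (smooth_derivable (smooth_mu lam_gt0))).
  have [_ ->] := derive_mu lam_gt0 y (e2 R).
  by rewrite /e2 pt2 mul1r.
have e' := etrans (esym (congr1 (fun h : E -> R^o => 'D_(e2 R) h y) finv)) e.
rewrite -xE dc in e'.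
have -> : n%:R * (l * mu x * 'D_V f x) = 'D_(e2 R) f y - 'D_(e2 R) f x.
  by rewrite e' /y mu_phi; ring.
apply: (le_trans (ler_normB _ _)); apply: lerD; apply: HC => //.
exact: height_phi.
Qed.

(** The coefficients of w are constant along V, and dt /\ i_V w vanishes. *)
Lemma invariant_flow s : pullback (phi s) w = w.
Proof.
apply/funext => x; apply/funext => v.
rewrite pullback_phi /g contraction0 mulr0 addr0 /shear_flow.
exact: (derive_line0 (f := fun y => w y v) (ws v) (fun y => derive_flow0 y v)).
Qed.

End InvariantForms.

(** With V substituted for the only row of v that is not horizontal, the other
    terms of the sum vanish. *)
Lemma contraction_row p (w : pform R 2 p.+1) x (v : 'M[R]_(p.+1, 3)) i :
  (forall k, k != i -> v k j2 = 0) -> v i j2 = 1 ->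
  contraction w x v = w x (setrow i V v).
Proof.
move=> vk vi; rewrite /contraction (bigD1 i)//= vi mul1r big1 ?addr0// => k ki.
by rewrite vk// mul0r.
Qed.

Local Notation Om_rho := (coinvariant Om (fun k : int => phi k%:~R)).

Definition flow_difference p (w : pform R 2 p) :=
  exists2 z, Om z & w = z - pullback (phi 1) z.

Lemma linear_Om p : linear_set (@torus_forms R P lam p).
Proof. by split; [exact: Om0|exact: Om_lincomb]. Qed.

Lemma ext_deriv_flow_difference p (z : pform R 2 p) : Om z ->
  ext_deriv (z - pullback (phi 1) z) = ext_deriv z - pullback (phi 1) (ext_deriv z).
Proof.
move=> /Om_smooth sz.
have sP := smooth_form_pullback_flow V (smooth_mu lam_gt0) 1 sz.
have dP := ext_deriv_pullback_flow V (smooth_mu lam_gt0) (mu_hessian lam_gt0) 1 sz.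
have e : -1 *: pullback (phi 1) z + z = z - pullback (phi 1) z.
  by rewrite scaleN1r addrC.
have d := etrans (congr1 (@ext_deriv R 2 p) (esym e)) (ext_deriv_lincomb (-1) sP sz).
by apply: etrans d _; rewrite dP scaleN1r addrC.
Qed.

Lemma linear_flow_difference p : linear_set (@flow_difference p).
Proof.
split; first by exists 0; [exact: Om0|rewrite -[RHS]/(0 - 0) subr0].
move=> k x y [z Oz ->] [u Ou ->]; exists (k *: z + u); first exact: Om_lincomb.
by rewrite pullbackD pullbackZ scalerBr opprD addrACA.
Qed.

Lemma flow_difference_nat p (z : pform R 2 p) (n : nat) : Om z ->
  flow_difference (z - pullback (phi n%:R) z).
Proof.
move=> Oz; have [c0 cD] := linear_flow_difference p; elim: n => [|n IH].
  by rewrite pullback_shear_flow0 subrr.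
have -> : z - pullback (phi n.+1%:R) z = 1 *: (z - pullback (phi n%:R) z) +
   (pullback (phi n%:R) z - pullback (phi 1) (pullback (phi n%:R) z)).
  rewrite (pullback_shear_flowD (smooth_mu lam_gt0) (@muV R lam a)) natr1.
  by rewrite scale1r addrA subrK.
apply: cD IH _; exists (pullback (phi n%:R) z); last by [].
exact: (Om_pullback_flow lam_gt0 eigV n%:R Oz).
Qed.

(** The differences for the time-n maps telescope, so the differences for the
    time-one map already form the linear span. *)
Lemma coinvariantE p : @coinvariant R 2 Om (fun k : int => phi k%:~R) p = @flow_difference p.
Proof.
apply/seteqP; split=> w /=.
  apply: lspan_min; first exact: linear_flow_difference.
  move=> _ [k [z [Oz ->]]].
  case: k => n; first exact: flow_difference_nat.
  have [c0 cD] := linear_flow_difference p.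
  pose u := pullback (phi (- n.+1%:R)) z.
  have Ou : Om u by exact: (Om_pullback_flow lam_gt0 eigV (- n.+1%:R) Oz).
  have := cD (-1) _ _ (flow_difference_nat n.+1 Ou) c0.
  rewrite addr0 scaleN1r opprB.
  rewrite (pullback_shear_flowD (smooth_mu lam_gt0) (@muV R lam a)) addNr.
  by rewrite pullback_shear_flow0 /u NegzE mulrNz.
move=> [z Oz ->]; apply/asboolP.
exists 1%N, (fun=> 1), (fun=> z - pullback (phi 1) z); split; last first.
  by rewrite big_ord1 scale1r.
by move=> _; exists 1, z.
Qed.

Local Notation C_tau := (divergence Om phi).
Local Notation J := (@flow_mean R 2 mu V _).

Lemma J_lie p (w : pform R 2 p) : Om w ->
  J (lie_deriv phi w) = pullback (phi 1) w - w.
Proof.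
by move=> /Om_smooth sw; exact: (flow_mean_lie (smooth_mu lam_gt0) (@muV R lam a) sw).
Qed.

Lemma J_lincomb p (k : R) (w z : pform R 2 p) : Om w -> Om z ->
  J (k *: w + z) = k *: J w + J z.
Proof.
by move=> /Om_smooth sw /Om_smooth sz; exact: (@flow_mean_lincomb R 2 mu V (smooth_mu lam_gt0) p k w z sw sz).
Qed.

Lemma J_ext_deriv p (w : pform R 2 p) : Om w -> ext_deriv (J w) = J (ext_deriv w).
Proof.
move=> /Om_smooth sw.
exact: (@ext_deriv_flow_mean R 2 mu V (smooth_mu lam_gt0) (mu_hessian lam_gt0) p w sw).
Qed.

Lemma J_invariant p (w : pform R 2 p) : (forall s, pullback (phi s) w = w) -> J w = w.
Proof.
move=> wi; apply/funext => x; apply/funext => v; rewrite /flow_mean.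
have -> : (fun s => pullback (phi s) w x v) = (fun=> w x v).
  by apply/funext => s; rewrite wi.
exact: int01_cst.
Qed.

Lemma lie_invariant p (w : pform R 2 p) : (forall s, pullback (phi s) w = w) ->
  lie_deriv phi w = 0.
Proof.
move=> wi; apply/funext => x; apply/funext => v; rewrite /lie_deriv.
have -> : (fun s => pullback (phi s) w x v) = cst (w x v).
  by apply/funext => s; rewrite wi.
exact: derive1_cst.
Qed.

(** If J w = 0 then w is invariant under the time-one map, hence under the whole
    flow, hence equal to its mean J w. *)
Lemma J_inj p (w : pform R 2 p) : Om w -> J w = 0 -> w = 0.
Proof.
move=> Ow Jw.
have wi : pullback (phi 1) w = w.
  exact: (flow_mean_eq0 (smooth_mu lam_gt0) (@muV R lam a) (Om_smooth Ow) Jw).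
by rewrite -(J_invariant (invariant_flow Ow wi)).
Qed.

Lemma linear_C_tau p : linear_set (@divergence R 2 Om phi p).
Proof.
split.
  exists 0; first exact: Om0.
  by apply: lie_invariant.
move=> k _ _ [w Ow <-] [z Oz <-]; exists (k *: w + z); first exact: Om_lincomb.
exact: (lie_deriv_lincomb V (smooth_mu lam_gt0) k (Om_smooth Ow) (Om_smooth Oz)).
Qed.

Lemma C_tau_Om p (w : pform R 2 p) : C_tau w -> Om w.
Proof. by move=> [z Oz <-]; exact: Om_lie. Qed.

Lemma linear_Om_rho p : linear_set (@coinvariant R 2 Om (fun k : int => phi k%:~R) p).
Proof. by rewrite coinvariantE; exact: linear_flow_difference. Qed.

Lemma Om_rhoP p (w : pform R 2 p) : Om_rho w <-> flow_difference w.
Proof. by rewrite coinvariantE. Qed.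

Lemma Om_rho_Om p (w : pform R 2 p) : Om_rho w -> Om w.
Proof.
move=> /Om_rhoP[z Oz ->].
exact: (Om_sub Oz (Om_pullback_flow lam_gt0 eigV 1 Oz)).
Qed.

Lemma Om_opp p (w : pform R 2 p) : Om w -> Om (- w).
Proof. by move=> Ow; rewrite -[- w]add0r; exact: (Om_sub (Om0 P lam p) Ow). Qed.

Lemma pullbackN1 p (z : pform R 2 p) :
  - z - pullback (phi 1) (- z) = pullback (phi 1) z - z.
Proof. by rewrite -[pullback _ (- z)]/(- pullback _ z) opprK addrC. Qed.

Lemma J_C_tau p (w : pform R 2 p) : C_tau w -> Om_rho (J w).
Proof.
move=> [z Oz <-]; apply/Om_rhoP; exists (- z); first exact: (Om_opp Oz).
by rewrite pullbackN1; exact: J_lie.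
Qed.

Lemma J_C_tau_surj p (w : pform R 2 p) : Om_rho w -> exists2 z, C_tau z & J z = w.
Proof.
move=> /Om_rhoP[z Oz ->]; have Oz' := Om_opp Oz.
exists (lie_deriv phi (- z)); first by exists (- z).
apply: etrans (J_lie Oz') _.
by have := pullbackN1 (- z); rewrite opprK => ->.
Qed.

Lemma J0 p : J (0 : pform R 2 p) = 0.
Proof. by apply: J_invariant. Qed.

Lemma J_inj2 p (w z : pform R 2 p) : Om w -> Om z -> J w = J z -> w = z.
Proof.
move=> Ow Oz e; apply/eqP; rewrite -subr_eq0; apply/eqP/J_inj; first exact: Om_sub.
by rewrite addrC -scaleN1r J_lincomb// e scaleN1r addNr.
Qed.

(** The mean J over the flow commutes with d, sends L_X z to phi_1^* z - z, and is
    injective: it is an isomorphism from the complex of divergence forms onto the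
    complex of co-invariant forms. *)
Lemma cohomology_isomorphic p :
  lmod_isomorphic (cohomology C_tau p) (cohomology Om_rho p).
Proof.
apply: (@subquot_isomorphic _ _ _ _ _ _ _ (@flow_mean R 2 mu V p)).
- apply: linear_cocycles => [q|q w /C_tau_Om/Om_smooth//]; exact: linear_C_tau.
- apply: linear_coboundaries => [q|q w /C_tau_Om/Om_smooth//]; exact: linear_C_tau.
- apply: linear_cocycles => [q|q w /Om_rho_Om/Om_smooth//]; exact: linear_Om_rho.
- apply: linear_coboundaries => [q|q w /Om_rho_Om/Om_smooth//]; exact: linear_Om_rho.
- by move=> k x y [Cx _] [Cy _]; apply: J_lincomb; exact: C_tau_Om.
- move=> x [Cx dx]; split; first exact: J_C_tau.
  by rewrite J_ext_deriv ?dx ?J0//; exact: C_tau_Om.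
- move=> y [/J_C_tau_surj[z Cz <-] dy]; exists z => //; split=> //.
  apply: J_inj; first exact/Om_ext_deriv/C_tau_Om.
  by rewrite -J_ext_deriv//; exact: C_tau_Om.
- move=> x [Cx dx]; case: p x Cx dx => [|p] x Cx dx; split.
  + by move=> ->; exact: J0.
  + by move=> Jx; apply: J_inj Jx; exact: C_tau_Om.
  + move=> [u Cu <-]; exists (J u); first exact: J_C_tau.
    by rewrite J_ext_deriv//; exact: C_tau_Om.
  + move=> [_ /J_C_tau_surj[u Cu <-] e]; exists u => //.
    apply: J_inj2; [exact/Om_ext_deriv/C_tau_Om|exact: C_tau_Om|].
    by rewrite -J_ext_deriv//; exact: C_tau_Om.
Qed.

(** If h - phi_1^* h is closed, then dh is invariant under the flow; hence dh(V) = 0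
    and h is constant along the flow. *)
Lemma H0_eq0 (x : cohomology Om_rho 0) : x = 0.
Proof.
apply: subquot_eq0.
- apply: linear_cocycles => [q|q w /Om_rho_Om/Om_smooth//]; exact: linear_Om_rho.
- apply: linear_coboundaries => [q|q w /Om_rho_Om/Om_smooth//]; exact: linear_Om_rho.
move=> z [/Om_rhoP[h Oh ->] dz].
have Odh := Om_ext_deriv Oh.
have inv : pullback (phi 1) (ext_deriv h) = ext_deriv h.
  have e := etrans (esym (ext_deriv_flow_difference Oh)) dz.
  by rewrite -[LHS](subKr (ext_deriv h)) e subr0.
have DV y u : 'D_V (fun y => h y u) y = 0.
  pose v : 'M[R]_(1, 3) := e2 R.
  have := contraction0 Odh inv y v.
  rewrite (@contraction_row 0 _ _ _ 0); last 2 first.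
  - by move=> k; rewrite ord1 eqxx.
  - by rewrite /v /e2 pt2.
  rewrite /ext_deriv big_ord1 expr0 scale1r row_setrow.
  by rewrite [row' _ _]flatmx0 (flatmx0 u).
rewrite /coboundaries /=; apply/funext => y; apply/funext => v.
have [_ _ sh] := Om_smooth Oh.
have e : h (phi 1 y) (v *m jacobian (phi 1) y) = h y v.
  rewrite (flatmx0 (v *m _)) (flatmx0 v).
  exact: (derive_line0 (f := fun y => h y 0) (sh 0) (fun y => DV y 0)).
exact: (etrans (congr1 (fun r => h y v - r) e) (subrr _)).
Qed.

End TorusFlow.

(** * Means over the fibres *)

Section FibreMean.
Variable R : realType.
Local Notation E := 'rV[R]_3.
Local Notation smooth := (@smooth R 2).
Local Notation e0 := (e0 R).
Local Notation e1 := (e1 R).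
Local Notation e2 := (e2 R).
Implicit Types (f : E -> R^o).

Lemma avg_periodic e u f : (forall x, f (x + u) = f x) ->
  forall x, avg e f (x + u) = avg e f x.
Proof.
move=> fu x; rewrite !avgE; congr int01; apply/funext => s.
by rewrite addrAC fu.
Qed.

Lemma moment_periodic e u f : (forall x, f (x + u) = f x) ->
  forall x, moment e f (x + u) = moment e f x.
Proof.
move=> fu x; rewrite !momentE; congr int01; apply/funext => s.
by rewrite addrAC fu.
Qed.

Lemma avg_cst e f x : (forall s, f (x + s *: e) = f x) -> avg e f x = f x.
Proof.
move=> fe; rewrite avgE -[RHS]int01_cst; congr int01; exact/funext.
Qed.

(** Mean over the fibre of the height through the given point, for functions
    periodic under e0 and e1. *)
Definition mean f := avg e0 (avg e1 f).

Lemma smooth_mean f : smooth f -> smooth (mean f).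
Proof. by move=> sf; do 2 apply: smooth_avg. Qed.

Lemma avg_lincomb e f g (b c : R) x : smooth f -> smooth g ->
  avg e (fun y => b * f y + c * g y) x = b * avg e f x + c * avg e g x.
Proof.
move=> sf sg; rewrite !avgE.
have cs h : smooth h -> continuous (fun s : R => h (x + s *: e)).
  move=> sh s; apply/differentiable_continuous/derivable1_diffP.
  by case: (is_derive_line (v := e) (smooth_diff (x + s *: e) sh)).
rewrite -!int01Z; [|exact: cs..].
by rewrite -int01D// => s; (apply: cvgM; [exact: cvg_cst|]); exact: cs.
Qed.

Lemma mean_lincomb f g (b c : R) x : smooth f -> smooth g ->
  mean (fun y => b * f y + c * g y) x = b * mean f x + c * mean g x.
Proof.
move=> sf sg; rewrite /mean -avg_lincomb; try exact: smooth_avg.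
by congr (avg e0 _ x); apply/funext => y; exact: avg_lincomb.
Qed.

Lemma derive_mean f u x : smooth f ->
  'D_u (mean f) x = mean (fun y => 'D_u f y) x.
Proof.
move=> sf; rewrite /mean derive_avg; last exact: smooth_avg.
by congr (avg e0 _ x); apply/funext => y; exact: derive_avg.
Qed.

(** Averaging over the lattice parallelogram spanned by u and w kills the
    derivatives in the directions of u and w of functions periodic in both. *)
Lemma derive_avg2 u w f (b c : R) x : smooth f ->
  (forall y, f (y + u) = f y) -> (forall y, f (y + w) = f y) ->
  'D_(b *: u + c *: w) (avg u (avg w f)) x = 0.
Proof.
move=> sf fu fw.
have d1 : 'D_u (avg u (avg w f)) x = 0.
  rewrite derive_avg_along; last exact: smooth_avg.
  by rewrite (avg_periodic w fu) subrr.
have d2 : 'D_w (avg u (avg w f)) x = 0.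
  rewrite derive_avg; last exact: smooth_avg.
  have -> : (fun y => 'D_w (avg w f) y) = (fun=> 0).
    by apply/funext => y; rewrite derive_avg_along// fw subrr.
  exact: avg_cst.
rewrite derive_linear ?d1 ?d2 ?mulr0 ?addr0//.
by apply: smooth_diff; do 2 apply: smooth_avg.
Qed.

Lemma horizontalE (u : E) : u 0 j2 = 0 -> u = u 0 j0 *: e0 + u 0 j1 *: e1.
Proof. by move=> u2; rewrite {1}[u]rV3E u2 scale0r addr0. Qed.

Lemma derive_mean0 f (u : E) x : smooth f ->
  (forall y, f (y + e0) = f y) -> (forall y, f (y + e1) = f y) ->
  u 0 j2 = 0 -> 'D_u (mean f) x = 0.
Proof. by move=> sf f0 f1 /horizontalE ->; exact: derive_avg2. Qed.

Lemma mean_derive0 f (u : E) x : smooth f ->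
  (forall y, f (y + e0) = f y) -> (forall y, f (y + e1) = f y) ->
  u 0 j2 = 0 -> mean (fun y => 'D_u f y) x = 0.
Proof. by move=> sf f0 f1 u2; rewrite -derive_mean//; exact: derive_mean0. Qed.

Lemma mean_cst f x : (forall (u y : E), u 0 j2 = 0 -> f (y + u) = f y) ->
  mean f x = f x.
Proof.
move=> fu; have h0 s : (s *: e0) 0 j2 = 0 by rewrite mxE /e0 pt2 mulr0.
have h1 s : (s *: e1) 0 j2 = 0 by rewrite mxE /e1 pt2 mulr0.
rewrite /mean (_ : avg e1 f = f); last first.
  by apply/funext => y; apply: avg_cst => s; exact: fu.
by apply: avg_cst => s; exact: fu.
Qed.

End FibreMean.

Section HeightFunctions.
Variable R : realType.
Local Notation E := 'rV[R]_3.
Local Notation smooth := (@smooth R 2).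

Definition cos_height (x : E) : R^o := cos (2 * pi * x 0 j2).
Definition sin_height (x : E) : R^o := sin (2 * pi * x 0 j2).

Let lin : smooth (fun x : E => 2 * pi * x 0 j2).
Proof. by apply: smoothZ; exact: smooth_coord. Qed.

Let derive_lin x v : 'D_v (fun x : E => 2 * pi * x 0 j2 : R^o) x = 2 * pi * v 0 j2.
Proof.
by rewrite (deriveZ _ (smooth_derivable (@smooth_coord R 2 j2))) derive_coord.
Qed.

Let derive_cos x v : differentiable cos_height x /\
  'D_v cos_height x = - (2 * pi * v 0 j2) * sin_height x.
Proof.
have [d e] := derive_comp1 v (is_derive_cos (2 * pi * x 0 j2)) (smooth_diff x lin).
split; [exact: d|apply: etrans e _; rewrite derive_lin /sin_height; ring].
Qed.

Let derive_sin x v : differentiable sin_height x /\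
  'D_v sin_height x = (2 * pi * v 0 j2) * cos_height x.
Proof.
have [d e] := derive_comp1 v (is_derive_sin (2 * pi * x 0 j2)) (smooth_diff x lin).
split; [exact: d|apply: etrans e _; rewrite derive_lin /cos_height; ring].
Qed.

Lemma smooth_cos_height : smooth cos_height.
Proof.
suff H k : differentiable_upto k cos_height /\ differentiable_upto k sin_height.
  by move=> k; case: (H k).
elim: k => [//|k [IHc IHs]]; split; apply/duSP; split=> [x|v].
- by case: (derive_cos x 0).
- have -> : (fun x => 'D_v cos_height x) = (fun x => - (2 * pi * v 0 j2) * sin_height x).
    by apply/funext => x; case: (derive_cos x v).
  by apply: du_M => //; exact: du_cst.
- by case: (derive_sin x 0).
- have -> : (fun x => 'D_v sin_height x) = (fun x => (2 * pi * v 0 j2) * cos_height x).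
    by apply/funext => x; case: (derive_sin x v).
  by apply: du_M => //; exact: du_cst.
Qed.

Lemma cos_height_int (x : E) (k : int) (y : E) : y 0 j2 = k%:~R + x 0 j2 ->
  cos_height y = cos_height x.
Proof.
move=> yx; rewrite /cos_height yx mulrDr addrC.
have cn (r : R) (n : nat) : cos (r + 2 * pi * n%:R) = cos r.
  by rewrite -(periodicn (@cosD2pi R) n r) -mulr_natr; congr (cos (_ + _)); ring.
case: k {yx} => n; first exact: cn.
rewrite NegzE mulrNz mulrN -[LHS](cn _ n.+1).
by congr cos; rewrite subrK.
Qed.

(** Such a combination is a polynomial vanishing at every number between -1 and 1. *)
Lemma cos_height_free n (b : 'I_n -> R) :
  (forall x, \sum_(j < n) b j * cos_height x ^+ j = 0) -> forall j, b j = 0.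
Proof.
move=> H; pose q : {poly R} := \poly_(j < n) (if insub j is Some i then b i else 0).
have qj (j : 'I_n) : q`_j = b j by rewrite coef_poly ltn_ord insubT//= => ?; congr b; exact: val_inj.
suff q0 : q = 0 by move=> j; rewrite -qj q0 coef0.
pose r k : R := (k.+1%:R)^-1.
apply: (@roots_geq_poly_eq0 _ _ [seq r k | k <- iota 0 n]).
- apply/allP => _ /mapP[k _ ->]; apply/eqP.
  have r01 : -1 <= r k <= 1.
    rewrite (le_trans (lerN10 _)) ?invr_ge0//= invf_le1// ?ler1n//; exact: ltr0Sn.
  have pi0 : 2 * pi != 0 :> R by rewrite mulf_neq0// ?pnatr_eq0// gt_eqF// pi_gt0.
  have := H (pt 0 (acos (r k) / (2 * pi))).
  rewrite /cos_height pt2 mulrC divfK// acosK ?in_itv//= => <-.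
  rewrite horner_poly; apply: eq_bigr => j _.
  by rewrite insubT//= => ?; congr (b _ * _); exact: val_inj.
- rewrite map_inj_uniq ?iota_uniq// => k m /invr_inj/eqP.
  by rewrite eqr_nat => /eqP[].
- by rewrite size_map size_iota size_poly.
Qed.

End HeightFunctions.

(** * Cohomology in degrees one and two *)

Lemma sub_eq_swap (K : nzRingType) (U : lmodType K) (x y x' y' : U) :
  x - x' = y - y' -> y' - x' = y - x.
Proof.
move=> e; have -> : x' = x - (y - y') by rewrite -e subKr.
by rewrite opprB addrA [y' + _]addrC subrK.
Qed.

Lemma pullback_sum (R : realType) n p (I : Type) (r : seq I) (h : 'rV[R]_n.+1 -> 'rV[R]_n.+1)
    (w : I -> pform R n p) :
  pullback h (\sum_(i <- r) w i) = \sum_(i <- r) pullback h (w i).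
Proof.
elim: r => [|i r IH]; first by rewrite !big_nil.
by rewrite !big_cons pullbackD IH.
Qed.

Section InfiniteDimension.
Variables (R : realType) (P : 'M[R]_2) (lam a : R).
Local Notation E := 'rV[R]_3.
Local Notation smooth := (@smooth R 2).
Hypotheses (P_unit : P \in unitmx) (lam_gt0 : 0 < lam) (lam_neq1 : lam != 1).
Hypothesis eigV : forall t,
  mxflow P lam t *m slope_vec a = lam `^ t *: slope_vec a.
Local Notation mu := (mu lam).
Local Notation V := (V a).
Local Notation L := (L P lam).
Local Notation phi := (shear_flow mu V).
Local Notation Om := (torus_forms P lam).
Local Notation Om_rho := (coinvariant Om (fun k : int => phi k%:~R)).
Local Notation l := (ln lam).
Local Notation contr := (contraction a).

(** If a combination of the exhibited classes is the differential of h - phi^* h,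
    then the same combination of the w j differs from dh by a form invariant
    under the flow, whose contraction vanishes. *)
Lemma infinite_criterion p (w : nat -> pform R 2 p.+1) :
  (forall j, Om (w j)) ->
  (forall j, ext_deriv (w j - pullback (phi 1) (w j)) = 0) ->
  (forall n (b : 'I_n -> R) (h : pform R 2 p), Om h ->
     (forall x v, contr (\sum_(j < n) b j *: w j) x v = contr (ext_deriv h) x v) ->
     forall j, b j = 0) ->
  infinite_dimensional (cohomology Om_rho p.+1).
Proof.
move=> Ow dw indep; have lOm := linear_Om_rho lam_gt0 eigV.
have sOm q (z : pform R 2 q) : Om_rho z -> smooth_form z.
  by move=> /(Om_rho_Om lam_gt0 eigV)/Om_smooth.
apply: (@subquot_infinite _ _ _ _ _ _ (fun j => w j - pullback (phi 1) (w j))).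
- exact: (linear_cocycles lOm sOm).
- exact: (linear_coboundaries lOm sOm).
- move=> j; split; last exact: dw.
  by apply/(Om_rhoP lam_gt0 eigV); exists (w j).
move=> n b [u /(Om_rhoP lam_gt0 eigV)[h Oh ->] du].
pose W : pform R 2 p.+1 := \sum_(j < n) b j *: w j.
have OW : Om W by apply: linear_set_sum; [exact: linear_Om|move=> j; exact: Ow].
have Odh : Om (ext_deriv h) by exact: Om_ext_deriv.
have inv : pullback (phi 1) (W - ext_deriv h) = W - ext_deriv h.
  have e2 := etrans (esym (ext_deriv_flow_difference a lam_gt0 Oh)) du.
  have e3 : \sum_(j < n) b j *: (w j - pullback (phi 1) (w j)) =
      W - pullback (phi 1) W.
    rewrite pullback_sum -sumrB; apply: eq_bigr => j _.
    by rewrite pullbackZ scalerBr.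
  rewrite e3 in e2; exact: (sub_eq_swap e2).
have Od : Om (W - ext_deriv h) by exact: (Om_sub OW Odh).
apply: (indep n b h Oh) => x v.
have c0 := contraction0 P_unit lam_gt0 lam_neq1 Od inv x v.
apply/eqP; rewrite -subr_eq0; apply/eqP; apply: etrans _ c0.
rewrite /contraction -sumrB; apply: eq_bigr => i _.
by rewrite -mulrBr.
Qed.

Lemma derive_height (F : E -> R^o) v x : smooth F ->
  (forall (u y : E), u 0 j2 = 0 -> F (y + u) = F y) ->
  'D_v F x = v 0 j2 * 'D_(e2 R) F x.
Proof.
move=> sF Fu; have e22 : e2 R 0 j2 = 1 by exact: pt2.
have comb (b c : R) (y z : E) i : (b *: y + c *: z) 0 i = b * y 0 i + c * z 0 i.
  by rewrite !mxE.
pose u := 1 *: v + (- v 0 j2) *: e2 R.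
have u2 : u 0 j2 = 0 by rewrite comb e22; ring.
have Du : 'D_u F x = 0.
  have := is_derive_line (v := u) (smooth_diff (x + (0 : R) *: u) sF).
  rewrite scale0r addr0 => -[_ <-].
  have -> : (fun r : R => F (x + r *: u)) = cst (F x).
    by apply/funext => r; rewrite Fu// mxE u2 mulr0.
  exact: derive_cst.
have vE : v = 1 *: u + v 0 j2 *: e2 R.
  by rewrite /u !scale1r -addrA -scalerDl addNr scale0r addr0.
rewrite {1}vE derive_linear; last exact: smooth_diff.
by rewrite Du mulr0 add0r.
Qed.

Lemma ext_deriv_height p (F : E -> R^o) (B : 'M[R]_(p, 3) -> R) x v : smooth F ->
  (forall (u y : E), u 0 j2 = 0 -> F (y + u) = F y) ->
  ext_deriv (fun x v => F x * B v : R^o) x v =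
  'D_(e2 R) F x * \sum_(i < p.+1) (-1) ^+ i * (v i j2 * B (row' i v)).
Proof.
move=> sF Fu; rewrite /ext_deriv mulr_sumr; apply: eq_bigr => i _.
have -> : (fun y => F y * B (row' i v) : R^o) = (fun y => B (row' i v) * F y).
  by apply/funext => y; rewrite mulrC.
rewrite (deriveZ _ (smooth_derivable sF)) derive_height// !mxE /GRing.scale/=.
by ring.
Qed.

Lemma smooth_cosX j : smooth (fun x : E => cos_height x ^+ j).
Proof.
elim: j => [|j IH]; first exact: smooth_cst.
under eq_fun do rewrite exprS; exact: smoothM (@smooth_cos_height R) IH.
Qed.

Lemma cos_height_horizontal (u y : E) : u 0 j2 = 0 ->
  cos_height (y + u) = cos_height y.
Proof. by move=> u2; rewrite /cos_height mxE u2 addr0. Qed.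

Lemma mu_horizontal (u y : E) : u 0 j2 = 0 -> mu (y + u) = mu y.
Proof. by move=> u2; rewrite !muE// mxE u2 addr0. Qed.

Lemma V2 : V 0 j2 = 0. Proof. exact: pt2. Qed.

Lemma V0 : V 0 j0 = 1. Proof. by rewrite /V pt0 !mxE. Qed.

Lemma phi_horizontal s x : exists2 u : E, u 0 j2 = 0 & phi s x = x + u.
Proof. by exists ((s * mu x) *: V) => //; rewrite mxE V2 mulr0. Qed.

Lemma cos_height_gam m k x : cos_height (gam P lam m k x) = cos_height x.
Proof.
by apply: (@cos_height_int _ x k); rewrite -!heightE height_gam.
Qed.

Lemma sum_formE n p (b : 'I_n -> R) (w : 'I_n -> pform R 2 p) x v :
  (\sum_(j < n) b j *: w j) x v = \sum_(j < n) b j * w j x v.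
Proof.
elim: n b w => [|n IH] b w; first by rewrite !big_ord0.
by rewrite !big_ord_recl -(IH (fun i => b (lift ord0 i)) (fun i => w (lift ord0 i))).
Qed.

(** The first coordinate of the planar part in the eigenbasis P; A^t multiplies it
    by lam^t. *)
Definition ell (v : E) : R := invmx P 0 0 * v 0 j0 + invmx P 0 1 * v 0 j1.

Lemma ell_pt u t : ell (pt u t) = (invmx P *m u) 0 0.
Proof.
rewrite /ell pt0 pt1 mxE big_ord_recl big_ord1; congr (_ + _ * u _ _); last exact: val_inj.
by congr (invmx P _ _); exact: val_inj.
Qed.

Lemma mulVP (u : 'cV[R]_2) t : invmx P *m (mxflow P lam t *m u) =
  diag2 (lam `^ t) (lam `^ (- t)) *m (invmx P *m u).
Proof. by rewrite /mxflow !mulmxA mulVmx// mul1mx. Qed.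

Lemma diag2_mul (x y : R) (u : 'cV[R]_2) :
  (diag2 x y *m u) 0 0 = x * u 0 0 /\ (diag2 x y *m u) 1 0 = y * u 1 0.
Proof. by rewrite /diag2 mul_diag_mx !mxE. Qed.

Lemma ell_mulL v t : ell (v *m L t) = lam `^ t * ell v.
Proof.
rewrite -(pt_eta v) pt_mulL !ell_pt mulVP.
by have [-> _] := diag2_mul (lam `^ t) (lam `^ (- t)) (invmx P *m plane v).
Qed.

Lemma ellV_neq0 : ell V != 0.
Proof.
rewrite ell_pt; set y := invmx P *m slope_vec a.
apply/negP => /eqP y0.
have e : diag2 (lam `^ 1) (lam `^ (- 1)) *m y = lam `^ 1 *: y.
  by rewrite /y -mulVP eigV -scalemxAr.
have [_ e1] := diag2_mul (lam `^ 1) (lam `^ (- 1)) y.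
have y1 : y 1 0 = 0.
  move: e1; rewrite e mxE powRN powRr1 ?ltW// => e1.
  have : (lam ^+ 2 - 1) * y 1 0 = 0.
    by rewrite mulrBl mul1r expr2 -mulrA e1 mulrA divff ?gt_eqF// mul1r subrr.
  move/eqP; rewrite mulf_eq0 subr_eq0 => /orP[|/eqP//].
  by rewrite sqrp_eq1 ?ltW// (negPf lam_neq1).
have y00 : y = 0.
  apply/colP => i; rewrite [RHS]mxE.
  case: i => [[|[|//]] hi].
    by rewrite -[RHS]y0; congr (y _ _); exact: val_inj.
  by rewrite -[RHS]y1; congr (y _ _); exact: val_inj.
have : slope_vec a = P *m y by rewrite /y mulmxA mulmxV// mul1mx.
rewrite y00 mulmx0 => /colP/(_ 0); rewrite !mxE /= => /eqP.
by rewrite oner_eq0.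
Qed.

(** The factor lam^-t makes this form invariant under the lattice. *)
Definition form1 (j : nat) : pform R 2 1 :=
  fun x v => cos_height x ^+ j * (mu x)^-1 * ell (row 0 v).

Lemma Om_form1 j : Om (form1 j).
Proof.
apply/OmP; split; first split=> [x|x|v].
- move=> i u v w b c e _ _; rewrite (ord1 i) in e.
  rewrite /form1 e /ell !mxE /GRing.scale/=; ring.
- by move=> v i k; rewrite !ord1 eqxx.
- apply: smoothM; last exact: smooth_cst.
  apply: smoothM; first exact: smooth_cosX.
  by apply: smoothV; [exact: smooth_mu|move=> y; exact: mu_neq0].
move=> m k; apply/funext => x; apply/funext => v.
rewrite pullback_gam /form1 row_mul ell_mulL cos_height_gam mu_gam//.
rewrite invfM; have := powR_gt0 k%:~R lam_gt0; move: (lam `^ k%:~R) => q q0.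
by field; rewrite mu_neq0// gt_eqF.
Qed.

Lemma contr_form1 j x v : contr (form1 j) x v =
  v 0 j2 * (cos_height x ^+ j * (mu x)^-1 * ell V).
Proof. by rewrite /contraction big_ord1 /form1 row_setrow. Qed.

Lemma form1_diff j : form1 j - pullback (phi 1) (form1 j) =
  fun x v => cos_height x ^+ j * (- (l * ell V) * v 0 j2).
Proof.
apply/funext => x; apply/funext => v.
have e := @pullback_phiE R lam a lam_gt0 1 (form1 j) 1 x v (Om_smooth (Om_form1 j)).
apply: etrans (congr1 (fun r => form1 j x v - r) e) _.
have [u u2 ->] := phi_horizontal 1 x.
rewrite contr_form1 /form1 cos_height_horizontal// mu_horizontal//.
by field; rewrite mu_neq0.
Qed.

(** For the forms w_j = cos(2 pi t)^j lam^-t ell, the difference w_j - phi_1^* w_j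
    is a function of t times dt, hence closed. If a combination of them were the
    differential of h - phi_1^* h, then the same combination of the
    cos(2 pi t)^j lam^-t ell(V) would be the derivative of h along V; the mean of
    the latter over the fibres is zero, while the former is constant on them. *)
Lemma H1_infinite : infinite_dimensional (cohomology Om_rho 1).
Proof.
apply: (infinite_criterion Om_form1) => [j|n b h Oh hE].
  rewrite form1_diff; apply/funext => x; apply/funext => v.
  rewrite (ext_deriv_height (fun v => - (l * ell V) * v 0 j2) x v (smooth_cosX j)); last first.
    by move=> u y u2; rewrite cos_height_horizontal.
  rewrite big_ord_recl big_ord1 !mxE.
  have -> : lift ord0 0 = 1 :> 'I_2 by exact: val_inj.
  have -> : lift 1 0 = 0 :> 'I_2 by exact: val_inj.
  rewrite /= expr0 expr1 -[RHS]/(0 : R); ring.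
have [_ _ sh] := Om_smooth Oh.
pose f (y : E) : R^o := h y 0.
have fE x : \sum_(j < n) b j * (cos_height x ^+ j * (mu x)^-1 * ell V) = 'D_V f x.
  have := hE x (e2 R); rewrite /contraction !big_ord1 sum_formE.
  have -> : e2 R 0 j2 = 1 by exact: pt2.
  rewrite !mul1r /ext_deriv big_ord1 expr0 scale1r row_setrow.
  rewrite [row' _ _]flatmx0 -/f => <-.
  by apply: eq_bigr => j _; rewrite /form1 row_setrow.
have sG : forall x, 'D_V f x = 0.
  move=> x.
  have mf : mean (fun y => 'D_V f y) x = 0.
    apply: mean_derive0 => //; [exact: sh|..]; last exact: V2.
    - by move=> y; exact: (Om_periodic0 P_unit 0 y Oh).
    - by move=> y; exact: (Om_periodic1 P_unit 0 y Oh).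
  rewrite -mf mean_cst// => u y u2; rewrite -!fE; apply: eq_bigr => j _.
  by rewrite cos_height_horizontal// mu_horizontal.
apply: cos_height_free => x.
have := fE x; rewrite sG => e.
have : (\sum_(j < n) b j * cos_height x ^+ j) * ((mu x)^-1 * ell V) = 0.
  by rewrite -[RHS]e mulr_suml; apply: eq_bigr => j _; ring.
move/eqP; rewrite mulf_eq0 => /orP[/eqP//|].
by rewrite mulf_eq0 invr_eq0 (negPf (mu_neq0 lam_gt0 x)) (negPf ellV_neq0).
Qed.

Definition area (v : 'M[R]_(2, 3)) : R := v 0 j0 * v 1 j1 - v 0 j1 * v 1 j0.

Lemma det2E (M : 'M[R]_2) : \det M = M 0 0 * M 1 1 - M 0 1 * M 1 0.
Proof.
rewrite (expand_det_row M 0) big_ord_recl big_ord1 /cofactor !det_mx11 !mxE.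
have -> : lift ord0 0 = 1 :> 'I_2 by exact: val_inj.
have -> : lift 1 0 = 0 :> 'I_2 by exact: val_inj.
have -> : ord0 = 0 :> 'I_2 by exact: val_inj.
by rewrite /= addn0 expr0 add0n expr1; ring.
Qed.

Lemma mulL_coord p (v : 'M[R]_(p, 3)) t i (M := mxflow P lam t) :
  (v *m L t) i j0 = M 0 0 * v i j0 + M 0 1 * v i j1 /\
  (v *m L t) i j1 = M 1 0 * v i j0 + M 1 1 * v i j1.
Proof.
have rE j : (v *m L t) i j = (row i v *m L t) 0 j by rewrite -row_mul [RHS]mxE.
have v0 : plane (row i v) 0 0 = v i j0 by rewrite -(pt0 _ (height (row i v))) pt_eta [LHS]mxE.
have v1 : plane (row i v) 1 0 = v i j1 by rewrite -(pt1 _ (height (row i v))) pt_eta [LHS]mxE.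
rewrite !rE -(pt_eta (row i v)) pt_mulL pt0 pt1 [_ 0 0]mxE [_ 1 0]mxE !big_ord_recl !big_ord0 !addr0.
have -> : lift ord0 ord0 = 1 :> 'I_2 by exact: val_inj.
have -> : ord0 = 0 :> 'I_2 by exact: val_inj.
by rewrite v0 v1.
Qed.

Lemma area_mulL (v : 'M[R]_(2, 3)) t : area (v *m L t) = area v.
Proof.
rewrite /area; have [-> ->] := mulL_coord v t 0; have [-> ->] := mulL_coord v t 1.
have := det_mxflow P_unit lam_gt0 t; rewrite det2E => D.
by rewrite -[RHS]mul1r -D; ring.
Qed.

Definition form2 (j : nat) : pform R 2 2 :=
  fun x v => cos_height x ^+ j * area v.

Lemma lift00 : lift 0 0 = 1 :> 'I_2. Proof. exact: val_inj. Qed.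
Lemma lift10 : lift 1 0 = 0 :> 'I_2. Proof. exact: val_inj. Qed.

Lemma ord2P (Q : 'I_2 -> Prop) : Q 0 -> Q 1 -> forall i, Q i.
Proof.
move=> q0 q1 [[|[|//]] hi].
- by rewrite (_ : Ordinal hi = 0)//; exact: val_inj.
- by rewrite (_ : Ordinal hi = 1)//; exact: val_inj.
Qed.

Lemma Om_form2 j : Om (form2 j).
Proof.
apply/OmP; split; first split=> [x|x|v].
- move=> i u v w b c; rewrite /form2 /area /GRing.scale/=.
  move: i; apply: ord2P => /rowP e /matrixP ev /matrixP ew.
  + have e1 k : v 1 k = u 1 k by have := ev 0 k; rewrite !mxE lift00.
    have e2 k : w 1 k = u 1 k by have := ew 0 k; rewrite !mxE lift00.
    have e0 k : u 0 k = b * v 0 k + c * w 0 k by have := e k; rewrite !mxE.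
    by rewrite !e0 !e1 !e2; ring.
  + have e1 k : v 0 k = u 0 k by have := ev 0 k; rewrite !mxE lift10.
    have e2 k : w 0 k = u 0 k by have := ew 0 k; rewrite !mxE lift10.
    have e0 k : u 1 k = b * v 1 k + c * w 1 k by have := e k; rewrite !mxE.
    by rewrite !e0 !e1 !e2; ring.
- move=> v i k ik e; rewrite /form2 /area.
  have e01 q : v 0 q = v 1 q.
    have /rowP/(_ q) := e; rewrite !mxE; move: ik {e}.
    by move: i; apply: ord2P; move: k; apply: ord2P.
  by rewrite !e01; ring.
- by apply: smoothM; [exact: smooth_cosX|exact: smooth_cst].
move=> m k; apply/funext => x; apply/funext => v.
by rewrite pullback_gam /form2 area_mulL cos_height_gam.
Qed.

Lemma V1 : V 0 j1 = a. Proof. by rewrite /V pt1 !mxE. Qed.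

Definition flux (v : 'M[R]_(2, 3)) : R :=
  v 0 j2 * (v 1 j1 - a * v 1 j0) + v 1 j2 * (v 0 j0 * a - v 0 j1).

Lemma contr_form2 j x v : contr (form2 j) x v = cos_height x ^+ j * flux v.
Proof.
rewrite /contraction big_ord_recl big_ord1 /form2 /area /flux.
have -> : lift ord0 ord0 = 1 :> 'I_2 by exact: val_inj.
have -> : ord0 = 0 :> 'I_2 by exact: val_inj.
have r00 k : setrow 0 V v 0 k = V 0 k by rewrite mxE.
have r01 k : setrow 0 V v 1 k = v 1 k by rewrite mxE.
have r10 k : setrow 1 V v 0 k = v 0 k by rewrite mxE.
have r11 k : setrow 1 V v 1 k = V 0 k by rewrite mxE.
by rewrite !r00 !r01 !r10 !r11 V0 V1; ring.
Qed.

Lemma smooth_mucos j : smooth (fun x => mu x * cos_height x ^+ j).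
Proof. by apply: smoothM; [exact: smooth_mu|exact: smooth_cosX]. Qed.

Lemma form2_diff j : form2 j - pullback (phi 1) (form2 j) =
  fun x v => mu x * cos_height x ^+ j * (- l * flux v).
Proof.
apply/funext => x; apply/funext => v.
have e := @pullback_phiE R lam a lam_gt0 2 (form2 j) 1 x v (Om_smooth (Om_form2 j)).
apply: etrans (congr1 (fun r => form2 j x v - r) e) _.
have [u u2 ->] := phi_horizontal 1 x.
rewrite contr_form2 /form2 cos_height_horizontal//; ring.
Qed.

Lemma flux_closed (v : 'M[R]_(3, 3)) :
  \sum_(i < 3) (-1) ^+ i * (v i j2 * (- l * flux (row' i v))) = 0.
Proof.
have r0 k : row' j0 v 0 k = v j1 k by rewrite mxE; congr (v _ k); exact: val_inj.
have r0' k : row' j0 v 1 k = v j2 k by rewrite mxE; congr (v _ k); exact: val_inj.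
have r1 k : row' j1 v 0 k = v j0 k by rewrite mxE; congr (v _ k); exact: val_inj.
have r1' k : row' j1 v 1 k = v j2 k by rewrite mxE; congr (v _ k); exact: val_inj.
have r2 k : row' j2 v 0 k = v j0 k by rewrite mxE; congr (v _ k); exact: val_inj.
have r2' k : row' j2 v 1 k = v j1 k by rewrite mxE; congr (v _ k); exact: val_inj.
rewrite big_ord_recl big_ord_recl big_ord_recl big_ord0.
have -> : ord0 = j0 by exact: val_inj.
have -> : lift j0 ord0 = j1 by exact: val_inj.
have -> : lift j0 (lift ord0 ord0) = j2 by exact: val_inj.
rewrite /flux !r0 !r0' !r1 !r1' !r2 !r2' /=; ring.
Qed.

(** The same argument with w_j = cos(2 pi t)^j dx /\ dy: here the combination of
    the cos(2 pi t)^j would be dh(V, e1), a sum of derivatives along the fibre, whose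
    mean over the fibres is zero. *)
Lemma H2_infinite : infinite_dimensional (cohomology Om_rho 2).
Proof.
apply: (infinite_criterion Om_form2) => [j|n b h Oh hE].
  rewrite form2_diff; apply/funext => x; apply/funext => v.
  rewrite (ext_deriv_height (fun v => - l * flux v) x v (smooth_mucos j)); last first.
    by move=> u y u2; rewrite mu_horizontal// cos_height_horizontal.
  by rewrite flux_closed mulr0.
have [_ _ sh] := Om_smooth Oh.
pose f (y : E) : R^o := h y (e1 R).
pose g (y : E) : R^o := h y V.
pose v : 'M[R]_(2, 3) := \matrix_(i, k) (if i == 0 then e2 R else e1 R) 0 k.
have v0 : row 0 v = e2 R by apply/rowP => k; rewrite !mxE.
have v1 : row 1 v = e1 R by apply/rowP => k; rewrite !mxE.
have fE x : \sum_(j < n) b j * cos_height x ^+ j = 'D_V f x - 'D_(e1 R) g x.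
  have vk k : k != 0 -> v k j2 = 0.
    by move: k; apply: ord2P => //= _; rewrite mxE /=; exact: pt2.
  have v02 : v 0 j2 = 1 by rewrite mxE /=; exact: pt2.
  have := hE x v; have cr w := @contraction_row R a 1 w x v 0 vk v02; rewrite !cr sum_formE.
  set u := setrow 0 V v.
  have u0 k : u 0 k = V 0 k by rewrite mxE.
  have u1 k : u 1 k = e1 R 0 k by rewrite mxE /= mxE.
  have au : area u = 1.
    by rewrite /area !u0 !u1 V0 V1 /e1 pt0 pt1 !mxE /=; ring.
  have -> : \sum_(j < n) b j * form2 j x u = \sum_(j < n) b j * cos_height x ^+ j.
    by apply: eq_bigr => j _; rewrite /form2 au mulr1.
  move=> ->; rewrite /ext_deriv big_ord_recl big_ord1 expr0 scale1r.
  have -> : lift ord0 ord0 = 1 :> 'I_2 by exact: val_inj.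
  have -> : ord0 = 0 :> 'I_2 by exact: val_inj.
  rewrite expr1 scaleN1r.
  have -> : row 0 u = V by apply/rowP => k; rewrite mxE u0.
  have -> : row 1 u = e1 R by apply/rowP => k; rewrite mxE u1.
  have -> : row' 0 u = e1 R.
    by apply/matrixP => q k; rewrite mxE ord1 lift00 u1.
  have -> // : row' 1 u = V.
  by apply/matrixP => q k; rewrite mxE ord1 lift10 u0.
have G0 x : \sum_(j < n) b j * cos_height x ^+ j = 0.
  pose G y : R^o := \sum_(j < n) b j * cos_height y ^+ j.
  have GE : G = (fun y => 1 * 'D_V f y + (-1) * 'D_(e1 R) g y).
    by apply/funext => y; rewrite /G fE mul1r mulN1r.
  have e12 : e1 R 0 j2 = 0 by exact: pt2.
  have mf : mean (fun y => 'D_V f y) x = 0.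
    apply: mean_derive0; [exact: sh|..|exact: V2].
    - by move=> y; exact: (Om_periodic0 P_unit _ y Oh).
    - by move=> y; exact: (Om_periodic1 P_unit _ y Oh).
  have mg : mean (fun y => 'D_(e1 R) g y) x = 0.
    apply: mean_derive0; [exact: sh|..|exact: e12].
    - by move=> y; exact: (Om_periodic0 P_unit _ y Oh).
    - by move=> y; exact: (Om_periodic1 P_unit _ y Oh).
  have mG : mean G x = G x.
    apply: mean_cst => u y u2; apply: eq_bigr => j _.
    by rewrite cos_height_horizontal.
  rewrite -[LHS]/(G x) -mG GE mean_lincomb ?mf ?mg ?mulr0 ?addr0//.
  - exact/smooth_derive/sh.
  - exact/smooth_derive/sh.
exact: cos_height_free.
Qed.

End InfiniteDimension.

(** * Smooth gluing along the height *)

Section FlatFunction.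
Variable R : realType.

(** Up to linear combinations the family is closed under derivation, so that all
    its members are smooth at once. *)
Definition flat (n : nat) (t : R) : R^o :=
  if 0 < t then t ^- n * expR (- t^-1) else 0.

Lemma flat_pos0 t : 0 < t -> 0 < flat 0 t.
Proof. by rewrite /flat => ->; rewrite expr0 invr1 mul1r expR_gt0. Qed.

Lemma flat_nonpos n t : t <= 0 -> flat n t = 0.
Proof. by rewrite /flat ltNge => ->. Qed.

Lemma flat_ge0 t : 0 <= flat 0 t.
Proof.
have [t0|t0] := ltP 0 t; first exact/ltW/flat_pos0.
by rewrite flat_nonpos.
Qed.

Lemma expRN_inv_le (k : nat) (t : R) : 0 < t -> expR (- t^-1) <= (k.+1%:R * t) ^+ k.+1.
Proof.
move=> t0; rewrite expRN -[leRHS]invrK lef_pV2 ?posrE ?expR_gt0 ?invr_gt0 ?exprn_gt0 ?mulr_gt0//.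
have -> : t^-1 = k.+1%:R * (k.+1%:R * t)^-1.
  by rewrite invfM mulrA divff ?mul1r// pnatr_eq0.
rewrite expRM_natl -exprVn; apply: lerXn2r; rewrite ?nnegrE ?expR_ge0//.
  by rewrite invr_ge0 mulr_ge0// ltW.
by apply: le_trans (expR_ge1Dx _); rewrite lerDr.
Qed.

Lemma flat_le n : exists C, forall t : R, `|flat n t| <= C * `|t| ^+ 2.
Proof.
exists (n.+2%:R ^+ n.+2) => t; rewrite /flat; case: ifPn => t0; last first.
  by rewrite normr0 mulr_ge0// exprn_ge0.
rewrite normrM (gtr0_norm (expR_gt0 _)) !gtr0_norm ?invr_gt0 ?exprn_gt0//.
rewrite mulrC ler_pdivrMr ?exprn_gt0//.
apply: le_trans (expRN_inv_le n.+1 t0) _.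
by rewrite exprMn -[in leRHS]mulrA -exprD add2n.
Qed.

(** At t = 0 the exponential beats every power of t, which flat_le makes
    quantitative. *)
Lemma is_derive_flat n (t : R) :
  is_derive t 1 (flat n) (flat n.+2 t - n%:R * flat n.+1 t).
Proof.
have [t0|t0|->] := ltgtP t 0.
- have e : \near t, cst (0 : R^o) t = flat n t.
    near=> s; rewrite flat_nonpos//=.
    by apply/ltW; near: s; exact: lt_nbhsl.
  apply: near_eq_is_derive e _.
  by rewrite !flat_nonpos ?ltW// mulr0 subr0; exact: is_derive_cst.
- have e : \near t, (fun s : R => s ^- n * expR (- s^-1) : R^o) t = flat n t.
    near=> s; rewrite /flat ifT//.
    by near: s; exact: lt_nbhsr.
  apply: near_eq_is_derive e _.
  have tn0 : t != 0 by rewrite gt_eqF.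
  have dV : is_derive t 1 (fun s : R => s^-1) (- t ^- 2 *: 1).
    by apply: is_deriveV tn0 _; exact: is_derive_id.
  have dE := @is_derive1_comp R expR (fun s => - s^-1) t _ _ (is_derive_expR _) (is_deriveN dV).
  have dX : is_derive t 1 (fun s : R => s ^+ n) (n%:R * t ^+ n.-1).
    split; first exact: exprn_derivable.
    by rewrite -derive1E exp_derive1.
  have dXV := @is_deriveV R (fun s => s ^+ n) t _ _ (expf_neq0 n tn0) dX.
  have [dM eM] := is_deriveM dXV dE.
  split; [exact: dM|apply: etrans eM _].
  rewrite /flat t0 /GRing.scale/= mulr1 opprK.
  move: (expR (- t^-1)) => q; case: (n) => [|k] /=.
    by field.
  by rewrite !exprS; field; rewrite expf_neq0.
- rewrite !flat_nonpos// mulr0 subr0.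
  suff H : h^-1 *: (flat n (h *: 1 + 0) - flat n 0) @[h --> 0^'] --> (0 : R^o).
    by split; [apply/cvg_ex; exists 0|exact: cvg_lim].
  have [C HC] := flat_le n.
  have C0 : 0 <= C by have := HC 1; rewrite normr1 expr1n mulr1; exact: le_trans.
  apply/cvgrPdist_le => e e0; near=> h.
  rewrite sub0r normrN [flat n 0]flat_nonpos// subr0 addr0 /GRing.scale/= mulr1.
  have h0 : h != 0 by near: h; exact: nbhs_dnbhs_neq.
  rewrite normrM normfV ler_pdivrMl ?normr_gt0//.
  apply: le_trans (HC h) _; rewrite expr2 mulrA mulrC ler_pM2l ?normr_gt0//.
  apply: (@le_trans _ _ ((C + 1) * `|h|)); first by rewrite ler_wpM2r// lerDl.
  rewrite -ler_pdivlMl ?ltr_pwDr//.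
  near: h; apply: dnbhs0_le; rewrite mulr_gt0// invr_gt0 ltr_pwDr//.
Unshelve. all: by end_near.
Qed.

End FlatFunction.

Section SmoothStep.
Variable R : realType.
Local Notation E := 'rV[R]_3.
Local Notation smooth := (@smooth R 2).

Lemma smooth_flat_affine n (s c : R) : smooth (fun x : E => flat n (s * x 0 j2 + c)).
Proof.
move=> k; elim: k n => [//|k IH] n.
have sl : smooth (fun x : E => s * x 0 j2 + c).
  by apply: smoothD; [apply: smoothZ; exact: smooth_coord|exact: smooth_cst].
have dl x v : 'D_v (fun x : E => s * x 0 j2 + c : R^o) x = s * v 0 j2.
  have sc : smooth (fun x : E => x 0 j2) := @smooth_coord R 2 j2.
  have := derive_lincomb s 1 x v sc (@smooth_cst R 2 c).
  by rewrite derive_cst mulr0 addr0 derive_coord mul1r.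
have dF (x v : E) := derive_comp1 v (is_derive_flat n (s * x 0 j2 + c)) (smooth_diff x sl).
apply/duSP; split=> [x|v]; first by case: (dF x 0).
have -> : (fun x : E => 'D_v (fun x : E => flat n (s * x 0 j2 + c)) x) = (fun x =>
  (flat n.+2 (s * x 0 j2 + c) + - n%:R * flat n.+1 (s * x 0 j2 + c)) * (s * v 0 j2)).
  by apply/funext => x; have [_ ->] := dF x v; rewrite dl mulNr.
apply: du_M; last exact: du_cst.
by apply: du_D; [exact: IH|apply: du_M; [exact: du_cst|exact: IH]].
Qed.

(** A smooth transition from 0 for t at most 1/4 to 1 for t at least 3/4. *)
Definition step (t : R) : R := flat 0 (t - 4^-1) / (flat 0 (t - 4^-1) + flat 0 (3 / 4 - t)).

Lemma step_den_gt0 (t : R) : 0 < flat 0 (t - 4^-1) + flat 0 (3 / 4 - t).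
Proof.
have [t1|t1] := ltP 4^-1 t.
  by apply: ltr_pwDl; [apply: flat_pos0; rewrite subr_gt0|exact: flat_ge0].
by apply: ltr_pwDr; [apply: flat_pos0; lra|exact: flat_ge0].
Qed.

Lemma step0 (t : R) : t <= 4^-1 -> step t = 0.
Proof. by move=> t1; rewrite /step flat_nonpos ?mul0r// subr_le0. Qed.

Lemma step1 (t : R) : 3 / 4 <= t -> step t = 1.
Proof.
move=> t1; have := step_den_gt0 t; rewrite /step (flat_nonpos 0 (t := 3 / 4 - t)) ?subr_le0//.
by rewrite addr0 => ?; rewrite divff// gt_eqF.
Qed.

Lemma smooth_step (c : R) : smooth (fun x : E => step (x 0 j2 - c)).
Proof.
have s1 : smooth (fun x : E => flat 0 (x 0 j2 - c - 4^-1)).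
  have := @smooth_flat_affine 0 1 (- c - 4^-1).
  by under eq_fun do rewrite mul1r addrA.
have s2 : smooth (fun x : E => flat 0 (3 / 4 - (x 0 j2 - c))).
  have -> : (fun x : E => flat 0 (3 / 4 - (x 0 j2 - c))) =
      (fun x => flat 0 (-1 * x 0 j2 + (3 / 4 + c))).
    by apply/funext => x; congr flat; ring.
  exact: smooth_flat_affine.
apply: smoothM => //; apply: smoothV; first exact: smoothD.
by move=> x; rewrite gt_eqF// step_den_gt0.
Qed.

(** The transition from F m to F (m + 1) takes place at heights strictly between
    m and m + 1, so that the glued function is F m near the height m. *)
Definition glue (F : int -> E -> R^o) (x : E) : R^o :=
  let m := Num.floor (x 0 j2) in
  F m x + step (x 0 j2 - m%:~R) * (F (m + 1) x - F m x).

Let piece (F : int -> E -> R^o) (m : int) (x : E) : R^o :=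
  F m x + step (x 0 j2 - m%:~R) * (F (m + 1) x - F m x).

Let floor_near (x : E) (m : int) : m%:~R < x 0 j2 < m%:~R + 1 ->
  Num.floor (x 0 j2) = m.
Proof.
move=> /andP[h1 h2]; apply: floor_def.
by rewrite (ltW h1) intrD.
Qed.

Lemma near_height (x : E) (b c : R) : b < x 0 j2 < c ->
  \forall y \near x, b < (y : E) 0 j2 < c.
Proof.
move=> /andP[h1 h2].
have cc := smooth_continuous (@smooth_coord R 2 j2) (x := x).
near=> y; apply/andP; split.
- by near: y; exact: (cvgr_gt _ cc).
- by near: y; exact: (cvgr_lt _ cc).
Unshelve. all: by end_near. Qed.

Lemma smooth_glue F : (forall m, smooth (F m)) -> smooth (glue F).
Proof.
move=> sF; apply: smooth_local => x.
set m := Num.floor (x 0 j2).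
have fx : m%:~R <= x 0 j2 < m%:~R + 1.
  by rewrite floor_le_tmp -[1]/(1%:~R) -intrD floorD1_gt.
have [xm|xm] := eqVneq (x 0 j2) m%:~R.
(* Below the height m the glued function is a transition from F (m - 1) to F m,
   which is over at the height m - 1/4. *)
- exists (F m) => //.
  have H : m%:~R - 4^-1 < x 0 j2 < m%:~R + 4^-1 by rewrite xm; lra.
  apply: filterS (near_height H) => y /andP[y1 y2].
  rewrite /glue /=; have [ym|ym] := leP m%:~R (y 0 j2).
    have -> : Num.floor (y 0 j2) = m by apply: floor_def; rewrite ym intrD; lra.
    by rewrite step0 ?mul0r ?addr0//; lra.
  have -> : Num.floor (y 0 j2) = m - 1.
    by apply: floor_def; rewrite subrK intrB ym andbT; lra.
  by rewrite subrK step1 ?mul1r ?subrKC//; rewrite intrB; lra.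
- exists (piece F m).
    apply: smoothD; first exact: sF.
    by apply: smoothM; [exact: smooth_step|apply: smoothB; exact: sF].
  have H : m%:~R < x 0 j2 < m%:~R + 1.
    by move: fx; rewrite le_eqVlt eq_sym (negPf xm).
  apply: filterS (near_height H) => y /floor_near fy.
  by rewrite /glue fy.
Qed.

Lemma derive_line_eq (f g : E -> R^o) (x v : E) :
  (forall r : R, f (r *: v + x) = g (r *: v + x)) -> 'D_v f x = 'D_v g x.
Proof.
move=> fg; rewrite /derive.
have -> // : (fun h : R => h^-1 *: ((f \o shift x) (h *: v) - f x)) =
  (fun h : R => h^-1 *: ((g \o shift x) (h *: v) - g x)).
apply/funext => h /=; rewrite fg; congr (_ *: (_ - _)).
by have := fg 0; rewrite scale0r add0r.
Qed.

Lemma derive_glue F (v : E) x : (forall m, smooth (F m)) -> v 0 j2 = 0 ->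
  'D_v (glue F) x = glue (fun m y => 'D_v (F m) y) x.
Proof.
move=> sF v2; set m := Num.floor (x 0 j2).
pose s := step (x 0 j2 - m%:~R).
transitivity ('D_v (fun y => (1 - s) * F m y + s * F (m + 1) y) x).
  apply: derive_line_eq => r; rewrite /glue mxE [(r *: v) _ _]mxE v2 mulr0 add0r.
  by rewrite -/m -/s; ring.
rewrite derive_lincomb; [|exact: sF|exact: sF].
by rewrite /glue -/m -/s; ring.
Qed.

End SmoothStep.

(** * Divergences on the torus *)

Section Divergence.
Variables (R : realType) (P : 'M[R]_2) (lam : R).
Local Notation E := 'rV[R]_3.
Local Notation smooth := (@smooth R 2).
Hypotheses (P_unit : P \in unitmx) (lam_gt0 : 0 < lam).
Local Notation L := (L P lam).
Local Notation A t := (mxflow P lam t).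
Local Notation gam := (gam P lam).
Local Notation e0 := (e0 R).
Local Notation e1 := (e1 R).
Local Notation e2 := (e2 R).

Lemma mulLVr t : L t *m L (- t) = 1%:M.
Proof. by rewrite -(LD P_unit lam_gt0) addrN (L0 lam P_unit). Qed.

Lemma mulVLr t : L (- t) *m L t = 1%:M.
Proof. by rewrite -(LD P_unit lam_gt0) addNr (L0 lam P_unit). Qed.

(** For integral t these vectors and the next ones form another basis of the
    lattice of the fibre. *)
Definition frame0 (t : R) : E := e0 *m L (- t).
Definition frame1 (t : R) : E := e1 *m L (- t).

Lemma sum2 (F : 'I_2 -> R) : \sum_i F i = F 0 + F 1.
Proof. by rewrite !big_ord_recl big_ord0 addr0; congr (_ + F _); exact: val_inj. Qed.

Lemma ptE u : pt u 0 = u 0 0 *: e0 + u 1 0 *: e1 :> E.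
Proof.
by rewrite [LHS]rV3E pt0 pt1 pt2 scale0r addr0.
Qed.

Lemma e0_frame t : e0 = A t 0 0 *: frame0 t + A t 1 0 *: frame1 t.
Proof.
rewrite -[LHS]mulmx1 -(mulLVr t) mulmxA pt_mulL ptE mulmxDl -!scalemxAl.
by rewrite -colE !mxE.
Qed.

Lemma e1_frame t : e1 = A t 0 1 *: frame0 t + A t 1 1 *: frame1 t.
Proof.
rewrite -[LHS]mulmx1 -(mulLVr t) mulmxA pt_mulL ptE mulmxDl -!scalemxAl.
by rewrite -colE !mxE.
Qed.

Lemma frame0_horizontal t : frame0 t 0 j2 = 0.
Proof. by rewrite -heightE height_mulL height_pt. Qed.

Lemma frame1_horizontal t : frame1 t 0 j2 = 0.
Proof. by rewrite -heightE height_mulL height_pt. Qed.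

Lemma gamE m k (x : E) : gam m k x = gam 0 k x + pt (map_mx intr m) 0.
Proof.
rewrite /gam raddf0 addrAC ptD add0r addr0 //.
Qed.

Lemma gamD m k (x u : E) : gam m k (x + u) = gam m k x + u *m L k%:~R.
Proof. by rewrite /gam mulmxDl addrA. Qed.

Lemma gam_translate m x : gam m 0 x = x + pt (map_mx intr m) 0.
Proof. by rewrite /gam mulr0z (L0 lam P_unit) mulmx1 addrC. Qed.

Lemma gam_gam j m k x :
  gam 0 (- j) (gam m k x) = gam 0 (k - j) x + pt (map_mx intr m) 0 *m L (- j%:~R).
Proof.
have g0 i y : gam 0 i y = y *m L i%:~R + pt 0 i%:~R.
  by rewrite /gam raddf0 addrC.
have e1 := congr1 (gam 0 (- j)) (gamE m k x).
have e2 := gamD 0 (- j) (gam 0 k x) (pt (map_mx intr m) 0).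
have e3 : gam 0 (- j) (gam 0 k x) = gam 0 (k - j) x.
  have e : (k - j)%:~R = k%:~R + - j%:~R :> R by rewrite intrD mulrNz.
  have Lk := LD P_unit lam_gt0 k%:~R (- j%:~R).
  rewrite [LHS]g0 [RHS]g0 [gam 0 k x]g0 mulmxDl mulrNz -mulmxA -Lk -e -addrA.
  by rewrite pt_mulL mulmx0 ptD addr0 e.
have en : (- j)%:~R = - j%:~R :> R by exact: mulrNz.
by rewrite e3 en in e2; exact: (etrans e1 e2).
Qed.

Lemma derive_gam f k u x : smooth f ->
  'D_u (fun y => f (gam 0 k y)) x = 'D_(u *m L k%:~R) f (gam 0 k x).
Proof. by move=> sf; apply: derive_affine; exact: smooth_diff. Qed.

Lemma smooth_gam f k : smooth f -> smooth (fun y => f (gam 0 k y)).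
Proof. exact: smooth_affine. Qed.

Lemma avg_gam (f : E -> R^o) e k x :
  avg e f (gam 0 k x) = avg (e *m L (- k%:~R)) (fun y => f (gam 0 k y)) x.
Proof.
rewrite !avgE; congr int01; apply/funext => s.
by rewrite gamD -scalemxAl -mulmxA mulVLr mulmx1.
Qed.

Variable h : E -> R^o.
Hypotheses (sh : smooth h) (hinv : forall m k x, h (gam m k x) = h x).

Lemma h_e0 x : h (x + e0) = h x.
Proof. by have := hinv (delta_mx 0 0) 0 x; rewrite gam_translate map_delta_mx. Qed.

Lemma h_e1 x : h (x + e1) = h x.
Proof. by have := hinv (delta_mx 1 0) 0 x; rewrite gam_translate map_delta_mx. Qed.

Lemma h_frame0 (k : int) x : h (x + frame0 k%:~R) = h x.
Proof.
by rewrite -(hinv 0 k) gamD -mulmxA mulVLr mulmx1 h_e0 hinv.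
Qed.

Lemma h_frame1 (k : int) x : h (x + frame1 k%:~R) = h x.
Proof.
by rewrite -(hinv 0 k) gamD -mulmxA mulVLr mulmx1 h_e1 hinv.
Qed.

(** A primitive on each fibre: q0 accounts for the mean of h along e1, and q1 for
    the difference between h and this mean. *)
Definition q0 := moment e0 (avg e1 h).
Definition q1 := moment e1 h.

Lemma smooth_q0 : smooth q0.
Proof. by apply: smooth_moment; exact: smooth_avg. Qed.

Lemma smooth_q1 : smooth q1.
Proof. exact: smooth_moment. Qed.

Lemma div_q x : 'D_e0 q0 x + 'D_e1 q1 x = h x - mean h x.
Proof.
rewrite derive_moment_along; last exact: smooth_avg.
rewrite derive_moment_along// h_e1 (avg_periodic _ h_e0) /mean.
by rewrite addrC addrA subrK.
Qed.

Lemma mean_horizontal (u x : E) : u 0 j2 = 0 -> mean h (x + u) = mean h x.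
Proof.
move=> u2; have := derive_line0 (smooth_mean sh)
  (fun y => derive_mean0 y sh h_e0 h_e1 u2) x 1.
by rewrite scale1r.
Qed.

(** The mean over a fibre can be computed with any basis of the lattice, because
    h differs from its mean by derivatives of functions invariant under the
    lattice. *)
Lemma mean_basis (k : int) x :
  avg (frame0 k%:~R) (avg (frame1 k%:~R) h) x = mean h x.
Proof.
have [N NE] : exists N : (E -> R^o) -> E -> R^o,
    forall f, avg (frame0 k%:~R) (avg (frame1 k%:~R) f) = N f by eexists.
have N0 f e (b c : R) : smooth f -> (forall y, f (y + frame0 k%:~R) = f y) ->
    (forall y, f (y + frame1 k%:~R) = f y) -> e = b *: frame0 k%:~R + c *: frame1 k%:~R ->
    N (fun y => 'D_e f y) x = 0.
  move=> sf ff0 ff1 eE.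
  have <- : 'D_e (N f) x = N (fun y => 'D_e f y) x.
    rewrite -!NE derive_avg; last exact: smooth_avg.
    by congr (avg _ _ x); apply/funext => y; exact: derive_avg.
  by rewrite eE -NE; exact: derive_avg2.
have hE : h = (fun y => 1 * (1 * 'D_e0 q0 y + 1 * 'D_e1 q1 y) + 1 * mean h y).
  by apply/funext => y; rewrite !mul1r div_q subrK.
have Nlin f g (b c : R) : smooth f -> smooth g ->
    N (fun y => b * f y + c * g y) x = b * N f x + c * N g x.
  move=> sf sg; rewrite -!NE -avg_lincomb; try exact: smooth_avg.
  by congr (avg _ _ x); apply/funext => y; exact: avg_lincomb.
have sd0 := smooth_derive e0 smooth_q0; have sd1 := smooth_derive e1 smooth_q1.
have sd : smooth (fun y => 1 * 'D_e0 q0 y + 1 * 'D_e1 q1 y).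
  by apply: smoothD; exact: smoothZ.
have Nm : N (mean h) x = mean h x.
  have am y : avg (frame1 k%:~R) (mean h) y = mean h y.
    by apply: avg_cst => s; apply: mean_horizontal; rewrite mxE frame1_horizontal mulr0.
  rewrite -NE (_ : avg (frame1 k%:~R) (mean h) = mean h); last exact/funext.
  by apply: avg_cst => s; apply: mean_horizontal; rewrite mxE frame0_horizontal mulr0.
have n0 : N (fun y => 'D_e0 q0 y) x = 0.
  apply: (N0 q0 e0 (A k%:~R 0 0) (A k%:~R 1 0)).
  - exact: smooth_q0.
  - by apply: moment_periodic; apply: avg_periodic; exact: h_frame0.
  - by apply: moment_periodic; apply: avg_periodic; exact: h_frame1.
  - exact: e0_frame.
have n1 : N (fun y => 'D_e1 q1 y) x = 0.
  apply: (N0 q1 e1 (A k%:~R 0 1) (A k%:~R 1 1)).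
  - exact: smooth_q1.
  - by apply: moment_periodic; exact: h_frame0.
  - by apply: moment_periodic; exact: h_frame1.
  - exact: e1_frame.
have Nl f g : smooth f -> smooth g -> N f x = 0 ->
    N (fun y => 1 * f y + 1 * g y) x = N g x.
  have cancel (r s t : R) : s = 0 -> r = 1 * s + 1 * t -> r = t.
    by move=> -> ->; rewrite mulr0 add0r mul1r.
  by move=> sf sg z; exact: cancel z (Nlin f g 1 1 sf sg).
have nd : N (fun y => 1 * 'D_e0 q0 y + 1 * 'D_e1 q1 y) x = 0.
  exact: etrans (Nl _ _ sd0 sd1 n0) n1.
have Neq f g : f = g -> N f x = N g x by move=> ->.
rewrite NE; exact: etrans (Neq _ _ hE) (etrans (Nl _ _ sd (smooth_mean sh) nd) Nm).
Qed.

Lemma mean_gam k x : mean h (gam 0 k x) = mean h x.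
Proof.
rewrite {1}/mean avg_gam -(mean_basis k x); congr (avg _ _ x).
apply/funext => y; rewrite avg_gam; congr (avg _ _ y).
by apply/funext => z; exact: hinv.
Qed.

Lemma q0_lattice j m x : q0 (x + pt (map_mx intr m) 0 *m L (- j%:~R)) = q0 x.
Proof.
rewrite ptE mulmxDl -!scalemxAl !mxE addrA.
rewrite (@periodicZ _ q0 (frame1 j%:~R)).
  by apply: periodicZ; apply: moment_periodic; apply: avg_periodic; exact: h_frame0.
by apply: moment_periodic; apply: avg_periodic; exact: h_frame1.
Qed.

Lemma q1_lattice j m x : q1 (x + pt (map_mx intr m) 0 *m L (- j%:~R)) = q1 x.
Proof.
rewrite ptE mulmxDl -!scalemxAl !mxE addrA.
rewrite (@periodicZ _ q1 (frame1 j%:~R)).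
  by apply: periodicZ; apply: moment_periodic; exact: h_frame0.
by apply: moment_periodic; exact: h_frame1.
Qed.

(** The field (q0, q1) depends on the choice of the basis e0, e1, which the monodromy
    A does not preserve. This is its transport by the lattice element of
    height j; the transports are permuted by the action (transl_gam). *)
Definition transl i (j : int) (x : E) : R^o :=
  A j%:~R i 0 * q0 (gam 0 (- j) x) + A j%:~R i 1 * q1 (gam 0 (- j) x).

Lemma smooth_transl i j : smooth (transl i j).
Proof.
apply: smoothD; apply: smoothZ; apply: smooth_gam.
  exact: smooth_q0.
exact: smooth_q1.
Qed.

Lemma derive_transl i (j : int) u v x : u *m L (- j%:~R) = v ->
  'D_u (transl i j) x = A j%:~R i 0 * 'D_v q0 (gam 0 (- j) x) +
                        A j%:~R i 1 * 'D_v q1 (gam 0 (- j) x).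
Proof.
have <- : (- j)%:~R = - j%:~R :> R by exact: mulrNz.
move=> <-.
have s0 := smooth_gam (- j) smooth_q0; have s1 := smooth_gam (- j) smooth_q1.
have d0 := derive_gam (- j) u x smooth_q0; have d1 := derive_gam (- j) u x smooth_q1.
have dl := derive_lincomb (A j%:~R i 0) (A j%:~R i 1) x u s0 s1.
have subst (b c : R) (z p q p' q' : R^o) :
    p = p' -> q = q' -> z = b * p + c * q -> z = b * p' + c * q' by move=> -> ->.
exact: subst d0 d1 dl.
Qed.

Lemma div_transl j x :
  'D_e0 (transl 0 j) x + 'D_e1 (transl 1 j) x = h x - mean h x.
Proof.
have d0 := smooth_diff (gam 0 (- j) x) smooth_q0.
have d1 := smooth_diff (gam 0 (- j) x) smooth_q1.
have t0 := @derive_transl 0 j e0 (frame0 j%:~R) x erefl.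
have t1 := @derive_transl 1 j e1 (frame1 j%:~R) x erefl.
have l0 := derive_linear (A j%:~R 0 0) (A j%:~R 1 0) (frame0 j%:~R) (frame1 j%:~R) d0.
have l1 := derive_linear (A j%:~R 0 1) (A j%:~R 1 1) (frame0 j%:~R) (frame1 j%:~R) d1.
rewrite -(e0_frame j%:~R) in l0; rewrite -(e1_frame j%:~R) in l1.
have := div_q (gam 0 (- j) x); rewrite (hinv 0 (- j) x) (mean_gam (- j) x) => <-.
have swap (z0 z1 y0 y1 a b c d : R^o) : z0 = a + b -> z1 = c + d ->
    y0 = a + c -> y1 = b + d -> z0 + z1 = y0 + y1.
  by move=> -> -> -> ->; rewrite addrACA.
exact: swap t0 t1 l0 l1.
Qed.

Lemma transl_gam i j m k x : transl i j (gam m k x) =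
  A k%:~R i 0 * transl 0 (j - k) x + A k%:~R i 1 * transl 1 (j - k) x.
Proof.
have g := gam_gam j m k x; rewrite -[k - j]opprB in g.
have t0 := etrans (congr1 q0 g) (q0_lattice j m (gam 0 (- (j - k)) x)).
have t1 := etrans (congr1 q1 g) (q1_lattice j m (gam 0 (- (j - k)) x)).
have AE c : A j%:~R i c = A k%:~R i 0 * A (j - k)%:~R 0 c +
                          A k%:~R i 1 * A (j - k)%:~R 1 c.
  have {1}-> : j = k + (j - k) by rewrite addrC subrK.
  by rewrite intrD (mxflowD P_unit lam_gt0) mxE sum2.
have regroup (b c d e f w q r z0 z1 s t : R) : s = b * c + d * e ->
    t = b * f + d * w -> z0 = q -> z1 = r ->
    s * z0 + t * z1 = b * (c * q + f * r) + d * (e * q + w * r).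
  by move=> -> -> -> ->; ring.
exact: regroup (AE 0) (AE 1) t0 t1.
Qed.

(** Near the integral height m the field is the transport for j = m. Interpolating
    between the transports makes the field equivariant and does not change its
    divergence, since each transport has divergence h - mean h and the weights
    depend on the height only. *)
Definition W i := glue (transl i).

Lemma smooth_W i : smooth (W i).
Proof. by apply: smooth_glue => j; exact: smooth_transl. Qed.

Lemma div_W x : 'D_e0 (W 0) x + 'D_e1 (W 1) x = h x - mean h x.
Proof.
have w0 := derive_glue x (smooth_transl 0) (pt2 _ _ : e0 0 j2 = 0).
have w1 := derive_glue x (smooth_transl 1) (pt2 _ _ : e1 0 j2 = 0).
have convex (b c d e s r : R) (z0 z1 : R^o) : z0 = b + s * (c - b) ->
    z1 = d + s * (e - d) -> b + d = r -> c + e = r -> z0 + z1 = r.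
  move=> -> -> bd ce.
  have -> : d = r - b by rewrite -bd; ring.
  have -> : e = r - c by rewrite -ce; ring.
  by ring.
exact: convex w0 w1 (div_transl _ x) (div_transl _ x).
Qed.

Lemma W_gam i m k x : W i (gam m k x) = A k%:~R i 0 * W 0 x + A k%:~R i 1 * W 1 x.
Proof.
rewrite /W /glue -!heightE height_gam.
have -> : Num.floor (k%:~R + height x) = k + Num.floor (height x).
  by rewrite floorDzr ?intr_int// intrKfloor.
set n := Num.floor (height x).
have T0 := transl_gam i (k + n) m k x; rewrite (addrC k n) addrK in T0.
have T1 := transl_gam i (n + k + 1) m k x; rewrite addrAC addrK addrAC in T1.
have sE : k%:~R + height x - (n + k)%:~R = height x - n%:~R by rewrite intrD; ring.
have regroup (b c y0 y1 z0 z1 s r r1 : R) : r = b * y0 + c * y1 ->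
    r1 = b * z0 + c * z1 ->
    r + s * (r1 - r) = b * (y0 + s * (z0 - y0)) + c * (y1 + s * (z1 - y1)).
  by move=> -> ->; ring.
rewrite (addrC k n) sE; exact: regroup T0 T1.
Qed.

Definition Wt := moment e2 (mean h).

Lemma smooth_Wt : smooth Wt.
Proof. by apply: smooth_moment; exact: smooth_mean. Qed.

Lemma mean_e2 x : mean h (x + e2) = mean h x.
Proof.
have gE : gam 0 1 x = x + e2 + (x *m L 1 - x).
  rewrite /gam raddf0 -/e2 [x + e2]addrC -addrA; congr (_ + _).
  by rewrite addrC subrK.
have u2 : (x *m L 1 - x) 0 j2 = 0.
  have hL := height_mulL P lam x 1; rewrite !heightE in hL.
  by rewrite mxE [X in _ + X]mxE hL subrr.
have := mean_gam 1 x; rewrite gE => <-.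
exact: esym (mean_horizontal (x + e2) u2).
Qed.

Lemma total_mean : exists c, forall x, avg e2 (mean h) x = c.
Proof.
have sm := smooth_mean sh; have sa := smooth_avg e2 sm.
have d2 x : 'D_e2 (avg e2 (mean h)) x = 0.
  by rewrite derive_avg_along// mean_e2 subrr.
have du (u x : E) : u 0 j2 = 0 -> avg e2 (mean h) (x + u) = avg e2 (mean h) x.
  by move=> u2; apply: avg_periodic => y; exact: mean_horizontal.
have dv v x : 'D_v (avg e2 (mean h)) x = 0.
  by rewrite derive_height// d2 mulr0.
exists (avg e2 (mean h) 0) => x.
have := derive_line0 sa (dv x) 0 1.
by rewrite scale1r add0r.
Qed.

Lemma Wt_gam m k x : Wt (gam m k x) = Wt x.
Proof.
have Wh (u y : E) : u 0 j2 = 0 -> Wt (y + u) = Wt y.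
  by move=> u2; apply: moment_periodic => z; exact: mean_horizontal.
have W2 := periodicZ (moment_periodic e2 mean_e2 : forall y, Wt (y + e2) = Wt y).
rewrite -(W2 k x).
have gE : gam m k x = x + k%:~R *: e2 + (gam m k x - (x + k%:~R *: e2)).
  by rewrite addrC subrK.
rewrite gE Wh//.
have hg := height_gam P lam m k x; rewrite !heightE in hg.
by rewrite mxE [X in _ + X]mxE hg [(x + _) 0 _]mxE [(_ *: e2) 0 _]mxE [e2 0 j2]pt2; ring.
Qed.

(** The field (W 0, W 1) takes care of h minus its mean over the fibres; this mean is
    a periodic function of the height, and Wt of it minus its own mean c. *)
Lemma divergence_decomposition : exists c, forall x,
  'D_e0 (W 0) x + 'D_e1 (W 1) x + 'D_e2 Wt x = h x - c.
Proof.
have [c Hc] := total_mean; exists c => x.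
rewrite div_W derive_moment_along; last exact: smooth_mean.
by rewrite mean_e2 Hc addrA subrK.
Qed.

End Divergence.

(** * Cohomology in degree three *)

Section TopDegree.
Variables (R : realType) (P : 'M[R]_2) (lam a : R).
Local Notation E := 'rV[R]_3.
Local Notation smooth := (@smooth R 2).
Hypotheses (P_unit : P \in unitmx) (lam_gt0 : 0 < lam) (lam_neq1 : lam != 1).
Hypothesis eigV : forall t,
  mxflow P lam t *m slope_vec a = lam `^ t *: slope_vec a.
Local Notation mu := (mu lam).
Local Notation V := (V a).
Local Notation L := (L P lam).
Local Notation A t := (mxflow P lam t).
Local Notation phi := (shear_flow mu V).
Local Notation Om := (torus_forms P lam).
Local Notation Om_rho := (coinvariant Om (fun k : int => phi k%:~R)).
Local Notation contr := (contraction a).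

Definition minor0 (v : 'M[R]_(2, 3)) : R := v 0 j1 * v 1 j2 - v 0 j2 * v 1 j1.
Definition minor1 (v : 'M[R]_(2, 3)) : R := v 0 j2 * v 1 j0 - v 0 j0 * v 1 j2.

(** The interior product of the volume form dx /\ dy /\ dt with the vector field of
    components F0, F1, F2; its differential is the divergence times the volume. *)
Definition flux_form (F0 F1 F2 : E -> R^o) : pform R 2 2 :=
  fun x v => F0 x * minor0 v + F1 x * minor1 v + F2 x * area v.

Lemma smooth_flux_form F0 F1 F2 : smooth F0 -> smooth F1 -> smooth F2 ->
  smooth_form (flux_form F0 F1 F2).
Proof.
move=> s0 s1 s2; split=> [x|x|v].
- move=> i u v w b c; rewrite /flux_form /minor0 /minor1 /area /GRing.scale/=.
  move: i; apply: ord2P => /rowP e /matrixP ev /matrixP ew.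
  + have e1 k : v 1 k = u 1 k by have := ev 0 k; rewrite !mxE lift00.
    have e2 k : w 1 k = u 1 k by have := ew 0 k; rewrite !mxE lift00.
    have e0 k : u 0 k = b * v 0 k + c * w 0 k by have := e k; rewrite !mxE.
    by rewrite !e0 !e1 !e2; ring.
  + have e1 k : v 0 k = u 0 k by have := ev 0 k; rewrite !mxE lift10.
    have e2 k : w 0 k = u 0 k by have := ew 0 k; rewrite !mxE lift10.
    have e0 k : u 1 k = b * v 1 k + c * w 1 k by have := e k; rewrite !mxE.
    by rewrite !e0 !e1 !e2; ring.
- move=> v i k ik e; rewrite /flux_form /minor0 /minor1 /area.
  have e01 q : v 0 q = v 1 q.
    have /rowP/(_ q) := e; rewrite !mxE; move: ik {e}.
    by move: i; apply: ord2P; move: k; apply: ord2P.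
  by rewrite !e01; ring.
- by do 2?[apply: smoothD]; apply: smoothM => //; exact: smooth_cst.
Qed.

Lemma ext_deriv_flux_form F0 F1 F2 x : smooth F1 ->
  ext_deriv (flux_form F0 F1 F2) x 1%:M =
  'D_(e0 R) F0 x + 'D_(e1 R) F1 x + 'D_(e2 R) F2 x.
Proof.
move=> s1.
have r0 k : row' j0 1%:M 0 k = (j1 == k)%:R :> R by rewrite !mxE; congr ((_ == k)%:R); exact: val_inj.
have r0' k : row' j0 1%:M 1 k = (j2 == k)%:R :> R by rewrite !mxE; congr ((_ == k)%:R); exact: val_inj.
have r1 k : row' j1 1%:M 0 k = (j0 == k)%:R :> R by rewrite !mxE; congr ((_ == k)%:R); exact: val_inj.
have r1' k : row' j1 1%:M 1 k = (j2 == k)%:R :> R by rewrite !mxE; congr ((_ == k)%:R); exact: val_inj.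
have r2 k : row' j2 1%:M 0 k = (j0 == k)%:R :> R by rewrite !mxE; congr ((_ == k)%:R); exact: val_inj.
have r2' k : row' j2 1%:M 1 k = (j1 == k)%:R :> R by rewrite !mxE; congr ((_ == k)%:R); exact: val_inj.
have f0 : (fun y => flux_form F0 F1 F2 y (row' j0 1%:M)) = F0.
  apply/funext => y; rewrite /flux_form /minor0 /minor1 /area !r0 !r0' /=; ring.
have f1 : (fun y => flux_form F0 F1 F2 y (row' j1 1%:M)) = (fun y => - F1 y).
  apply/funext => y; rewrite /flux_form /minor0 /minor1 /area !r1 !r1' /=; ring.
have f2 : (fun y => flux_form F0 F1 F2 y (row' j2 1%:M)) = F2.
  apply/funext => y; rewrite /flux_form /minor0 /minor1 /area !r2 !r2' /=; ring.
have rw j : row j (1%:M : 'M[R]_3) = 'e_j by rewrite rowE mulmx1.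
rewrite /ext_deriv big_ord_recl big_ord_recl big_ord_recl big_ord0.
have -> : ord0 = j0 by exact: val_inj.
have -> : lift j0 ord0 = j1 by exact: val_inj.
have -> : lift j0 (lift ord0 ord0) = j2 by exact: val_inj.
rewrite f0 f1 f2 !rw -e0E -e1E -e2E.
have dN : 'D_(e1 R) (fun y => - F1 y) x = - 'D_(e1 R) F1 x.
  exact: deriveN (smooth_derivable s1).
by rewrite dN /= expr0 expr1 sqrrN expr1n !scale1r scaleN1r opprK addr0 addrA.
Qed.

Section Primitive.
Variable w : pform R 2 3.
Hypothesis Ow : Om w.
Let h (x : E) : R^o := w x 1%:M.

Let wE x v : w x v = \det v * h x.
Proof. by have [wm wa _] := Om_smooth Ow; exact: top_form_det. Qed.

Let sh : smooth h. Proof. by have [_ _] := Om_smooth Ow; apply. Qed.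

Let hinv m k x : h (gam P lam m k x) = h x.
Proof.
have e := Om_inv m k x 1%:M Ow.
by rewrite mul1mx wE (det_L P_unit lam_gt0) mul1r in e.
Qed.

Definition primitive : pform R 2 2 :=
  flux_form (W P lam h 0) (W P lam h 1) (Wt h).

Lemma Om_primitive : Om primitive.
Proof.
apply/OmP; split.
  by apply: smooth_flux_form; [exact: smooth_W|exact: smooth_W|exact: smooth_Wt].
move=> m k; apply/funext => x; apply/funext => v.
have g0 := W_gam P_unit lam_gt0 hinv 0 m k x.
have g1 := W_gam P_unit lam_gt0 hinv 1 m k x.
have gt := Wt_gam P_unit lam_gt0 sh hinv m k x.
have D := det_mxflow P_unit lam_gt0 k%:~R; rewrite det2E in D.
have h2 i : (v *m L k%:~R) i j2 = v i j2.
  have e := height_mulL P lam (row i v) k%:~R.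
  by rewrite -row_mul !heightE ![row _ _ _ _]mxE in e.
rewrite pullback_gam /primitive /flux_form (area_mulL P_unit lam_gt0) g0 g1 gt.
rewrite /minor0 /minor1 !h2.
have [-> ->] := mulL_coord P lam v k%:~R 0; have [-> ->] := mulL_coord P lam v k%:~R 1.
congr (_ + _); move: D {g0 g1 gt h2}.
move: (A k%:~R 0 0) (A k%:~R 0 1) (A k%:~R 1 0) (A k%:~R 1 1) => q0 q1 q2 q3 D.
move: (W P lam h 0 x) (W P lam h 1 x) => y z.
rewrite -[y in RHS]mul1r -[z in RHS]mul1r -D; ring.
Qed.

(** A form of top degree is exact up to a constant multiple of the volume. *)
Lemma ext_deriv_primitive : exists c, forall x v,
  w x v - ext_deriv primitive x v = \det v * c.
Proof.
have [c Hc] := divergence_decomposition P_unit lam_gt0 sh hinv; exists c => x v.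
have [dm da _] := Om_smooth (Om_ext_deriv Om_primitive).
have top := top_form_det v (dm x) (da x).
have dE := ext_deriv_flux_form (W P lam h 0) (Wt h) x (smooth_W P lam sh 1).
have close (y z y1 z1 y0 D r : R^o) : y = D * y1 -> z = D * z1 -> z1 = y0 ->
    y0 = y1 - r -> y - z = D * r by move=> -> -> -> ->; ring.
exact: close (wE x v) top dE (Hc x).
Qed.

End Primitive.

(** V is tangent to the fibres of the height, so that for a multiple w of the volume
    dt /\ i_V w = dt(V) w = 0. *)
Lemma volume_invariant (w : pform R 2 3) c : Om w ->
  (forall x v, w x v = \det v * c) -> pullback (phi 1) w = w.
Proof.
move=> Ow wE; have OP := Om_pullback_flow lam_gt0 eigV 1 Ow.
have [Pm Pa _] := Om_smooth OP.
apply/funext => x; apply/funext => v.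
have Pv := top_form_det v (Pm x) (Pa x).
have e := @pullback_phiE R lam a lam_gt0 3 w 1 x 1%:M (Om_smooth Ow).
have c0 : contr w (phi 1 x) 1%:M = 0.
  rewrite (@contraction_row R a 2 w _ _ j2); last 2 first.
  - by move=> i i2; rewrite mxE (negPf i2).
  - by rewrite mxE eqxx.
  rewrite wE (expand_det_col _ j2) big1 ?mul0r// => i _.
  rewrite mxE; case: ifP => i2; first by rewrite V2 mul0r.
  by rewrite mxE i2 mul0r.
rewrite c0 mulr0 addr0 wE det1 mul1r in e.
by rewrite e in Pv; exact: etrans Pv (esym (wE x v)).
Qed.

(** Write w = c vol + d e. The volume is invariant under the flow, so that
    w - phi_1^* w is the differential of e - phi_1^* e. *)
Lemma H3_eq0 (x : cohomology Om_rho 3) : x = 0.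
Proof.
have lOm := linear_Om_rho lam_gt0 eigV.
have sOm q (z : pform R 2 q) : Om_rho z -> smooth_form z.
  by move=> /(Om_rho_Om lam_gt0 eigV)/Om_smooth.
apply: subquot_eq0; [exact: (linear_cocycles lOm sOm)|
  exact: (linear_coboundaries lOm sOm)|].
move=> z [/(Om_rhoP lam_gt0 eigV)[w Ow ->] _].
have [c Hc] := ext_deriv_primitive Ow.
have Oe := Om_primitive Ow; set e := primitive w in Hc Oe.
have inv := volume_invariant (Om_sub Ow (Om_ext_deriv Oe)) Hc.
exists (e - pullback (phi 1) e).
  by apply/(Om_rhoP lam_gt0 eigV); exists e.
exact: etrans (ext_deriv_flow_difference a lam_gt0 Oe) (sub_eq_swap inv).
Qed.

End TopDegree.

(** * The cohomology of co-invariant forms *)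

Lemma infinite_dimensional_isomorphic (K : fieldType) (U U' : lmodType K) :
  lmod_isomorphic U U' -> infinite_dimensional U' -> infinite_dimensional U.
Proof.
move=> [f [g fK gK]] infU' [n [e span]]; apply: infU'.
exists n, (f \o e) => y; have [c yE] := span (g y); exists c.
by rewrite -[LHS]gK yE linear_sum; apply: eq_bigr => i _; rewrite linearZ.
Qed.

(** The eigenvector of A spans the first eigenline of P, because the two
    eigenvalues differ; hence it is an eigenvector of every A^t. *)
Lemma slope_vec_eigen (R : realType) (A : 'M[int]_2) (P : 'M[R]_2) (lam a : R) :
  P \in unitmx -> 0 < lam -> lam != 1 ->
  map_mx intr A = P *m diag2 lam lam^-1 *m invmx P ->
  map_mx intr A *m slope_vec a = lam *: slope_vec a ->
  forall t, mxflow P lam t *m slope_vec a = lam `^ t *: slope_vec a.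
Proof.
move=> P_unit lam_gt0 lam_neq1 AE aE t.
pose y := invmx P *m slope_vec a.
have yE : slope_vec a = P *m y by rewrite mulmxA mulmxV// mul1mx.
have Dy : diag2 lam lam^-1 *m y = lam *: y.
  by rewrite scalemxAr -aE AE !mulmxA mulVmx// mul1mx.
have y1 : y 1 0 = 0.
  have [_ e] := diag2_mul lam lam^-1 y; rewrite Dy mxE in e.
  have : (lam ^+ 2 - 1) * y 1 0 = 0.
    by rewrite mulrBl mul1r expr2 -mulrA e mulrA divff ?gt_eqF// mul1r subrr.
  move/eqP; rewrite mulf_eq0 subr_eq0 => /orP[|/eqP//].
  by rewrite sqrp_eq1 ?ltW// (negPf lam_neq1).
have Dt : diag2 (lam `^ t) (lam `^ (- t)) *m y = lam `^ t *: y.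
  have [d0 d1] := diag2_mul (lam `^ t) (lam `^ (- t)) y.
  apply/colP; apply: ord2P; first by rewrite d0 [RHS]mxE.
  by rewrite d1 [RHS]mxE y1 !mulr0.
by rewrite /mxflow -!mulmxA -/y Dt -scalemxAr -yE.
Qed.

Theorem mainTheorem1 (R : realType) (A : 'M[int]_2) (P : 'M[R]_2) (lam a : R)
    (phi : R -> 'rV[R]_3 -> 'rV[R]_3)
    (detA : \det A = 1) (trA : 2 < \tr A)
    (P_unit : P \in unitmx) (lam_gt0 : 0 < lam) (lam_neq1 : lam != 1)
    (A_diag : map_mx intr A = P *m diag2 lam lam^-1 *m invmx P)
    (lam_irr : irrational lam) (lamV_irr : irrational lam^-1)
    (a_eigen : map_mx intr A *m slope_vec a = lam *: slope_vec a)
    (phi_flow : is_flow (torus_field lam a) phi) :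
  let Om := torus_forms P lam in
  let Om_rho := coinvariant Om (fun k : int => phi k%:~R) in
  let C_tau := divergence Om phi in
  [/\ (forall x : cohomology Om_rho 0, x = 0),
      (forall x : cohomology Om_rho 3, x = 0),
      infinite_dimensional (cohomology Om_rho 1) /\
      infinite_dimensional (cohomology Om_rho 2),
      forall p, lmod_isomorphic (cohomology C_tau p) (cohomology Om_rho p)
    & infinite_dimensional (cohomology C_tau 1) /\
      infinite_dimensional (cohomology C_tau 2)].
Proof.
have eigV := slope_vec_eigen P_unit lam_gt0 lam_neq1 A_diag a_eigen.
have phiE := flow_unique phi_flow; subst phi.
move=> Om Om_rho C_tau.
have iso := cohomology_isomorphic P_unit lam_gt0 lam_neq1 eigV.
have inf1 := H1_infinite P_unit lam_gt0 lam_neq1 eigV.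
have inf2 := H2_infinite P_unit lam_gt0 lam_neq1 eigV.
split.
- exact: H0_eq0 P_unit lam_gt0 lam_neq1 eigV.
- exact: H3_eq0 P_unit lam_gt0 eigV.
- exact: conj inf1 inf2.
- exact: iso.
- by split; [exact: infinite_dimensional_isomorphic (iso 1) inf1|
             exact: infinite_dimensional_isomorphic (iso 2) inf2].
Qed.
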